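(* Let $\mathfrak g$, $Q_m(\mathfrak g)$ and $R_i$ be as in the context, with $m$ an integer, $m>1$ and $m>\ell-1$. Let $\mathbb C(y)$ be the field of rational functions in $y_i(n)$, $i\in S$, $n\in d\mathbb Z/d'm\mathbb Z$, and put $a_i(n)=y_i(n)y_i(n+d_i)/F(i,n)$, where $F(i,n)=\prod_{j:\,v^i_n\to v^j_n}y_j(n+d_j)\prod_{j:\,v^j_n\to v^i_n}y_j(n)$ (products over $j$ such that the indicated arrow exists in $Q_m(\mathfrak g)$), except: $F(i,n)=y_{i-1}(n+\tfrac12)y_{i+1}(n)$ for $i=\ell$ in $B_\ell$ and $i=3$ in $F_4$; $F(i,n)=y_{i-1}(n+1)y_{i+1}(n)y_{i+1}(n+\tfrac12)$ for $i=\ell-1$ in $B_\ell$ and $i=2$ in $F_4$; $F(\ell,n)=y_{\ell-1}(n+1)y_{\ell-1}(n+2)$ in $C_\ell$; $F(2,n)=y_1(n+1)y_1(n+2)y_1(n+3)$ in $G_2$; here $y_0:=1$ and $y_{\ell+1}:=1$. Let $\mathbb C(a)$ be the subfield generated by the $a_i(n)$, $f_y(i,n)=1+\sum_{k=0}^{d'm/d_i-2}(a_i(n)a_i(n-d_i)\cdots a_i(n-kd_i))^{-1}$, and let $r_i$ be the field endomorphism of $\mathbb C(y)$ with $r_i(y_i(n))=\dfrac{f_y(i,n-2d_i)}{f_y(i,n-d_i)}\dfrac{F(i,n-d_i)}{y_i(n-d_i)}$, $r_i(y_j(n))=y_j(n)$ ($j\ne i$). Let $\mathbb C(\mathbf X)$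 be the field generated by the $X$-variables of $Q_m(\mathfrak g)$ and $\beta:\mathbb C(\mathbf X)\to\mathbb C(a)$, $X^i_n\mapsto a_i(n)^{-1}$. Then for each $i\in S$, $r_i(\mathbb C(a))\subseteq\mathbb C(a)$ and $r_i\circ\beta=\beta\circ R_i^\ast$ on $\mathbb C(\mathbf X)$; and the maps $r_i$ ($i\in S$) generate an action of the Weyl group $W(\mathfrak g)$ on $\mathbb C(y)$ (i.e. $s_i\mapsto r_i$ respects the Coxeter relations).
   Context: Let $\mathfrak g$ be a finite-dimensional complex simple Lie algebra of rank $\ell$, $S=\{1,\dots,\ell\}$, of type $A_\ell$, $B_\ell$, $C_\ell$, $D_\ell$ ($\ell\ge4$), $E_{6,7,8}$, $F_4$ or $G_2$, with simple roots labelled: for $A_\ell,B_\ell,C_\ell$ the chain $1-2-\cdots-\ell$ ($\alpha_\ell$ short in $B_\ell$, long in $C_\ell$); $D_\ell$: chain $1-\cdots-(\ell-1)$ plus edge $(\ell-2)-\ell$; $E_\ell$: chain $1-2-3-5-\cdots-\ell$ plus edge $3-4$; $F_4$: chain $1-2-3-4$, $\alpha_1,\alpha_2$ long; $G_2$: $\alpha_2$ long. $d_i=(\alpha_i,\alpha_i)/2$ normalized: $d_i=1$ in types $A,D,E$; $(1,\dots,1,\frac12)$ for $B_\ell$; $(1,\dots,1,2)$ for $C_\ell$; $(1,1,\frac12,\frac12)$ for $F_4$; $(1,3)$ for $G_2$; $d=\min d_i$, $d'=\max d_i$; $C_{ij}=2(\alpha_i,\alpha_j)/(\alpha_i,\alpha_i)$.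 $W(\mathfrak g)=\langle s_i\mid(s_is_j)^{m_{ij}}=1\rangle$ with $m_{ii}=1$ and $m_{ij}=2,3,4,6$ for $C_{ij}C_{ji}=0,1,2,3$. Quiver $Q_m(\mathfrak g)$ on $\{v^i_n: i\in S, n\in d\mathbb Z/d'm\mathbb Z\}$ with arrows (indices mod $d'm$): (simply-laced) orient Dynkin edges from larger to smaller label ($C(\mathfrak g)$); $v^i_n\to v^i_{n+1}$, and for each $i\to j$ in $C(\mathfrak g)$, $v^i_n\to v^j_n$ and $v^j_{n+1}\to v^i_n$. ($B_\ell$) $v^i_n\to v^i_{n+1}$ ($i\le\ell-1$); $v^i_n\to v^{i-1}_n$, $v^{i-1}_{n+1}\to v^i_n$ ($2\le i\le\ell-1$); $v^\ell_n\to v^\ell_{n+1/2}$, $v^\ell_n\to v^{\ell-1}_{n-1/2}$, $v^{\ell-1}_{n+1/2}\to v^\ell_n$. ($C_\ell$) $v^i_n\to v^i_{n+1}$ ($i\le\ell-1$); $v^i_n\to v^{i-1}_n$, $v^{i-1}_{n+1}\to v^i_n$ ($2\le i\le\ell-1$); $v^\ell_n\to v^\ell_{n+2}$, $v^\ell_n\to v^{\ell-1}_n$, $v^{\ell-1}_{n+2}\to v^\ell_n$. ($F_4$) $v^i_n\to v^i_{n+1}$ ($i=1,2$); $v^2_n\to v^1_n$, $v^1_{n+1}\to v^2_n$; $v^3_n\to v^3_{n+1/2}$, $v^3_n\to v^2_{n-1/2}$, $v^2_{n+1/2}\to v^3_n$; $v^4_n\to v^4_{n+1/2}$, $v^4_n\to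 v^3_n$, $v^3_{n+1/2}\to v^4_n$. ($G_2$) $v^1_n\to v^1_{n+1}$, $v^2_n\to v^2_{n+3}$, $v^2_n\to v^1_n$, $v^1_{n+3}\to v^2_n$. $\varepsilon_{uv}=\#\{u\to v\}-\#\{v\to u\}$; $X^i_n$ is the $X$-variable at $v^i_n$. Mutation at $k$: $\varepsilon'_{ij}=-\varepsilon_{ij}$ if $k\in\{i,j\}$, else $\varepsilon_{ij}+(|\varepsilon_{ik}|\varepsilon_{kj}+\varepsilon_{ik}|\varepsilon_{kj}|)/2$; $X'_k=X_k^{-1}$, $X'_i=X_i(1+X_k^{-\mathrm{sgn}(\varepsilon_{ik})})^{-\varepsilon_{ik}}$. For each $i$ the arrows $v^i_n\to v^i_{n+d_i}$ form $d_i/d$ oriented cycles $P_{i,\gamma}$; for an oriented cycle $P: v_1\to\cdots\to v_p\to v_1$, $R(P)=M(P)^{-1}\circ(v_{p-1},v_p)\circ\mu_{v_p}\mu_{v_{p-1}}\circ M(P)$ with $M(P)=\mu_{v_{p-2}}\cdots\mu_{v_1}$ and $(v_{p-1},v_p)$ the transposition of labels; $R_i=R(P_{i,1})\circ\cdots\circ R(P_{i,d_i/d})$ preserves $Q_m(\mathfrak g)$, and $R_i^\ast$ is the induced field automorphism of $\mathbb C(\mathbf X)$ ($R_i^\ast(X^j_n)$ = new $X$-variable at $v^j_n$ in terms of the initial ones).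
   Formalization: β need not be defined on all of ℂ(X) (for A_1, m=2, a(0)=a(1), so 1/(X_0−X_1) has no image); r_i∘β = β∘R_i^* is proved for every x=p/q with q(a^{-1})≠0, including that R_i^*x again lies in the domain of β. *)

(* Defs.v *)
From mathcomp Require Import all_boot all_order all_algebra.
From mathcomp Require Import mpoly complex Rstruct.
From Stdlib Require Rdefinitions.

Set Implicit Arguments.
Unset Strict Implicit.
Unset Printing Implicit Defensive.

Import Order.TTheory GRing.Theory Num.Theory.
Local Open Scope ring_scope.

Definition CC : fieldType := complex Rdefinitions.R.

(* Lie types.  Simple roots are labelled 1..l as in the paper.               *)
Inductive ltype := TA | TB | TC | TD | TE | TF | TG.

Definition valid_type (t : ltype) (l : nat) : bool :=
  match t with
  | TA => (1 <= l)%N | TB => (2 <= l)%N | TC => (2 <= l)%N | TD => (4 <= l)%N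
  | TE => [|| l == 6%N, l == 7%N | l == 8%N]
  | TF => l == 4%N | TG => l == 2%N
  end.

(* Times n range over d Z / d' m Z.  We work with the SCALED time n / d, an
   element of Z / N Z with N = (d'/d) m.  dsc t l i = d_i / d, dpr t = d'/d. *)
Definition dsc (t : ltype) (l i : nat) : nat :=
  match t with
  | TA | TD | TE => 1
  | TB => if i == l then 1 else 2      (* d = (1,..,1,1/2), d = 1/2 *)
  | TC => if i == l then 2 else 1      (* d = (1,..,1,2),   d = 1   *)
  | TF => if (i <= 2)%N then 2 else 1  (* d = (1,1,1/2,1/2), d = 1/2 *)
  | TG => if i == 2%N then 3 else 1    (* d = (1,3), d = 1 *)
  end.

Definition dpr (t : ltype) : nat :=
  match t with TA | TD | TE => 1 | TB | TC | TF => 2 | TG => 3 end.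

Definition Nsz (t : ltype) (m : nat) : nat := (dpr t * m)%N.

Definition Eseq (l : nat) : seq nat := [:: 1; 2; 3]%N ++ iota 5 (l - 4).

Definition chain_adj (s : seq nat) (i j : nat) : bool :=
  has (fun k => ((nth 0 s k == i) && (nth 0 s k.+1 == j)) ||
                ((nth 0 s k == j) && (nth 0 s k.+1 == i))) (iota 0 (size s).-1).

Definition adj (t : ltype) (l i j : nat) : bool :=
  match t with
  | TD => chain_adj (iota 1 l.-1) i j ||
          ((i == l.-2) && (j == l)) || ((j == l.-2) && (i == l))
  | TE => chain_adj (Eseq l) i j ||
          ((i == 3%N) && (j == 4%N)) || ((j == 3%N) && (i == 4%N))
  | _ => chain_adj (iota 1 l) i j
  end.

(* C_ij C_ji *)
Definition bond (t : ltype) (l i j : nat) : nat :=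
  if ~~ adj t l i j then 0%N else
  match t with
  | TB | TC => if ((i == l.-1) && (j == l)) || ((j == l.-1) && (i == l))
               then 2%N else 1%N
  | TF => if ((i == 2%N) && (j == 3%N)) || ((j == 2%N) && (i == 3%N))
          then 2%N else 1%N
  | TG => 3%N
  | _ => 1%N
  end.

Definition mcox (t : ltype) (l i j : nat) : nat :=
  if i == j then 1%N else
  match bond t l i j with 0 => 2 | 1 => 3 | 2 => 4 | _ => 6 end%N.

(* The quiver Q_m(g): raw arrows ((label, scaled time), (label, scaled time)),
   one entry per arrow, generated rule by rule for each vertex (i, n).       *)
Definition rawv := (nat * int)%type.

Definition rules (t : ltype) (l : nat) (i : nat) (n : int) : seq (rawv * rawv) :=
  match t with
  | TA | TD | TE =>
      ((i, n), (i, n + 1)) ::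
      flatten [seq [:: ((i, n), (j, n)); ((j, n + 1), (i, n))]
              | j <- iota 1 l & adj t l i j && (j < i)%N]
  | TB =>
      (if (i <= l.-1)%N then [:: ((i, n), (i, n + 2))] else [::]) ++
      (if (2 <= i <= l.-1)%N then
         [:: ((i, n), (i.-1, n)); ((i.-1, n + 2), (i, n))] else [::]) ++
      (if i == l then
         [:: ((l, n), (l, n + 1)); ((l, n), (l.-1, n - 1));
             ((l.-1, n + 1), (l, n))] else [::])
  | TC =>
      (if (i <= l.-1)%N then [:: ((i, n), (i, n + 1))] else [::]) ++
      (if (2 <= i <= l.-1)%N then
         [:: ((i, n), (i.-1, n)); ((i.-1, n + 1), (i, n))] else [::]) ++
      (if i == l then
         [:: ((l, n), (l, n + 2)); ((l, n), (l.-1, n));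
             ((l.-1, n + 2), (l, n))] else [::])
  | TF =>
      (if (i <= 2)%N then [:: ((i, n), (i, n + 2))] else [::]) ++
      (if i == 2%N then [:: ((2%N, n), (1%N, n)); ((1%N, n + 2), (2%N, n))]
       else [::]) ++
      (if i == 3%N then
         [:: ((3%N, n), (3%N, n + 1)); ((3%N, n), (2%N, n - 1));
             ((2%N, n + 1), (3%N, n))] else [::]) ++
      (if i == 4%N then
         [:: ((4%N, n), (4%N, n + 1)); ((4%N, n), (3%N, n));
             ((3%N, n + 1), (4%N, n))] else [::])
  | TG =>
      (if i == 1%N then [:: ((1%N, n), (1%N, n + 1))] else [::]) ++
      (if i == 2%N then
         [:: ((2%N, n), (2%N, n + 3)); ((2%N, n), (1%N, n));
             ((1%N, n + 3), (2%N, n))] else [::])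
  end.

Definition raw_arrows (t : ltype) (l N : nat) : seq (rawv * rawv) :=
  flatten [seq flatten [seq rules t l i (Posz n) | n <- iota 0 N]
          | i <- iota 1 l].

(* Vertices v^i_n : label i = (ordinal i-1), scaled time in Z/NZ. *)
Definition V (l N : nat) : finType := ('I_l * 'I_N)%type.

Definition ordmod (N : nat) (n0 : 'I_N) (k : int) : 'I_N :=
  insubd n0 `|(k %% (N : int))%Z|%N.

(* vertex with label i (1 <= i <= l) and scaled time n mod N; v0 only
   supplies witnesses that the index types are inhabited. *)
Definition vtx (l N : nat) (v0 : V l N) (i : nat) (n : int) : V l N :=
  (insubd v0.1 i.-1, ordmod v0.2 n).

Definition label (l N : nat) (v : V l N) : nat := (v.1 : nat).+1.
Definition time (l N : nat) (v : V l N) : int := Posz (v.2 : nat).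

Definition arrows (t : ltype) (l N : nat) (v0 : V l N) : seq (V l N * V l N) :=
  [seq (vtx v0 a.1.1 a.1.2, vtx v0 a.2.1 a.2.2) | a <- raw_arrows t l N].

Definition eps (t : ltype) (l N : nat) (u v : V l N) : int :=
  (count (pred1 (u, v)) (arrows t u))%:Z - (count (pred1 (v, u)) (arrows t u))%:Z.

Definition seed (W : finType) (K : fieldType) := ((W -> W -> int) * (W -> K))%type.

Definition mutate (W : finType) (K : fieldType) (k : W) (s : seed W K) : seed W K :=
  let e := s.1 in let X := s.2 in
  (fun i j => if (i == k) || (j == k) then - e i j
              else e i j + ((`|e i k| * e k j + e i k * `|e k j|) %/ 2)%Z,
   fun i => if i == k then (X k)^-1
            else X i * (1 + X k ^ (- sgz (e i k))) ^ (- e i k)).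

Definition swap_seed (W : finType) (K : fieldType) (a b : W) (s : seed W K) : seed W K :=
  let sg := fun u => if u == a then b else if u == b then a else u in
  (fun i j => s.1 (sg i) (sg j), fun i => s.2 (sg i)).

Inductive mop (W : finType) := Mu of W | Sw of W & W.

Definition run (W : finType) (K : fieldType) (ops : seq (mop W)) (s : seed W K) :=
  foldl (fun s o => match o with Mu k => mutate k s | Sw a b => swap_seed a b s end)
        s ops.

(* R(P) for P = v_1 -> ... -> v_p -> v_1, in order of application:
   mu_{v_1}, ..., mu_{v_{p-2}}, mu_{v_{p-1}}, mu_{v_p}, (v_{p-1} v_p),
   mu_{v_{p-2}}, ..., mu_{v_1}. *)
Definition Rops (W : finType) (P : seq W) : seq (mop W) :=
  match P with
  | [::] => [::]
  | x0 :: _ =>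
    let p := size P in
    let M := take (p - 2) P in
    [seq Mu v | v <- M] ++
    [:: Mu (nth x0 P (p - 2)); Mu (nth x0 P p.-1); Sw (nth x0 P (p - 2)) (nth x0 P p.-1)] ++
    [seq Mu v | v <- rev M]
  end.

(* the cycle P_{i,gamma}: v^i_{n_0} -> v^i_{n_0 + d_i} -> ..., listed from the
   scaled time gamma - 1 (gamma = 1 .. d_i/d). *)
Definition cyc (t : ltype) (l N : nat) (i : 'I_l) (gamma : nat) : seq (V l N) :=
  map (fun n : 'I_N => (i, n) : V l N)
      (filter (fun n : 'I_N => (n %% dsc t l i.+1 == gamma.-1)%N) (enum 'I_N)).

(* R_i = R(P_{i,1}) o ... o R(P_{i,d_i/d}); rightmost applied first *)
Definition Riops (t : ltype) (l N : nat) (i : 'I_l) : seq (mop (V l N)) :=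
  flatten [seq Rops (cyc t N i gamma) | gamma <- rev (iota 1 (dsc t l i.+1))].

Notation "x %:F" := (@FracField.tofrac _ x) : ring_scope.

Definition nv (l N : nat) : nat := #|{: V l N}|.
Definition Pol (l N : nat) := {mpoly CC[nv l N]}.
Definition RF (l N : nat) : fieldType := {fraction Pol l N}.

Definition cst (l N : nat) (c : CC) : RF l N := (c%:MP : Pol l N)%:F.

(* the variable attached to vertex v (X^i_n in C(X), y_i(n) in C(y)) *)
Definition var (l N : nat) (v : V l N) : RF l N :=
  ('X_(enum_rank v) : Pol l N)%:F.

Definition mev (l N : nat) (h : V l N -> RF l N) (p : Pol l N) : RF l N :=
  mmap (@cst l N) (fun k => h (enum_val k)) p.

Definition subst (l N : nat) (h : V l N -> RF l N) (x : RF l N) : RF l N :=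
  mev h (\n_(repr x)) / mev h (\d_(repr x)).

Definition yv (l N : nat) (v0 : V l N) (j : nat) (n : int) : RF l N :=
  if (1 <= j <= l)%N then var (vtx v0 j n) else 1.

Definition Fdef (t : ltype) (l N : nat) (v : V l N) : RF l N :=
  let i := label v in let n := time v in
  (\prod_(j <- iota 1 l | (v, vtx v j n) \in arrows t v)
      yv v j (n + (dsc t l j)%:Z)) *
  (\prod_(j <- iota 1 l | (vtx v j n, v) \in arrows t v) yv v j n).

Definition Fy (t : ltype) (l N : nat) (v : V l N) : RF l N :=
  let i := label v in let n := time v in
  match t with
  | TB => if i == l then yv v i.-1 (n + 1) * yv v i.+1 n
          else if i == l.-1 then yv v i.-1 (n + 2) * yv v i.+1 n * yv v i.+1 (n + 1)
          else Fdef t v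
  | TF => if i == 3%N then yv v i.-1 (n + 1) * yv v i.+1 n
          else if i == 2%N then yv v i.-1 (n + 2) * yv v i.+1 n * yv v i.+1 (n + 1)
          else Fdef t v
  | TC => if i == l then yv v l.-1 (n + 1) * yv v l.-1 (n + 2) else Fdef t v
  | TG => if i == 2%N then yv v 1 (n + 1) * yv v 1 (n + 2) * yv v 1 (n + 3)
          else Fdef t v
  | _ => Fdef t v
  end.

Definition ay (t : ltype) (l N : nat) (v : V l N) : RF l N :=
  let i := label v in let n := time v in
  var v * yv v i (n + (dsc t l i)%:Z) / Fy t v.

(* f_y(i, n) = 1 + sum_{k=0}^{d'm/d_i - 2} (a_i(n) a_i(n-d_i) ... a_i(n-k d_i))^{-1};
   d'm/d_i = N / (d_i/d). *)
Definition fy (t : ltype) (l N : nat) (v : V l N) : RF l N :=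
  let i := label v in let n := time v in let D := dsc t l i in
  1 + \sum_(k < (N %/ D).-1)
        (\prod_(s < k.+1) ay t (vtx v i (n - (s * D)%:Z)))^-1.

Definition rimg (t : ltype) (l N : nat) (i : 'I_l) (v : V l N) : RF l N :=
  if v.1 == i then
    let n := time v in let D := (dsc t l i.+1)%:Z in
    fy t (vtx v i.+1 (n - 2 * D)) / fy t (vtx v i.+1 (n - D)) *
    (Fy t (vtx v i.+1 (n - D)) / var (vtx v i.+1 (n - D)))
  else var v.

Definition rmap (t : ltype) (l N : nat) (i : 'I_l) : RF l N -> RF l N :=
  subst (rimg t i).

Definition Rstar (t : ltype) (l N : nat) (i : 'I_l) : RF l N -> RF l N :=
  subst (fun v => (run (Riops t N i) (@eps t l N, @var l N)).2 v).

Definition inCa (t : ltype) (l N : nat) (z : RF l N) : Prop :=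
  exists p q : Pol l N, mev (@ay t l N) q != 0 /\
                        z = mev (@ay t l N) p / mev (@ay t l N) q.

(* beta : C(X) -> C(a), X^i_n |-> a_i(n)^{-1}, as the graph relation
   "beta x = z" (beta is defined on those x = p/q with q(a^{-1}) != 0). *)
Definition beta_rel (t : ltype) (l N : nat) (x z : RF l N) : Prop :=
  let b := mev (fun v => (ay t v)^-1) in
  exists p q : Pol l N, [/\ b q != 0, x = p%:F / q%:F & z = b p / b q].

(* Main.v *)
(** Put q = 1/a and f(n) = 1 + q(n) + q(n) q(n-D) + ... along one cycle of length p.
    If A is the product of all q on the cycle, f is the periodic solution of
    f(n) = 1 - A + q(n) f(n-D), unique because A <> 1 (compare degrees).  It follows
    that y' = r_i(y) satisfies the Riccati identity
      y'(n) + F(n) / y'(n+D) = y(n) + F(n) / y(n+D),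
    that r_i is an involution, and that r_i(q(n)) = f(n) / (f(n-2D) q(n-D)).

    Mutating along a cycle multiplies the X-variables by partial sums of f, and the
    resulting formulas for the X-variables of R_i are exactly those of r_i on q.
    Everything is subtraction-free, so the exceptional loci of the partially defined
    specialization beta are never met.

    Coxeter relations: by the Riccati identities the two reflections of a rank 2
    subsystem fix the q-characters of its two fundamental representations.  Both
    reduced words of the longest element send the y-variables to solutions of the
    equations "q-character = constant" whose leading terms are prescribed by a
    grading, and such solutions agree to any order, by contraction in degree. *)

(* Substituting rational functions is only partially defined, and [rmap] evaluates one chosen
   fraction, so [r_i] is not known in advance to be a morphism. Its involutivity is therefore proved
   for the graph [prel] of the substitution. A substitution that is its own inverse has
   algebraically independent images, which makes it a field morphism; [R_i^*] is handled in the same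
   way. The braid relations cannot be expanded by hand, because the number of terms of f grows with
   m. The grading is a strictly dominant functional on weights. Along a reduced word each reflection
   acts where the simple root has positive degree, so f is 1 plus terms of negative degree, and
   degrees move as under the Weyl group. After the longest element they are negated, and the lowest
   weight monomial, a coefficient over one variable, strictly dominates its character; the equation
   can be solved for that variable. The returning half of R(P) is never computed: the claimed answer
   is mutated forward and compared with the seed after the exchange. *)
From HB Require Import structures.
Require Import Defs.
From mathcomp Require Import all_boot all_order all_algebra.
From mathcomp Require Import mpoly complex Rstruct ring zify.

Set Implicit Arguments.
Unset Strict Implicit.
Unset Printing Implicit Defensive.

Import Order.TTheory GRing.Theory Num.Theory.
Local Open Scope ring_scope.

(* The field K of rational functions in variables indexed by I, as the fraction
   field of a polynomial ring P.  [rf_grade w] sends the variable X_i to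
   X_i T^(w i); [rf_at1] evaluates every variable at 1. *)
Record ratfun (I : Type) := RatFun {
  rf_C : fieldType;
  rf_P : idomainType;
  rf_K :> fieldType;
  rf_cst : rf_C -> rf_P;
  rf_X : I -> rf_P;
  rf_frac : {rmorphism rf_P -> rf_K};
  rf_num : rf_K -> rf_P;
  rf_den : rf_K -> rf_P;
  rf_ev : (I -> rf_K) -> {rmorphism rf_P -> rf_K};
  rf_grade : (I -> nat) -> {rmorphism rf_P -> {poly rf_P}};
  rf_at1 : {rmorphism rf_P -> rf_C};
  rf_char0 : forall n, n.+1%:R != 0 :> rf_C;
  rf_ind : forall Q : rf_P -> Prop,
    (forall c, Q (rf_cst c)) -> (forall i, Q (rf_X i)) ->
    (forall p q, Q p -> Q q -> Q (p + q)) ->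
    (forall p q, Q p -> Q q -> Q (p * q)) -> forall p, Q p;
  rf_cst0 : rf_cst 0 = 0;
  rf_cstN1 : rf_cst (-1) = -1;
  rf_frac_eq0 : forall p, (rf_frac p == 0) = (p == 0);
  rf_numden : forall x, x = rf_frac (rf_num x) / rf_frac (rf_den x);
  rf_den_neq0 : forall x, rf_den x != 0;
  rf_evC : forall h c, rf_ev h (rf_cst c) = rf_frac (rf_cst c);
  rf_evX : forall h i, rf_ev h (rf_X i) = h i;
  rf_gradeC : forall w c, rf_grade w (rf_cst c) = (rf_cst c)%:P;
  rf_gradeX : forall w i, rf_grade w (rf_X i) = (rf_X i)%:P * 'X^(w i);
  rf_at1X : forall i, rf_at1 (rf_X i) = 1
}.

(** * Partial substitutions, subtraction-free elements and degree in a rational function field *)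

Section RationalSubstitution.
Variables (I : Type) (A : ratfun I).
Local Notation K := (rf_K A).
Local Notation P := (rf_P A).
Local Notation ev := (@rf_ev I A).
Local Notation fr := (@rf_frac I A).
Implicit Types (h : I -> K) (x y z : K) (p q : P).

Definition rvar i : K := fr (rf_X A i).
Definition rcst c : K := fr (rf_cst c).

Lemma rf_fracP x : exists p q, q != 0 /\ x = fr p / fr q.
Proof. by exists (rf_num x), (rf_den x); split; [exact: rf_den_neq0 | exact: rf_numden]. Qed.

Lemma rcst0 : rcst 0 = 0. Proof. by rewrite /rcst rf_cst0 rmorph0. Qed.
Lemma rcstN1 : rcst (-1) = -1. Proof. by rewrite /rcst rf_cstN1 rmorphN1. Qed.

Lemma frac_inj p q : fr p = fr q -> p = q.
Proof.
by move=> E; apply/eqP; rewrite -subr_eq0 -rf_frac_eq0 rmorphB E subrr.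
Qed.

(** Graph of the partial homomorphism given by [h]: defined at x as soon as some fraction for x has
    a denominator that survives [ev h]. The relation avoids chosen representatives and needs no
    hypothesis on [h]. *)
Definition prel h x z :=
  exists p q, [/\ ev h q != 0, x = fr p / fr q & z = ev h p / ev h q].

Lemma ev_frac_neq0 h q : ev h q != 0 -> fr q != 0.
Proof. by rewrite rf_frac_eq0; apply: contra => /eqP ->; rewrite rmorph0. Qed.

Lemma prel_fun h x z z' : prel h x z -> prel h x z' -> z = z'.
Proof.
case=> p [q [hq -> ->]] [p' [q' [hq' E ->]]].
apply/eqP; rewrite eqr_div //; apply/eqP; rewrite -!rmorphM; congr (ev h _).
apply: frac_inj; rewrite !rmorphM.
by move/eqP: E; rewrite eqr_div ?(ev_frac_neq0 hq) ?(ev_frac_neq0 hq') // => /eqP.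
Qed.

Lemma prel_pol h p : prel h (fr p) (ev h p).
Proof. by exists p, 1; rewrite !rmorph1 !divr1 oner_eq0. Qed.

Lemma prel_var h v : prel h (rvar v) (h v).
Proof. by rewrite -[h v](rf_evX h); apply: prel_pol. Qed.

Lemma prel_cst h c : prel h (rcst c) (rcst c).
Proof. by rewrite {2}/rcst -(rf_evC h); apply: prel_pol. Qed.

Lemma prel_add h x x' z z' : prel h x z -> prel h x' z' -> prel h (x + x') (z + z').
Proof.
case=> p [q [hq -> ->]] [p' [q' [hq' -> ->]]].
exists (p * q' + p' * q), (q * q'); rewrite !rmorphD !rmorphM mulf_neq0 //=.
by rewrite !addf_div ?(ev_frac_neq0 hq) ?(ev_frac_neq0 hq') // !rmorphD !rmorphM.
Qed.

Lemma prel_mul h x x' z z' : prel h x z -> prel h x' z' -> prel h (x * x') (z * z').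
Proof.
case=> p [q [hq -> ->]] [p' [q' [hq' -> ->]]].
exists (p * p'), (q * q'); rewrite !rmorphM mulf_neq0 //=.
by rewrite !mulf_div.
Qed.

Lemma prel_inv h x z : z != 0 -> prel h x z -> prel h x^-1 z^-1.
Proof.
move=> z0 [p [q [hq -> Ez]]]; exists q, p; split; last by rewrite Ez invf_div.
  by apply: contra z0 => /eqP E; rewrite Ez E mul0r.
by rewrite invf_div.
Qed.

Lemma prel_1 h : prel h 1 1.
Proof. by have := prel_pol h 1; rewrite !rmorph1. Qed.

Lemma prel_prod h (J : Type) (r : seq J) (Q : pred J) (F G : J -> K) :
  (forall i, Q i -> prel h (F i) (G i)) ->
  prel h (\prod_(i <- r | Q i) F i) (\prod_(i <- r | Q i) G i).
Proof. by move=> FG; elim/big_ind2: _ => //; [exact: prel_1 | move=> *; exact: prel_mul]. Qed.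

Lemma prel_sum h (J : Type) (r : seq J) (Q : pred J) (F G : J -> K) :
  (forall i, Q i -> prel h (F i) (G i)) ->
  prel h (\sum_(i <- r | Q i) F i) (\sum_(i <- r | Q i) G i).
Proof.
move=> FG; elim/big_ind2: _ => // [|*]; last exact: prel_add.
by rewrite -rcst0; apply: prel_cst.
Qed.

Lemma prel_ev h (k k' : I -> K) p :
  (forall v, prel h (k v) (k' v)) -> prel h (ev k p) (ev k' p).
Proof.
move=> kk'; elim/rf_ind: p => [c|v|p q Pp Pq|p q Pp Pq].
- by rewrite !rf_evC; apply: prel_cst.
- by rewrite !rf_evX.
- by rewrite !rmorphD; apply: prel_add.
- by rewrite !rmorphM; apply: prel_mul.
Qed.

Lemma ev_rvar p : ev rvar p = fr p.
Proof.
elim/rf_ind: p => [c|v|p q Pp Pq|p q Pp Pq].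
- by rewrite !rf_evC.
- by rewrite !rf_evX.
- by rewrite !rmorphD Pp Pq.
- by rewrite !rmorphM Pp Pq.
Qed.

Definition rsubst h x := ev h (rf_num x) / ev h (rf_den x).

Definition alg_indep h := forall q, ev h q = 0 -> q = 0.

(** An inverse [k] transports a relation q(h) = 0 to q = 0 among the variables themselves.
    Well-definedness of r_i and R_i^* is deduced in this way from their involutivity. *)
Lemma alg_indep_inverse h k :
  (forall v, prel k (h v) (rvar v)) -> alg_indep h.
Proof.
move=> hk q q0; apply/eqP; rewrite -rf_frac_eq0 -ev_rvar; apply/eqP.
apply: (prel_fun (prel_ev q hk)); rewrite q0.
by rewrite -rcst0; apply: prel_cst.
Qed.

Section Indep.
Variables (h : I -> K) (ih : alg_indep h).

Lemma alg_indep_neq0 q : q != 0 -> ev h q != 0.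
Proof. by apply: contra => /eqP /ih ->. Qed.

Lemma rsubst_prel x : prel h x (rsubst h x).
Proof.
exists (rf_num x), (rf_den x); split => //; last exact: rf_numden.
by apply: alg_indep_neq0; exact: rf_den_neq0.
Qed.

Lemma prel_rsubstE x z : prel h x z -> rsubst h x = z.
Proof. exact: prel_fun (rsubst_prel x). Qed.

Lemma rsubst_is_zmod_morphism : zmod_morphism (rsubst h).
Proof.
move=> x y; apply: prel_rsubstE; apply: prel_add (rsubst_prel x) _.
rewrite -mulN1r -[- rsubst h y]mulN1r; apply: prel_mul (rsubst_prel y).
by rewrite -rcstN1; apply: prel_cst.
Qed.

Lemma rsubst_is_monoid_morphism : monoid_morphism (rsubst h).
Proof.
split=> [|x y]; apply: prel_rsubstE; first exact: prel_1.
exact: prel_mul (rsubst_prel x) (rsubst_prel y).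
Qed.

Lemma rsubst_cst c : rsubst h (rcst c) = rcst c.
Proof. exact/prel_rsubstE/prel_cst. Qed.

Lemma rsubst_var v : rsubst h (rvar v) = h v.
Proof. exact/prel_rsubstE/prel_var. Qed.

End Indep.

Lemma ratfun_morph_ext (f g : {rmorphism K -> K}) :
  (forall c, f (rcst c) = g (rcst c)) ->
  (forall v, f (rvar v) = g (rvar v)) -> f =1 g.
Proof.
move=> fgc fgv x; have [p [q [_ ->]]] := rf_fracP x.
have fg r : f (fr r) = g (fr r).
  elim/rf_ind: r => [c|v|p' q' E E'|p' q' E E']; first exact: fgc.
  - exact: fgv.
  - by rewrite !rmorphD E E'.
  - by rewrite !rmorphM E E'.
by rewrite !fmorph_div !fg.
Qed.

(* Subtraction-free elements; setting all variables to 1 shows that they are nonzero. *)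
Inductive sf : K -> Prop :=
| sf_var v : sf (rvar v)
| sf_1 : sf 1
| sf_add x y : sf x -> sf y -> sf (x + y)
| sf_mul x y : sf x -> sf y -> sf (x * y)
| sf_inv x : sf x -> sf x^-1.

Lemma sf_neq0 x : sf x -> x != 0.
Proof.
pose pos p := exists n : nat, rf_at1 A p = n.+1%:R.
have pos_neq0 p : pos p -> p != 0.
  case=> n E; apply: contra_eq_neq E => ->; rewrite rmorph0 eq_sym; exact: rf_char0.
have posM p q : pos p -> pos q -> pos (p * q).
  move=> [n E] [n' E']; exists (n * n'.+1 + n')%N.
  by rewrite rmorphM E E' -natrM; congr (_%:R); lia.
have posD p q : pos p -> pos q -> pos (p + q).
  move=> [n E] [n' E']; exists (n + n'.+1)%N.
  by rewrite rmorphD E E' -natrD; congr (_%:R); lia.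
suff H : sf x -> exists p q, [/\ pos p, pos q & x = fr p / fr q].
  move=> /H [p [q [/pos_neq0 p0 /pos_neq0 q0 ->]]].
  by rewrite mulf_neq0 ?invr_eq0 ?rf_frac_eq0.
elim=> [v||{}x y _ [p [q [pp pq ->]]] _ [p' [q' [pp' pq' ->]]]|
        {}x y _ [p [q [pp pq ->]]] _ [p' [q' [pp' pq' ->]]]|{}x _ [p [q [pp pq ->]]]].
- exists (rf_X A v), 1; rewrite rmorph1 divr1; split => //.
  + by exists 0%N; rewrite rf_at1X.
  + by exists 0%N; rewrite rmorph1.
- exists 1, 1; rewrite rmorph1 divr1; split => //; by exists 0%N; rewrite rmorph1.
- exists (p * q' + p' * q), (q * q'); split; [apply: posD | |]; rewrite ?posM //.
  + exact: posM. + exact: posM. + exact: posM.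
  by rewrite addf_div ?rf_frac_eq0 ?pos_neq0 // rmorphD !rmorphM.
- exists (p * p'), (q * q'); split; try exact: posM.
  by rewrite mulf_div !rmorphM.
- by exists q, p; rewrite invf_div.
Qed.

Lemma sf_div x y : sf x -> sf y -> sf (x / y).
Proof. by move=> ? ?; apply: sf_mul => //; apply: sf_inv. Qed.

Lemma sf_prod (J : Type) (r : seq J) (Q : pred J) (F : J -> K) :
  (forall i, Q i -> sf (F i)) -> sf (\prod_(i <- r | Q i) F i).
Proof. by move=> FP; elim/big_ind: _ => //; [exact: sf_1 | exact: sf_mul]. Qed.

Lemma sf_1sum (J : Type) (r : seq J) (Q : pred J) (F : J -> K) :
  (forall i, Q i -> sf (F i)) -> sf (1 + \sum_(i <- r | Q i) F i).
Proof.
move=> FP; apply: (big_rec (fun z => sf (1 + z))) => [|i z Pi sz].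
  by rewrite addr0; apply: sf_1.
by rewrite addrCA; apply: sf_add => //; apply: FP.
Qed.

(* The weighted degree: the degree in T after X_i |-> X_i T^(w i). *)
Section Degree.
Variable w : I -> nat.

Local Notation wpol := (rf_grade A w).

Lemma wpol_at1 p : (wpol p).[1] = p.
Proof.
elim/rf_ind: p => [c|v|p q Pp Pq|p q Pp Pq].
- by rewrite rf_gradeC hornerC.
- by rewrite rf_gradeX hornerM hornerC hornerXn expr1n mulr1.
- by rewrite rmorphD hornerD Pp Pq.
- by rewrite rmorphM hornerM Pp Pq.
Qed.

Lemma wpol_eq0 p : (wpol p == 0) = (p == 0).
Proof.
apply/eqP/eqP => [E|->]; last exact: rmorph0.
by rewrite -[p]wpol_at1 E horner0.
Qed.

(** Equals -1 at 0 instead of minus infinity, hence the separate clause p == 0 in [dle]. *)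
Definition wdeg p : int := (size (wpol p))%:Z - 1.

Lemma wdegM p q : p != 0 -> q != 0 -> wdeg (p * q) = wdeg p + wdeg q.
Proof.
move=> p0 q0; rewrite /wdeg rmorphM size_mul ?wpol_eq0 //.
have: (0 < size (wpol p))%N by rewrite lt0n size_poly_eq0 wpol_eq0.
have: (0 < size (wpol q))%N by rewrite lt0n size_poly_eq0 wpol_eq0.
lia.
Qed.

(* [dle x B]: the degree of x is at most B (0 has degree -oo). *)
Definition dle x (B : int) := exists p q,
  [/\ q != 0, x = fr p / fr q & (p == 0) || (wdeg p - wdeg q <= B)].

Lemma dle0 B : dle 0 B.
Proof. by exists 0, 1; rewrite oner_eq0 eqxx rmorph0 mul0r. Qed.

Lemma dleM x y B C : dle x B -> dle y C -> dle (x * y) (B + C).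
Proof.
case=> p [q [q0 -> H]] [p' [q' [q0' -> H']]].
exists (p * p'), (q * q'); rewrite mulf_neq0 // mulf_div !rmorphM mulf_eq0.
split=> //; have [//|p0] := eqVneq p 0; have [//|p0'] := eqVneq p' 0.
rewrite (negPf p0) (negPf p0') /= in H H' *.
by rewrite !wdegM //; move: H H'; lia.
Qed.

Lemma dleD x y B : dle x B -> dle y B -> dle (x + y) B.
Proof.
case=> p [q [q0 -> H]] [p' [q' [q0' -> H']]].
exists (p * q' + p' * q), (q * q'); rewrite mulf_neq0 //.
rewrite addf_div ?rf_frac_eq0 // !rmorphD !rmorphM; split=> //.
have [->|p0] := eqVneq p 0.
  rewrite mul0r add0r mulf_eq0 (negPf q0) orbF; have [//|p0'] := eqVneq p' 0.
  by rewrite (negPf p0') /= in H' *; rewrite !wdegM //; move: H'; lia.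
have [->|p0'] := eqVneq p' 0.
  rewrite mul0r addr0 mulf_eq0 (negPf q0') orbF (negPf p0) in H *.
  by rewrite !wdegM //; move: H; rewrite /=; lia.
rewrite (negPf p0) (negPf p0') /= in H H'; apply/orP; right.
have E1 := wdegM p0 q0'; have E2 := wdegM p0' q0; have E3 := wdegM q0 q0'.
have sz : (size (wpol (p * q' + p' * q)%R) <=
           maxn (size (wpol (p * q')%R)) (size (wpol (p' * q)%R)))%N.
  by rewrite rmorphD; exact: size_polyD.
by rewrite E3; rewrite /wdeg in E1 E2 E3 H H' *; lia.
Qed.

Lemma dleN x B : dle x B -> dle (- x) B.
Proof.
case=> p [q [q0 -> H]]; exists (- p), q; rewrite rmorphN mulNr oppr_eq0; split=> //.
by rewrite /wdeg rmorphN size_polyN.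
Qed.

Lemma dleW x B C : B <= C -> dle x B -> dle x C.
Proof.
move=> BC [p [q [q0 -> H]]]; exists p, q; split=> //.
by case/orP: H => [->//|H]; rewrite (le_trans H BC) orbT.
Qed.

(** The degree filtration is separated, so a difference whose degree lies below every bound
    vanishes. This closes the contraction argument. *)
Lemma dle_lb x : x != 0 -> exists B, ~ dle x B.
Proof.
have [p [q [q0 ->]]] := rf_fracP x => x0.
have p0 : p != 0 by apply: contraNneq x0 => ->; rewrite rmorph0 mul0r.
exists (wdeg p - wdeg q - 1) => -[p' [q' [q0' E H]]].
move/eqP: E; rewrite eqr_div ?rf_frac_eq0 // -!rmorphM => /eqP /frac_inj E.
have p0' : p' != 0.
  apply: contra_eq_neq E => ->; rewrite mul0r mulf_neq0 //.
have := wdegM p0 q0'; rewrite E wdegM //.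
by move: H; rewrite (negPf p0') /=; lia.
Qed.

(* Exact degree; the clause on the inverse is the lower bound. *)
Definition deg_is x (d : int) := [/\ x != 0, dle x d & dle x^-1 (- d)].

Lemma deg_isP x : x != 0 -> exists d, deg_is x d.
Proof.
have [p [q [q0 ->]]] := rf_fracP x => x0.
have p0 : p != 0 by apply: contraNneq x0 => ->; rewrite rmorph0 mul0r.
exists (wdeg p - wdeg q); split=> //; first by exists p, q; rewrite q0 lexx orbT.
by exists q, p; split; rewrite ?p0 ?invf_div ?opprB ?lexx ?orbT.
Qed.

Lemma dle10 : dle 1 0.
Proof. by exists 1, 1; rewrite oner_eq0 rmorph1 divr1 subrr lexx orbT. Qed.

Lemma dle1_ge0 B : dle 1 B -> 0 <= B.
Proof.
case=> p [q [q0 E H]]; move: E => /eqP; rewrite eq_sym.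
rewrite -[1]divr1 eqr_div ?oner_eq0 ?rf_frac_eq0 // mulr1 mul1r => /eqP /frac_inj E.
by move: H; rewrite E (negPf q0) subrr.
Qed.

Lemma deg_is1 : deg_is 1 0.
Proof. by split; rewrite ?oner_eq0 ?invr1 ?oppr0 //; apply: dle10. Qed.

Lemma deg_isM x y d e : deg_is x d -> deg_is y e -> deg_is (x * y) (d + e).
Proof.
move=> [x0 xd xd'] [y0 ye ye']; split; first exact: mulf_neq0.
  exact: dleM.
by rewrite invfM opprD; apply: dleM.
Qed.

Lemma deg_isV x d : deg_is x d -> deg_is x^-1 (- d).
Proof. by move=> [x0 xd xd']; split; rewrite ?invr_eq0 // invrK opprK. Qed.

Lemma deg_is_fun x d e : deg_is x d -> deg_is x e -> d = e.
Proof.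
move=> [x0 xd xd'] [_ xe xe']; have := dleM xd xe'; have := dleM xe xd'.
by rewrite divff // => /dle1_ge0 ? /dle1_ge0; lia.
Qed.

Lemma deg_is_prod (J : Type) (r : seq J) (Q : pred J) (F : J -> K) (d : J -> int) :
  (forall i, Q i -> deg_is (F i) (d i)) ->
  deg_is (\prod_(i <- r | Q i) F i) (\sum_(i <- r | Q i) d i).
Proof.
by move=> FP; elim/big_ind2: _ => //; [exact: deg_is1 | move=> *; exact: deg_isM].
Qed.

Lemma deg_is_var v : deg_is (rvar v) (w v)%:Z.
Proof.
have E : wdeg (rf_X A v) = w v.
  rewrite /wdeg rf_gradeX mul_polyC size_scale ?size_polyXn; first lia.
  by rewrite -rf_frac_eq0; apply/sf_neq0/sf_var.
have x0 : rvar v != 0 by apply/sf_neq0/sf_var.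
have [d [_ H1 H2]] := deg_isP x0.
have n0 : rf_X A v != 0 by rewrite -rf_frac_eq0; exact: x0.
have w1 : wdeg 1 = 0 by rewrite /wdeg rmorph1 size_poly1.
split=> //.
  exists (rf_X A v), 1; rewrite oner_eq0 rmorph1 divr1; split=> //.
  by rewrite E w1 subr0 lexx orbT.
exists 1, (rf_X A v); rewrite rmorph1 div1r n0; split=> //.
by rewrite E w1 sub0r lexx orbT.
Qed.

(** Terms of negative degree cannot cancel the leading term 1. Applied to f when q has negative
    degree. *)
Lemma deg_is_1add x B : B < 0 -> dle x B -> deg_is (1 + x) 0.
Proof.
move=> B0 xB; have x1 : 1 + x != 0.
  apply/eqP => E; suff : dle 1 B by move/dle1_ge0; lia.
  by rewrite -[1](addrK x) E sub0r; apply: dleN.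
have [d dP] := deg_isP x1; suff <- : d = 0 by [].
have [_ D D'] := dP.
have d0 : dle (1 + x) 0 by apply: dleD dle10 (dleW _ xB); lia.
have := dleM d0 D'; rewrite divff // => /dle1_ge0 dle_d0.
apply/eqP; rewrite eq_le; apply/andP; split; first lia.
rewrite leNgt; apply/negP => dlt.
suff : dle 1 (Num.max B d) by move/dle1_ge0; lia.
rewrite -[1](addrK x); apply: dleD; first by apply: dleW D; lia.
by apply: dleN; apply: dleW xB; lia.
Qed.

End Degree.

End RationalSubstitution.

(** * q-characters in rank 2 and their invariance *)

(* The q-characters of the two fundamental representations in rank 2; [g] is
   the bond multiplicity, [al] belongs to the short root, [e] is a coefficient. *)
Section Characters.
Variable K : fieldType.
Implicit Types al p e : nat -> K.

Definition chars g al p e : K :=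
  match g with
  | 1 => al 0%N + p 0%N / al 1%N + e 0%N / p 1%N
  | 2 => al 0%N + p 0%N / al 1%N + e 0%N * al 2%N / p 2%N + e 0%N / al 3%N
  | _ => al 0%N + p 0%N / al 1%N + al 2%N * al 3%N / p 3%N + al 2%N / al 4%N +
         p 2%N / (al 3%N * al 4%N) + al 5%N / p 5%N + 1 / al 6%N
  end.

(** For g = 3 there are 15 monomials, three of them of weight zero: this fundamental representation
    of the quantum affine algebra restricts to the 14-dimensional adjoint representation plus a
    trivial one. *)
Definition charl g al p e : K :=
  match g with
  | 1 => p 0%N + e 0%N * al 1%N / p 1%N + e 0%N / al 2%N
  | 2 => p 0%N + e 0%N * al 1%N * al 2%N / p 2%N + e 0%N * al 1%N / al 3%N +
         e 0%N * p 1%N / (al 2%N * al 3%N) + e 0%N * e 1%N / p 3%N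
  | _ => p 0%N + al 1%N * al 2%N * al 3%N / p 3%N + al 1%N * al 2%N / al 4%N +
         al 1%N * p 2%N / (al 3%N * al 4%N) +
         p 1%N * p 2%N / (al 2%N * al 3%N * al 4%N) +
         al 1%N * al 5%N / p 5%N + p 1%N * al 5%N / (al 2%N * p 5%N) +
         p 2%N / p 4%N + al 3%N * al 4%N * al 5%N / (p 4%N * p 5%N) +
         al 1%N / al 6%N + p 1%N / (al 2%N * al 6%N) +
         al 3%N * al 4%N / (al 6%N * p 4%N) + al 3%N / (al 5%N * al 6%N) +
         p 3%N / (al 4%N * al 5%N * al 6%N) + 1 / p 6%N
  end.

Definition sprod g al k := \prod_(s < g) al (k + s.+1)%N.

Variables (g : nat) (al al' p p' e : nat -> K).
Hypothesis g13 : (0 < g <= 3)%N.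
Hypothesis e1 : g = 3%N -> forall k, e k = 1.
Hypotheses (al0 : forall k, al k != 0) (al'0 : forall k, al' k != 0).
Hypotheses (p0 : forall k, p k != 0) (p'0 : forall k, p' k != 0).

Let short_inv :=
  forall k, al' k + p k / al' k.+1 = al k + p k / al k.+1.
Let long_inv := forall k, p' k + e k * sprod g al k / p' (k + g)%N =
                          p k + e k * sprod g al k / p (k + g)%N.

Let g_cases : [\/ g = 1%N, g = 2%N | g = 3%N].
Proof. by case: g g13 => [|[|[|[|]]]] //; constructor. Qed.

(** Grouped into strings for the short root, the character is a polynomial in the invariant
    combinations [T], with coefficients free of [al]: this is its restriction to a rank 1
    subalgebra. The next three lemmas follow the same pattern. *)
Lemma chars_short : short_inv -> chars g al' p e = chars g al p e.
Proof.
move=> H; pose T (a : nat -> K) k := a k + p k / a k.+1.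
have HT k : T al' k = T al k by apply: H.
case: g_cases => -> /=.
- have E a : a 0%N + p 0%N / a 1%N + e 0%N / p 1%N = T a 0%N + e 0%N / p 1%N by [].
  by rewrite !E HT.
- have E a : (forall k, a k != 0) -> a 0%N + p 0%N / a 1%N + e 0%N * a 2%N / p 2%N +
      e 0%N / a 3%N = T a 0%N + e 0%N / p 2%N * T a 2%N.
    by move=> a0; rewrite /T; field; rewrite ?a0 ?p0.
  by rewrite !E ?HT.
- have E a : (forall k, a k != 0) ->
      a 0%N + p 0%N / a 1%N + a 2%N * a 3%N / p 3%N + a 2%N / a 4%N +
      p 2%N / (a 3%N * a 4%N) + a 5%N / p 5%N + 1 / a 6%N =
      T a 0%N + (T a 2%N * T a 3%N - p 2%N) / p 3%N + T a 5%N / p 5%N.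
    by move=> a0; rewrite /T; field; rewrite ?a0 ?p0.
  by rewrite !E ?HT.
Qed.

Lemma charl_short : short_inv -> charl g al' p e = charl g al p e.
Proof.
move=> H; pose T (a : nat -> K) k := a k + p k / a k.+1.
have HT k : T al' k = T al k by apply: H.
case: g_cases => -> /=.
- have E a : (forall k, a k != 0) -> p 0%N + e 0%N * a 1%N / p 1%N + e 0%N / a 2%N =
     p 0%N + e 0%N / p 1%N * T a 1%N by move=> a0; rewrite /T; field; rewrite ?a0 ?p0.
  by rewrite !E ?HT.
- have E a : (forall k, a k != 0) -> p 0%N + e 0%N * a 1%N * a 2%N / p 2%N +
      e 0%N * a 1%N / a 3%N + e 0%N * p 1%N / (a 2%N * a 3%N) + e 0%N * e 1%N / p 3%N =
      p 0%N + e 0%N / p 2%N * (T a 1%N * T a 2%N - p 1%N) + e 0%N * e 1%N / p 3%N.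
    by move=> a0; rewrite /T; field; rewrite ?a0 ?p0.
  by rewrite !E ?HT.
(* The rank 1 character with four monomials: three consecutive [T] multiply to eight monomials, and
   the subtracted products remove four. *)
- pose T3 a k := T a k * T a k.+1 * T a k.+2 - p k * T a k.+2 - p k.+1 * T a k.
  have E a : (forall k, a k != 0) ->
      p 0%N + a 1%N * a 2%N * a 3%N / p 3%N + a 1%N * a 2%N / a 4%N +
      a 1%N * p 2%N / (a 3%N * a 4%N) +
      p 1%N * p 2%N / (a 2%N * a 3%N * a 4%N) +
      a 1%N * a 5%N / p 5%N + p 1%N * a 5%N / (a 2%N * p 5%N) +
      p 2%N / p 4%N + a 3%N * a 4%N * a 5%N / (p 4%N * p 5%N) +
      a 1%N / a 6%N + p 1%N / (a 2%N * a 6%N) +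
      a 3%N * a 4%N / (a 6%N * p 4%N) + a 3%N / (a 5%N * a 6%N) +
      p 3%N / (a 4%N * a 5%N * a 6%N) + 1 / p 6%N =
      p 0%N + T3 a 1%N / p 3%N + T a 1%N * T a 5%N / p 5%N + p 2%N / p 4%N +
      T3 a 3%N / (p 4%N * p 5%N) + 1 / p 6%N.
    by move=> a0; rewrite /T3 /T; field; rewrite ?a0 ?p0.
  by rewrite !E ?/T3 ?HT.
Qed.

Lemma chars_long : long_inv -> chars g al p' e = chars g al p e.
Proof.
rewrite /long_inv => H.
case: g_cases => Eg; rewrite Eg /=.
- pose T (q : nat -> K) k := q k + e k * al k.+1 / q k.+1.
  have HT k : T p' k = T p k.
    by have := H k; rewrite Eg /sprod !big_ord_recr big_ord0 /= mul1r !addnS !addn0 /T ?mulrA.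
  have E (q : nat -> K) : (forall k, q k != 0) -> al 0%N + q 0%N / al 1%N + e 0%N / q 1%N =
      al 0%N + T q 0%N / al 1%N.
    by move=> q0; rewrite /T; field; rewrite ?al0 ?q0.
  by rewrite !E ?HT.
- pose T (q : nat -> K) k := q k + e k * (al k.+1 * al k.+2) / q k.+2.
  have HT k : T p' k = T p k.
    by have := H k; rewrite Eg /sprod !big_ord_recr big_ord0 /= mul1r !addnS !addn0 /T ?mulrA.
  have E (q : nat -> K) : (forall k, q k != 0) -> al 0%N + q 0%N / al 1%N +
      e 0%N * al 2%N / q 2%N + e 0%N / al 3%N = al 0%N + T q 0%N / al 1%N + e 0%N / al 3%N.
    move=> q0; rewrite /T.
    by field; rewrite ?al0 ?q0.
  by rewrite !E ?HT.
- pose T (q : nat -> K) k := q k + e k * (al k.+1 * al k.+2 * al k.+3) / q k.+3.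
  have HT k : T p' k = T p k.
    by have := H k; rewrite Eg /sprod !big_ord_recr big_ord0 /= mul1r !addnS !addn0 /T ?mulrA.
  have E (q : nat -> K) : (forall k, q k != 0) ->
      al 0%N + q 0%N / al 1%N + al 2%N * al 3%N / q 3%N + al 2%N / al 4%N +
      q 2%N / (al 3%N * al 4%N) + al 5%N / q 5%N + 1 / al 6%N =
      al 0%N + T q 0%N / al 1%N + al 2%N / al 4%N + T q 2%N / (al 3%N * al 4%N) + 1 / al 6%N.
    move=> q0; rewrite /T ?e1 //.
    by field; rewrite ?al0 ?q0.
  by rewrite !E ?HT.
Qed.

Lemma charl_long : long_inv -> charl g al p' e = charl g al p e.
Proof.
rewrite /long_inv => H.
case: g_cases => Eg; rewrite Eg /=.
- pose T (q : nat -> K) k := q k + e k * al k.+1 / q k.+1.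
  have HT k : T p' k = T p k.
    by have := H k; rewrite Eg /sprod !big_ord_recr big_ord0 /= mul1r !addnS !addn0 /T ?mulrA.
  have E (q : nat -> K) : (forall k, q k != 0) -> q 0%N + e 0%N * al 1%N / q 1%N + e 0%N / al 2%N =
      T q 0%N + e 0%N / al 2%N.
    by move=> q0; rewrite /T; field; rewrite ?al0 ?q0.
  by rewrite !E ?HT.
- pose T (q : nat -> K) k := q k + e k * (al k.+1 * al k.+2) / q k.+2.
  have HT k : T p' k = T p k.
    by have := H k; rewrite Eg /sprod !big_ord_recr big_ord0 /= mul1r !addnS !addn0 /T ?mulrA.
  have E (q : nat -> K) : (forall k, q k != 0) -> q 0%N + e 0%N * al 1%N * al 2%N / q 2%N +
      e 0%N * al 1%N / al 3%N + e 0%N * q 1%N / (al 2%N * al 3%N) + e 0%N * e 1%N / q 3%N =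
      T q 0%N + e 0%N * al 1%N / al 3%N + e 0%N * T q 1%N / (al 2%N * al 3%N).
    move=> q0; rewrite /T.
    by field; rewrite ?al0 ?q0.
  by rewrite !E ?HT.
- pose T (q : nat -> K) k := q k + e k * (al k.+1 * al k.+2 * al k.+3) / q k.+3.
  have HT k : T p' k = T p k.
    by have := H k; rewrite Eg /sprod !big_ord_recr big_ord0 /= mul1r !addnS !addn0 /T ?mulrA.
  have E (q : nat -> K) : (forall k, q k != 0) ->
      q 0%N + al 1%N * al 2%N * al 3%N / q 3%N + al 1%N * al 2%N / al 4%N +
      al 1%N * q 2%N / (al 3%N * al 4%N) +
      q 1%N * q 2%N / (al 2%N * al 3%N * al 4%N) +
      al 1%N * al 5%N / q 5%N + q 1%N * al 5%N / (al 2%N * q 5%N) +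
      q 2%N / q 4%N + al 3%N * al 4%N * al 5%N / (q 4%N * q 5%N) +
      al 1%N / al 6%N + q 1%N / (al 2%N * al 6%N) +
      al 3%N * al 4%N / (al 6%N * q 4%N) + al 3%N / (al 5%N * al 6%N) +
      q 3%N / (al 4%N * al 5%N * al 6%N) + 1 / q 6%N =
      T q 0%N + al 1%N * al 2%N / al 4%N + al 1%N * T q 2%N / (al 3%N * al 4%N) +
      T q 1%N * T q 2%N / (al 2%N * al 3%N * al 4%N) + al 1%N / al 6%N +
      T q 1%N / (al 2%N * al 6%N) + al 3%N / (al 5%N * al 6%N) +
      T q 3%N / (al 4%N * al 5%N * al 6%N).
    move=> q0; rewrite /T ?e1 //.
    by field; rewrite ?al0 ?q0.
  by rewrite !E ?HT.
Qed.

End Characters.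

(** * Uniqueness of solutions of the character equations *)

Section Contraction.
Variables (I : Type) (A : ratfun I) (w : I -> nat).
Local Notation K := (rf_K A).
Local Notation dle := (@dle I A w).
Local Notation deg_is := (@deg_is I A w).

(** Agreement to relative precision B: the error lies B degrees below the common bound d. With d
    additive under products, the precision B passes unchanged to every monomial. *)
Definition eqv (B d : int) (x y : K) := [/\ dle x d, dle y d & dle (x - y) (d - B)].

Lemma eqv_refl B d x : dle x d -> eqv B d x x.
Proof. by move=> xd; split=> //; rewrite subrr; apply: dle0. Qed.

Lemma eqvD B d x y x' y' : eqv B d x y -> eqv B d x' y' -> eqv B d (x + x') (y + y').
Proof.
move=> [h1 h2 h3] [k1 k2 k3]; split; try exact: dleD.
by rewrite opprD addrACA; apply: dleD.
Qed.

Lemma eqvM B d d' x y x' y' :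
  eqv B d x y -> eqv B d' x' y' -> eqv B (d + d') (x * x') (y * y').
Proof.
move=> [h1 h2 h3] [k1 k2 k3]; split; try exact: dleM.
have -> : x * x' - y * y' = x * (x' - y') + (x - y) * y' by ring.
apply: dleD; first by have := dleM h1 k3; rewrite addrA.
by have := dleM h3 k2; rewrite addrAC.
Qed.

Lemma eqvV B d x y : deg_is x d -> deg_is y d -> dle (x - y) (d - B) ->
  eqv B (- d) x^-1 y^-1.
Proof.
move=> [x0 _ xd] [y0 _ yd] xy; split=> //.
have -> : x^-1 - y^-1 = - (x - y) * x^-1 * y^-1 by field; rewrite x0 y0.
have -> : - d - B = d - B - d - d by lia.
by apply: dleM => //; apply: dleM => //; apply: dleN.
Qed.

(** The source of the contraction: measured against the dominant degree, a monomial of strictly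
    smaller degree is known to one more order. *)
Lemma eqvW B d d' x y : eqv B d x y -> d < d' -> eqv (B + 1) d' x y.
Proof.
move=> [h1 h2 h3] dd'; by split; [apply: dleW h1 | apply: dleW h2 | apply: dleW h3]; lia.
Qed.

(** Here c / x is the dominant monomial and M the rest of the character. Since x - y = x y (M - M')
    / c, the precision of the rest becomes the precision of x. *)
Lemma eqv_solve B d c x y M M' : deg_is x d -> deg_is y d -> deg_is c 0 ->
  M + c / x = M' + c / y -> eqv B (- d) M M' -> dle (x - y) (d - B).
Proof.
move=> [x0 xd _] [y0 yd _] [c0 _ cV] E [_ _ MM'].
have -> : x - y = x * y * ((M - M') * c^-1).
  have -> : M - M' = c / y - c / x by apply/eqP; rewrite subr_eq addrAC eq_sym subr_eq E addrC.
  by field; rewrite x0 y0 c0.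
have -> : d - B = d + d + (- d - B - 0) by lia.
by apply: dleM; [exact: dleM | apply: dleM => //; rewrite oppr0 in cV; rewrite oppr0].
Qed.

(** The degree of a monomial is a unification variable that [eqv_mono] fills in from the factors;
    [lia] then checks that it lies strictly below the dominant degree. *)
Ltac eqv_mono := first
  [ match goal with |- eqv _ _ (_ * _) (_ * _) =>
      eapply eqvM; [eqv_mono | eqv_mono] end
  | match goal with H : _ |- _ => eapply H end ].
Ltac eqv_sum := rewrite /= ?invfM; first
  [ match goal with |- eqv _ _ (_ + _) (_ + _) =>
      apply: eqvD; [eqv_sum | eqv_sum] end
  | eapply eqvW; [eqv_mono | lia] ].

(** Degrees u of the short and v of the long variable. They are strictly dominant: the simple roots
    have degrees 2u - v and 2v - gu, namely (1, 1), (2, 2) and (1, 3). For g = 1 the symmetry u = v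
    ensures that the longest element negates both degrees. *)
Definition top_degrees g : int * int :=
  match g with 1 => (1, 1) | 2 => (3, 4) | _ => (5, 9) end.

(** Both solutions have the degrees reached after the longest element, where the lowest weight
    monomial dominates. Isolating it raises the precision B by one. The two families are improved
    together, because the remaining monomials involve both. *)
Lemma chars_unique g (al al' p p' e : int -> K) :
  let: (u, v) := top_degrees g in
  (0 < g <= 3)%N -> (forall n, deg_is (e n) 0) ->
  (forall n, deg_is (al n) (- u)) -> (forall n, deg_is (al' n) (- u)) ->
  (forall n, deg_is (p n) (- v)) -> (forall n, deg_is (p' n) (- v)) ->
  (forall n : int, let sh (f : int -> K) k := f (n + k%:Z) in
     chars g (sh al) (sh p) (sh e) = chars g (sh al') (sh p') (sh e) /\
     charl g (sh al) (sh p) (sh e) = charl g (sh al') (sh p') (sh e)) ->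
  (forall n, al n = al' n) /\ (forall n, p n = p' n).
Proof.
case E : (top_degrees g) => [u v] g13 de da da' dp dp' H.
suff main (B : nat) n : dle (al n - al' n) (- u - B%:Z) /\ dle (p n - p' n) (- v - B%:Z).
  split=> n; apply/eqP; rewrite -subr_eq0; apply/negPn/negP => /(dle_lb w) [C nC]; apply: nC.
  - by have [+ _] := main (absz (C + u)) n; apply: dleW; lia.
  - by have [_ +] := main (absz (C + v)) n; apply: dleW; lia.
elim: B n => [|B IH] n.
  have [_ h1 _] := da n; have [_ h2 _] := da' n; have [_ h3 _] := dp n.
  have [_ h4 _] := dp' n; rewrite !subr0.
  by split; apply: dleD => //; apply: dleN.
have Ha k : eqv B (- u) (al k) (al' k).
  by have [_ ? _] := da k; have [_ ? _] := da' k; split=> //; case: (IH k).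
have Hp k : eqv B (- v) (p k) (p' k).
  by have [_ ? _] := dp k; have [_ ? _] := dp' k; split=> //; case: (IH k).
have HaV k : eqv B (- - u) (al k)^-1 (al' k)^-1 by apply: eqvV => //; case: (IH k).
have HpV k : eqv B (- - v) (p k)^-1 (p' k)^-1 by apply: eqvV => //; case: (IH k).
have He k : eqv B 0 (e k) (e k) by apply: eqv_refl; case: (de k).
have H1 : eqv B 0 1 1 by apply: eqv_refl; apply: dle10.
have -> : B.+1%:Z = B%:Z + 1 by lia.
(* In the character taken at time n - k, the lowest weight monomial carries its variable at time n;
   this determines the shift k in each case below. *)
have solve_al k c M M' : deg_is c 0 -> M + c / al (n - k + k) = M' + c / al' (n - k + k) ->
    eqv (B%:Z + 1) u M M' -> dle (al n - al' n) (- u - (B%:Z + 1)).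
  by rewrite !subrK => c0 E' MM; apply: eqv_solve E' _ => //; rewrite opprK.
have solve_p k c M M' : deg_is c 0 -> M + c / p (n - k + k) = M' + c / p' (n - k + k) ->
    eqv (B%:Z + 1) v M M' -> dle (p n - p' n) (- v - (B%:Z + 1)).
  by rewrite !subrK => c0 E' MM; apply: eqv_solve E' _ => //; rewrite opprK.
have gc : [\/ g = 1%N, g = 2%N | g = 3%N].
  by clear -g13; case: g g13 => [|[|[|[|]]]] //; constructor.
case: gc => Eg; move: E; rewrite Eg => -[? ?]; subst u v; rewrite Eg in H; split.
(* For g = 1 the two representations are dual to each other, so [al] is read off the long character
   and [p] off the short one. *)
- by have [_ h] := H (n - 2%:Z); apply: (solve_al _ _ _ _ _ h) => //; eqv_sum.
- by have [h _] := H (n - 1%:Z); apply: (solve_p _ _ _ _ _ h) => //; eqv_sum.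
- by have [h _] := H (n - 3%:Z); apply: (solve_al _ _ _ _ _ h) => //; eqv_sum.
- have [_ h] := H (n - 3%:Z); apply: (solve_p _ _ _ _ _ h) => //; last by eqv_sum.
  by rewrite -[0]addr0; apply: deg_isM.
- have [h _] := H (n - 6%:Z); apply: (solve_al _ _ _ _ _ h); first exact: deg_is1.
  by eqv_sum.
- have [_ h] := H (n - 6%:Z); apply: (solve_p _ _ _ _ _ h); first exact: deg_is1.
  by eqv_sum.
Qed.

End Contraction.

(** * Braid relations in rank 2 *)

Lemma chars_morph (K : fieldType) (f : {rmorphism K -> K}) g (al p e : nat -> K) :
  f (chars g al p e) = chars g (f \o al) (f \o p) (f \o e).
Proof.
by case: g => [|[|[|g]]]; rewrite /= !rmorphD /= ?fmorph_div ?rmorphM ?rmorph1 /=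
  ?fmorph_div ?rmorphM ?rmorph1.
Qed.

Lemma charl_morph (K : fieldType) (f : {rmorphism K -> K}) g (al p e : nat -> K) :
  f (charl g al p e) = charl g (f \o al) (f \o p) (f \o e).
Proof.
by case: g => [|[|[|g]]]; rewrite /= !rmorphD /= ?fmorph_div ?rmorphM ?rmorph1 /=
  ?fmorph_div ?rmorphM ?rmorph1.
Qed.

Fixpoint alt (T : Type) k (f g : T -> T) (x : T) : T :=
  if k is k'.+1 then f (alt k' g f x) else x.

Definition longest_length g := match g with 1 => 3 | 2 => 4 | _ => 6 end%N.

Section Rank2.
Variables (I : Type) (A : ratfun I) (w : I -> nat).
Local Notation K := (rf_K A).
Local Notation deg_is := (@deg_is I A w).
Variables (r1 r2 : {rmorphism K -> K}) (al p e : int -> K) (g : nat).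
Hypothesis g13 : (0 < g <= 3)%N.
Hypothesis e1 : g = 3%N -> forall n, e n = 1.
Hypotheses (r1p : forall n, r1 (p n) = p n) (r2al : forall n, r2 (al n) = al n).
Hypotheses (r1e : forall n, r1 (e n) = e n) (r2e : forall n, r2 (e n) = e n).
Let F n := \prod_(s < g) al (n + s.+1%:Z).
Hypothesis H1 : forall n, r1 (al n) + p n / r1 (al (n + 1)) = al n + p n / al (n + 1).
Hypothesis H2 : forall n, r2 (p n) + e n * F n / r2 (p (n + g%:Z)) =
                          p n + e n * F n / p (n + g%:Z).
Let fixes (phi : {rmorphism K -> K}) := forall z, r1 z = z -> r2 z = z -> phi z = z.
(** [phi] is the part of the word already read. The condition 0 < 2 * u - v says that the simple
    root still has positive degree after [phi], as it does along a reduced word; the new degree is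
    then that of the reflected weight. *)
Hypothesis D1 : forall (phi : {rmorphism K -> K}) (u v : int), fixes phi ->
  (forall n, deg_is (phi (al n)) u) -> (forall n, deg_is (phi (p n)) v) ->
  0 < 2 * u - v -> forall n, deg_is (phi (r1 (al n))) (v - u).
Hypothesis D2 : forall (phi : {rmorphism K -> K}) (u v : int), fixes phi ->
  (forall n, deg_is (phi (al n)) u) -> (forall n, deg_is (phi (p n)) v) ->
  0 < 2 * v - g%:Z * u -> forall n, deg_is (phi (r2 (p n))) (g%:Z * u - v).
Hypothesis dal : forall n, deg_is (al n) (top_degrees g).1.
Hypothesis dp : forall n, deg_is (p n) (top_degrees g).2.
Hypothesis de : forall n, deg_is (e n) 0.

Let sh (f : int -> K) (n : int) (k : nat) := f (n + k%:Z).
Let chs n := chars g (sh al n) (sh p n) (sh e n).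
Let chl n := charl g (sh al n) (sh p n) (sh e n).

Let al_neq0 n : al n != 0. Proof. by case: (dal n). Qed.
Let p_neq0 n : p n != 0. Proof. by case: (dp n). Qed.

Let short_inv n k : sh (r1 \o al) n k + sh p n k / sh (r1 \o al) n k.+1 =
  sh al n k + sh p n k / sh al n k.+1.
Proof. by rewrite /sh /= -addn1 PoszD addrA H1. Qed.

Let long_inv n k :
  sh (r2 \o p) n k + sh e n k * sprod g (sh al n) k / sh (r2 \o p) n (k + g) =
  sh p n k + sh e n k * sprod g (sh al n) k / sh p n (k + g).
Proof.
have -> : sprod g (sh al n) k = F (n + k%:Z).
  by apply: eq_bigr => s _; rewrite /sh PoszD addrA.
by rewrite /sh /= PoszD addrA H2.
Qed.

Let r1_chs n : r1 (chs n) = chs n.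
Proof.
rewrite chars_morph -[RHS](@chars_short _ _ _ (sh (r1 \o al) n)) //.
- by rewrite /chs /sh /=; case: g => [|[|[|?]]] /=; rewrite ?r1p ?r1e.
- by move=> k; apply: al_neq0.
- by move=> k; rewrite /sh /= fmorph_eq0 al_neq0.
- by move=> k; apply: p_neq0.
Qed.

Let r1_chl n : r1 (chl n) = chl n.
Proof.
rewrite charl_morph -[RHS](@charl_short _ _ _ (sh (r1 \o al) n)) //.
- by rewrite /chl /sh /=; case: g => [|[|[|?]]] /=; rewrite ?r1p ?r1e.
- by move=> k; apply: al_neq0.
- by move=> k; rewrite /sh /= fmorph_eq0 al_neq0.
- by move=> k; apply: p_neq0.
Qed.

Let r2_chs n : r2 (chs n) = chs n.
Proof.
rewrite chars_morph -[RHS](@chars_long _ _ _ _ (sh (r2 \o p) n)) //.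
- by rewrite /chs /sh /=; case: g => [|[|[|?]]] /=; rewrite ?r2al ?r2e.
- by move=> g3 k; rewrite /sh e1.
- by move=> k; apply: al_neq0.
- by move=> k; apply: p_neq0.
- by move=> k; rewrite /sh /= fmorph_eq0 p_neq0.
Qed.

Let r2_chl n : r2 (chl n) = chl n.
Proof.
rewrite charl_morph -[RHS](@charl_long _ _ _ _ (sh (r2 \o p) n)) //.
- by rewrite /chl /sh /=; case: g => [|[|[|?]]] /=; rewrite ?r2al ?r2e.
- by move=> g3 k; rewrite /sh e1.
- by move=> k; apply: al_neq0.
- by move=> k; apply: p_neq0.
- by move=> k; rewrite /sh /= fmorph_eq0 p_neq0.
Qed.

(** The invariant along a reduced word. Words grow on the right, as [phi \o r1], so that [r1] is
    expanded at the original variables and [phi] acts on the resulting formula. *)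
Let state (phi : {rmorphism K -> K}) (u v : int) :=
  [/\ forall n, deg_is (phi (al n)) u, forall n, deg_is (phi (p n)) v,
      fixes phi & forall n, phi (chs n) = chs n /\ phi (chl n) = chl n].

Let state_id : state idfun (top_degrees g).1 (top_degrees g).2.
Proof. by split. Qed.

Let state_r1 (phi : {rmorphism K -> K}) u v u' :
  state phi u v -> u' = v - u -> 0 < 2 * u - v -> state (phi \o r1) u' v.
Proof.
move=> [sa sp se sc] -> pos; split=> n /=; rewrite ?r1p ?r1_chs ?r1_chl //.
  exact: D1.
by move=> z1 z2; rewrite z1 se.
Qed.

Let state_r2 (phi : {rmorphism K -> K}) u v v' :
  state phi u v -> v' = g%:Z * u - v -> 0 < 2 * v - g%:Z * u -> state (phi \o r2) u v'.
Proof.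
move=> [sa sp se sc] -> pos; split=> n /=; rewrite ?r2al ?r2_chs ?r2_chl //.
  exact: D2.
by move=> z1 z2; rewrite z2 se.
Qed.

Let state_unique (phi psi : {rmorphism K -> K}) :
  state phi (- (top_degrees g).1) (- (top_degrees g).2) ->
  state psi (- (top_degrees g).1) (- (top_degrees g).2) ->
  (forall n, phi (al n) = psi (al n)) /\ (forall n, phi (p n) = psi (p n)).
Proof.
move=> [a1 a2 a3 a4] [b1 b2 b3 b4].
have := @chars_unique _ A w g (phi \o al) (psi \o al) (phi \o p) (psi \o p) e.
move: a1 a2 b1 b2; case: (top_degrees g) => u v /= a1 a2 b1 b2; apply=> // n.
have [c1 c2] := a4 n; have [d1 d2] := b4 n.
have shE (f : {rmorphism K -> K}) (x : int -> K) m : f \o sh x m = sh (f \o x) m by [].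
move: c1 c2 d1 d2; rewrite /chs /chl !chars_morph !charl_morph !shE => c1 c2 d1 d2.
have ee (f : {rmorphism K -> K}) : (forall n, f (e n) = e n) ->
    forall a b, chars g a b (sh (f \o e) n) = chars g a b (sh e n) /\
                charl g a b (sh (f \o e) n) = charl g a b (sh e n).
  by move=> fe a b; rewrite /sh /=; case: g => [|[|[|?]]] /=; rewrite ?fe.
have {}a3 k : phi (e k) = e k by apply: a3.
have {}b3 k : psi (e k) = e k by apply: b3.
move: c1 c2 d1 d2; rewrite !(proj1 (ee _ a3 _ _)) !(proj2 (ee _ a3 _ _)).
rewrite !(proj1 (ee _ b3 _ _)) !(proj2 (ee _ b3 _ _)) => c1 c2 d1 d2.
by split; [rewrite c1 d1 | rewrite c2 d2].
Qed.

Lemma rank2_braid n :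
  alt (longest_length g) r1 r2 (al n) = alt (longest_length g) r2 r1 (al n) /\
  alt (longest_length g) r1 r2 (p n) = alt (longest_length g) r2 r1 (p n).
Proof.
have gc : [\/ g = 1%N, g = 2%N | g = 3%N].
  by clear -g13; case: g g13 => [|[|[|[|]]]] //; constructor.
have step1 phi u v u' (S : state phi u v) (c : (u' == v - u) && (0 < 2 * u - v)) :
    state (phi \o r1) u' v by case/andP: c => /eqP E; apply: state_r1.
have step2 g0 (Eg : g = g0) phi u v v' (S : state phi u v)
    (c : (v' == g0%:Z * u - v) && (0 < 2 * v - g0%:Z * u)) : state (phi \o r2) u v'.
  by case/andP: c => /eqP E c; apply: (state_r2 S); rewrite Eg.
have := state_id; have := state_unique; case: gc => Eg; rewrite Eg /= => SU S0.
(* The numbers follow [top_degrees] under u -> v - u and v -> gu - v. Both reduced words end at the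
   negated pair, where [SU] applies. *)
- have S1 := step1 _ _ _ 0 S0 isT.
  have S2 := step2 _ Eg _ _ _ (-1) S1 isT.
  have S3 := step1 _ _ _ (-1) S2 isT.
  have T1 := step2 _ Eg _ _ _ 0 S0 isT.
  have T2 := step1 _ _ _ (-1) T1 isT.
  have T3 := step2 _ Eg _ _ _ (-1) T2 isT.
  by have [E1 E2] := SU _ _ S3 T3; split; [exact: E1 | exact: E2].
- have S1 := step1 _ _ _ 1 S0 isT.
  have S2 := step2 _ Eg _ _ _ (-2) S1 isT.
  have S3 := step1 _ _ _ (-3) S2 isT.
  have S4 := step2 _ Eg _ _ _ (-4) S3 isT.
  have T1 := step2 _ Eg _ _ _ 2 S0 isT.
  have T2 := step1 _ _ _ (-1) T1 isT.
  have T3 := step2 _ Eg _ _ _ (-4) T2 isT.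
  have T4 := step1 _ _ _ (-3) T3 isT.
  by have [E1 E2] := SU _ _ S4 T4; split; [exact: E1 | exact: E2].
- have S1 := step1 _ _ _ 4 S0 isT.
  have S2 := step2 _ Eg _ _ _ 3 S1 isT.
  have S3 := step1 _ _ _ (-1) S2 isT.
  have S4 := step2 _ Eg _ _ _ (-6) S3 isT.
  have S5 := step1 _ _ _ (-5) S4 isT.
  have S6 := step2 _ Eg _ _ _ (-9) S5 isT.
  have T1 := step2 _ Eg _ _ _ 6 S0 isT.
  have T2 := step1 _ _ _ 1 T1 isT.
  have T3 := step2 _ Eg _ _ _ (-3) T2 isT.
  have T4 := step1 _ _ _ (-4) T3 isT.
  have T5 := step2 _ Eg _ _ _ (-9) T4 isT.
  have T6 := step1 _ _ _ (-5) T5 isT.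
  by have [E1 E2] := SU _ _ S6 T6; split; [exact: E1 | exact: E2].
Qed.

End Rank2.

(** * The reflection along one cycle *)

Section Cycle.
Variable K : fieldType.
Implicit Types (q u y F : int -> K) (D : nat) (n : int).

Definition cyc_sum q D P n : K :=
  1 + \sum_(k < P.-1) \prod_(s < k.+1) q (n - (s * D)%:Z).

Definition cyc_prod q D P n : K := \prod_(s < P) q (n - (s * D)%:Z).

Lemma cyc_sum_rec q D P n : (0 < P)%N ->
  cyc_sum q D P n = 1 - cyc_prod q D P n + q n * cyc_sum q D P (n - D%:Z).
Proof.
case: P => // P _; rewrite /cyc_sum /=.
have E k : \prod_(s < k.+1) q (n - (s * D)%:Z) =
    q n * \prod_(s < k) q (n - D%:Z - (s * D)%:Z).
  rewrite big_ord_recl mul0n subr0; congr (_ * _); apply: eq_bigr => s _.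
  by congr q; rewrite lift0 mulSn; lia.
rewrite -addrA; congr (1 + _).
have -> : cyc_prod q D P.+1 n = q n * \prod_(s < P) q (n - D%:Z - (s * D)%:Z) by apply: E.
rewrite mulrDr mulr1 mulr_sumr.
under eq_bigr do rewrite E.
have: \sum_(i < P.+1) q n * \prod_(s < i) q (n - D%:Z - (s * D)%:Z) =
    \sum_(i < P.+1) q n * \prod_(s < i) q (n - D%:Z - (s * D)%:Z) by [].
rewrite {1}big_ord_recr big_ord_recl /= big_ord0 mulr1 => H.
by rewrite addrC -H addrK.
Qed.

Section Periodic.
Variables (D P : nat).
Hypothesis P0 : (0 < P)%N.
Definition periodic u := forall n, u (n + (P * D)%:Z) = u n.

Lemma periodicN u n : periodic u -> u (n - (P * D)%:Z) = u n.
Proof. by move=> per; rewrite -per subrK. Qed.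

Lemma cyc_prod_shift u n : periodic u -> cyc_prod u D P (n - D%:Z) = cyc_prod u D P n.
Proof.
move=> per; have := periodicN n per; rewrite /cyc_prod; case: (P) P0 => // P' _ perN.
rewrite big_ord_recr [RHS]big_ord_recl /= mul0n subr0 mulrC; congr (_ * _).
  by rewrite -perN; congr u; lia.
by apply: eq_bigr => s _; congr u; rewrite /bump /=; lia.
Qed.

Lemma cyc_sum_periodic q : periodic q -> periodic (cyc_sum q D P).
Proof.
move=> per n; congr (1 + _); apply: eq_bigr => k _; apply: eq_bigr => s _.
by rewrite addrAC per.
Qed.

Lemma cyc_unique q u : periodic q -> periodic u ->
  (forall n, cyc_prod q D P n != 1) ->
  (forall n, u n = 1 - cyc_prod q D P n + q n * u (n - D%:Z)) ->
  forall n, u n = cyc_sum q D P n.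
Proof.
move=> pq pu A1 Hu n.
(* The difference solves the homogeneous recursion: one turn around the cycle multiplies it by A,
   yet periodicity leaves it unchanged. *)
pose d n := u n - cyc_sum q D P n.
have dE k : d k = q k * d (k - D%:Z).
  by rewrite /d Hu cyc_sum_rec //; ring.
have dk k : d n = (\prod_(s < k) q (n - (s * D)%:Z)) * d (n - (k * D)%:Z).
  elim: k => [|k IH]; first by rewrite big_ord0 mul1r mul0n subr0.
  rewrite big_ord_recr /= -mulrA IH; congr (_ * _); rewrite dE; congr (_ * d _); lia.
have pd : d (n - (P * D)%:Z) = d n by rewrite /d !periodicN //; apply: cyc_sum_periodic.
have := dk P; rewrite pd -/(cyc_prod q D P n) => E.
apply/eqP; rewrite -subr_eq0 -/(d n); apply/eqP.
have /eqP : (1 - cyc_prod q D P n) * d n = 0 by rewrite mulrBl mul1r -E subrr.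
by rewrite mulf_eq0 subr_eq0 eq_sym (negPf (A1 n)) => /eqP.
Qed.

Section Reflection.
Variables (y F : int -> K).
Hypotheses (py : periodic y) (pF : periodic F).
Hypotheses (y0 : forall n, y n != 0) (F0 : forall n, F n != 0).
Let q n := F n / (y n * y (n + D%:Z)).
Let f := cyc_sum q D P.
Hypothesis f0 : forall n, f n != 0.
Definition refl_y n := f (n - 2 * D%:Z) / f (n - D%:Z) * (F (n - D%:Z) / y (n - D%:Z)).
Let y' := refl_y.
Let q' n := F n / (y' n * y' (n + D%:Z)).

Let shift2 n : n - 2 * D%:Z = n - D%:Z - D%:Z.
Proof. by lia. Qed.

Let pq : periodic q.
Proof. by move=> n; rewrite /q py pF addrAC py. Qed.

Let q0 n : q n != 0.
Proof. by rewrite mulf_neq0 ?invr_eq0 ?mulf_neq0. Qed.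

Let frec n : f n = 1 - cyc_prod q D P n + q n * f (n - D%:Z).
Proof. exact: cyc_sum_rec. Qed.

Lemma refl_yE n : y' n = y n * (q (n - D%:Z) * f (n - D%:Z - D%:Z) / f (n - D%:Z)).
Proof. by rewrite /y' /refl_y /q shift2 subrK; field; rewrite f0 !y0. Qed.

Lemma refl_y_neq0 n : y' n != 0.
Proof.
rewrite refl_yE; apply: mulf_neq0 => //; apply: mulf_neq0; last by rewrite invr_eq0.
exact: mulf_neq0.
Qed.

(** By the recursion for f at n - D and at n, the first term changes by -y(n) (1 - A) / f(n - D) and
    the second by the opposite amount; the same A occurs twice because it is constant along the
    cycle. *)
Lemma refl_riccati n :
  y' n + F n / y' (n + D%:Z) = y n + F n / y (n + D%:Z).
Proof.
have EF : F n = q n * y n * y (n + D%:Z) by rewrite /q; field; rewrite !y0.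
rewrite (refl_yE (n + D%:Z)) addrK EF.
rewrite refl_yE.
have E1 := frec n; have E2 := frec (n - D%:Z); rewrite cyc_prod_shift // in E2.
have -> : q (n - D%:Z) * f (n - D%:Z - D%:Z) = f (n - D%:Z) - (1 - cyc_prod q D P n).
  by rewrite [f (n - D%:Z) in RHS]E2; ring.
have -> : 1 - cyc_prod q D P n = f n - q n * f (n - D%:Z) by rewrite [in RHS]E1; ring.
by field; rewrite !f0 !y0 q0.
Qed.

Lemma refl_q n : q' n = f n / (f (n - D%:Z - D%:Z) * q (n - D%:Z)).
Proof.
rewrite /q' !refl_yE addrK.
have EF : F n = q n * y n * y (n + D%:Z) by rewrite /q; field; rewrite !y0.
by rewrite EF; field; rewrite !f0 !y0 !q0.
Qed.

Hypothesis A1 : forall n, cyc_prod q D P n != 1.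

Let A0 n : cyc_prod q D P n != 0.
Proof. by apply/prodf_neq0 => s _. Qed.

(** Multiply [refl_q] over a full turn: the values of f cancel by periodicity. *)
Let AV n : cyc_prod q' D P n = (cyc_prod q D P n)^-1.
Proof.
pose f2 n := f (n - D%:Z - D%:Z); pose q1 n := q (n - D%:Z).
have -> : cyc_prod q' D P n = cyc_prod f D P n / (cyc_prod f2 D P n * cyc_prod q1 D P n).
  rewrite -big_split -prodf_div; apply: eq_bigr => s _; exact: refl_q.
have -> : cyc_prod q1 D P n = cyc_prod q D P n.
  by rewrite -[RHS]cyc_prod_shift //; apply: eq_bigr => s _; congr q; lia.
have -> : cyc_prod f2 D P n = cyc_prod f D P n.
  rewrite -[RHS]cyc_prod_shift; last exact: cyc_sum_periodic.
  rewrite -[RHS]cyc_prod_shift; last exact: cyc_sum_periodic.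
  by apply: eq_bigr => s _; congr f; lia.
have fn0 : cyc_prod f D P n != 0 by apply/prodf_neq0 => s _.
by field; rewrite A0 fn0.
Qed.

Lemma refl_involutive n :
  let f' := cyc_sum q' D P in
  f' (n - 2 * D%:Z) / f' (n - D%:Z) * (F (n - D%:Z) / y' (n - D%:Z)) = y n.
Proof.
have Ef k : q k * f (k - D%:Z) / cyc_prod q D P k = cyc_sum q' D P k.
  (* The candidate for f' is (f - 1 + A) / A, rewritten with the recursion for f. It satisfies the
     recursion attached to q', whose cyclic product is 1 / A, so uniqueness identifies it with
     f'. *)
  pose u k := q k * f (k - D%:Z) / cyc_prod q D P k.
  apply: (@cyc_unique q' u).
  - move=> j; rewrite /q' /y' /refl_y /f; rewrite pF.
    have per j' d : cyc_sum q D P (j' + (P * D)%:Z - d) = cyc_sum q D P (j' - d).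
      by rewrite addrAC cyc_sum_periodic.
    have per' (g : int -> K) j' d : periodic g -> g (j' + (P * D)%:Z - d) = g (j' - d).
      by move=> pg; rewrite addrAC pg.
    have -> : j + (P * D)%:Z + D%:Z = j + D%:Z + (P * D)%:Z by lia.
    by rewrite !per !per'.
  - move=> j; rewrite /u pq; congr (_ * _ / _).
      by rewrite addrAC /f cyc_sum_periodic.
    by apply: eq_bigr => s _; rewrite addrAC pq.
  - by move=> j; rewrite AV; apply: contra (A1 j) => /eqP E; rewrite -[cyc_prod _ _ _ _]invrK E invr1.
  move=> j; rewrite /u AV refl_q cyc_prod_shift //.
  have E1 := frec j.
  have -> : q j * f (j - D%:Z) = f j - (1 - cyc_prod q D P j) by rewrite [f j in RHS]E1; ring.
  by field; rewrite A0 !f0 q0.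
rewrite /= -!Ef shift2 !cyc_prod_shift // refl_yE.
have -> : F (n - D%:Z) = q (n - D%:Z) * y (n - D%:Z) * y n.
  by rewrite /q subrK; field; rewrite !y0.
by field; rewrite A0 !f0 !y0 !q0.
Qed.

End Reflection.
End Periodic.
End Cycle.

(* The combinatorial data of the quiver: F(i,n) is the product of the
   y_j(n + s_ij + k D_j), 1 <= k <= g_ij, over the neighbours j of i. *)
Record dynkin (l N : nat) := Dynkin {
  dk_n0 : 'I_N;
  dk_adj : rel 'I_l;
  dk_D : 'I_l -> nat;
  dk_s : 'I_l -> 'I_l -> int;
  dk_g : 'I_l -> 'I_l -> nat;
  dk_sym : ssrbool.symmetric dk_adj;
  dk_irr : forall i, dk_adj i i = false;
  dk_D_dvd : forall i, (dk_D i %| N)%N;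
  dk_P_gt1 : forall i, (1 < N %/ dk_D i)%N;
  dk_s_sum : forall i j, dk_adj i j -> dk_s i j + dk_s j i = - (dk_g i j * dk_D j)%:Z;
  dk_gD : forall i j, dk_adj i j -> (dk_g i j * dk_D j = dk_g j i * dk_D i)%N;
  dk_g_range : forall i j, dk_adj i j -> (0 < dk_g i j <= 3)%N;
  dk_gD_lt : forall i j, dk_adj i j -> (dk_g i j * dk_D j < N)%N;
  dk_g1 : forall i j, dk_adj i j -> (dk_g i j == 1%N) || (dk_g j i == 1%N);
  dk_g3 : forall i j, dk_adj i j -> dk_g i j = 3%N ->
    forall k, (dk_adj i k -> k = j) /\ (dk_adj j k -> k = i)
}.

(** * The reflections attached to Dynkin data and their Coxeter relations *)

Section Reflections.
Variables (l N : nat) (X : dynkin l N) (A : ratfun (V l N)).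
Local Notation K := (rf_K A).
Local Notation adj := (dk_adj X).
Local Notation D := (dk_D X).
Local Notation s := (dk_s X).
Local Notation g := (dk_g X).
Local Notation om := (ordmod (dk_n0 X)).
Local Notation P i := (N %/ D i)%N.
Implicit Types (i j : 'I_l) (n : int).

Lemma dk_N_gt0 : (0 < N)%N.
Proof. by case: (dk_n0 X) => k /(leq_ltn_trans (leq0n k)). Qed.

Lemma dk_PD i : (P i * D i)%N = N.
Proof. exact: divnK (dk_D_dvd X i). Qed.

Lemma dk_P_gt0 i : (0 < P i)%N.
Proof. exact: ltnW (dk_P_gt1 X i). Qed.

Lemma om_val n : Posz (om n) = (n %% N%:Z)%Z.
Proof.
have N0 := dk_N_gt0; have N0' : (N%:Z != 0) by lia.
have H1 := modz_ge0 n N0'; have H2 := @ltz_mod n N%:Z N0'.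
by rewrite /ordmod val_insubd; case: ifP => [_|]; lia.
Qed.

Lemma om_period n : om (n + N%:Z) = om n.
Proof. by apply/val_inj/eqP; rewrite -eqz_nat /= !om_val modzDr. Qed.

Lemma om_val_id (k : 'I_N) : om (Posz k) = k.
Proof.
apply/val_inj/eqP; rewrite -eqz_nat /= om_val modz_small //.
by have := ltn_ord k; lia.
Qed.

Lemma periodic_om (T : Type) (u : int -> T) n : (forall m, u (m + N%:Z) = u m) ->
  u (Posz (om n)) = u n.
Proof.
move=> per; rewrite om_val {2}(divz_eq n N%:Z) addrC.
have pos (k : nat) m : u (m + k%:Z * N%:Z) = u m.
  elim: k m => [|k IH] m; first by rewrite mul0r addr0.
  by rewrite intS mulrDl mul1r addrA IH per.
case: (n %/ N%:Z)%Z => k; first by rewrite pos.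
by rewrite -[in RHS](pos k.+1) NegzE; congr u; ring.
Qed.

(** Time is any integer and is reduced modulo N only inside the variable, so that shifts can be
    computed in Z, with periodicity as a separate fact. *)
Definition yy i n : K := rvar A (i, om n).

Definition FF i n : K :=
  \prod_(j | adj i j) \prod_(k < g i j) yy j (n + s i j + (k.+1 * D j)%:Z).

Definition qq i n : K := FF i n / (yy i n * yy i (n + (D i)%:Z)).

Definition ff i : int -> K := cyc_sum (qq i) (D i) (P i).

Definition rimg_dk i (v : V l N) : K :=
  if v.1 == i then refl_y (D i) (P i) (yy i) (FF i) (Posz v.2) else rvar A v.

Lemma yy_period i n : yy i (n + N%:Z) = yy i n.
Proof. by rewrite /yy om_period. Qed.

Lemma FF_period i n : FF i (n + N%:Z) = FF i n.
Proof.
apply: eq_bigr => j _; apply: eq_bigr => k _.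
by rewrite -[RHS]yy_period; congr yy; lia.
Qed.

Lemma periodic_yy i : periodic (D i) (P i) (yy i).
Proof. by move=> n; rewrite dk_PD yy_period. Qed.

Lemma periodic_FF i : periodic (D i) (P i) (FF i).
Proof. by move=> n; rewrite dk_PD FF_period. Qed.

Lemma periodic_qq i : periodic (D i) (P i) (qq i).
Proof. by move=> n; rewrite /qq addrAC !periodic_yy periodic_FF. Qed.

Lemma periodic_ff i : periodic (D i) (P i) (ff i).
Proof. exact: cyc_sum_periodic (@periodic_qq i). Qed.

Lemma ff_period i n : ff i (n + N%:Z) = ff i n.
Proof. by have := @periodic_ff i n; rewrite dk_PD. Qed.

Lemma refl_y_period i n : refl_y (D i) (P i) (yy i) (FF i) (n + N%:Z) =
  refl_y (D i) (P i) (yy i) (FF i) n.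
Proof.
rewrite /refl_y.
by rewrite ![n + N%:Z - _]addrAC -!/(ff i _) !ff_period FF_period yy_period.
Qed.

Lemma rimg_dkE i j n : rimg_dk i (j, om n) =
  if j == i then refl_y (D i) (P i) (yy i) (FF i) n else yy j n.
Proof. by rewrite /rimg_dk /=; case: ifP => // _; rewrite periodic_om //; exact: refl_y_period. Qed.

Lemma sf_yy i n : sf (yy i n). Proof. exact: sf_var. Qed.

Lemma sf_FF i n : sf (FF i n).
Proof. by apply: sf_prod => j _; apply: sf_prod => k _; apply: sf_yy. Qed.

Lemma sf_cyc_sum (q : int -> K) D' P' : (forall n, sf (q n)) -> forall n, sf (cyc_sum q D' P' n).
Proof. by move=> sq n; apply: sf_1sum => k _; apply: sf_prod. Qed.

Lemma sf_qq i n : sf (qq i n).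
Proof. by apply: sf_div; [exact: sf_FF | apply: sf_mul; exact: sf_yy]. Qed.

Lemma sf_ff i n : sf (ff i n).
Proof. by apply: sf_cyc_sum => k; apply: sf_qq. Qed.

Lemma yy_neq0 i n : yy i n != 0. Proof. exact/sf_neq0/sf_yy. Qed.
Lemma FF_neq0 i n : FF i n != 0. Proof. exact/sf_neq0/sf_FF. Qed.
Lemma ff_neq0 i n : ff i n != 0. Proof. exact/sf_neq0/sf_ff. Qed.

Lemma sf_refl i n : sf (refl_y (D i) (P i) (yy i) (FF i) n).
Proof.
apply: sf_mul; first by apply: sf_div; apply: sf_ff.
by apply: sf_div; [exact: sf_FF | exact: sf_yy].
Qed.

Lemma deg_yy w i n : deg_is w (yy i n) (w (i, om n))%:Z.
Proof. exact: deg_is_var. Qed.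

Lemma deg_FF0 (w : V l N -> nat) i n :
  (forall j, adj i j -> forall k, w (j, k) = 0%N) -> deg_is w (FF i n) 0.
Proof.
move=> w0; rewrite [X in deg_is w _ X](_ : 0 = \sum_(j | adj i j) (\sum_(k < g i j) 0%Z)); last first.
  by rewrite big1 // => j _; rewrite big1.
apply: deg_is_prod => j ij; apply: deg_is_prod => k _.
by have := deg_yy w j (n + s i j + (k.+1 * D j)%:Z); rewrite w0.
Qed.

Lemma cyc_prod_qq_neq1 i n : cyc_prod (qq i) (D i) (P i) n != 1.
Proof.
(* No variable of label i enters F, so with this weight q has degree -2 and the product over the
   cycle has nonzero degree. *)
pose w (v : V l N) : nat := v.1 == i.
have dq k : deg_is w (qq i k) (0 - (1 + 1)).
  apply: deg_isM; first by apply: deg_FF0 => j ij k'; rewrite /w /=;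
    case: eqP ij => // ->; rewrite dk_irr.
  apply: deg_isV; apply: deg_isM; [have := deg_yy w i k | have := deg_yy w i (k + (D i)%:Z)];
    by rewrite /w /= eqxx.
have dA : deg_is w (cyc_prod (qq i) (D i) (P i) n) (\sum_(k < P i) (0 - (1 + 1))).
  by apply: deg_is_prod => k _; apply: dq.
apply/eqP => E; move: dA; rewrite E => /(deg_is_fun (deg_is1 A w)).
rewrite sumr_const card_ord -mulr_natr; have := dk_P_gt1 X i; lia.
Qed.

(** [refl_involutive] read through the graph of the substitution. All elements inverted on the way
    are subtraction-free, hence nonzero, so the transported formula is defined although [refl] is
    not yet a morphism. *)
Lemma rimg_dk_inverse i v : prel (rimg_dk i) (rimg_dk i v) (rvar A v).
Proof.
case: v => j k; have [->|ji] := eqVneq j i; last first.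
  by have := prel_var (rimg_dk i) (j, k); rewrite /rimg_dk /= (negPf ji).
pose y' := refl_y (D i) (P i) (yy i) (FF i).
have py n : prel (rimg_dk i) (yy i n) (y' n).
  by have := prel_var (rimg_dk i) (i, om n); rewrite rimg_dkE eqxx.
have pF n : prel (rimg_dk i) (FF i n) (FF i n).
  apply: prel_prod => j' ij'; apply: prel_prod => k' _.
  have := prel_var (rimg_dk i) (j', om (n + s i j' + (k'.+1 * D j')%:Z)).
  rewrite rimg_dkE; case: eqP => // E; by rewrite E dk_irr in ij'.
have sy' n : sf (y' n) by apply: sf_refl.
pose q' n := FF i n / (y' n * y' (n + (D i)%:Z)).
have pq n : prel (rimg_dk i) (qq i n) (q' n).
  apply: prel_mul => //; apply: prel_inv; last by apply: prel_mul.
  by apply/sf_neq0/sf_mul.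
have sq' n : sf (q' n) by apply: sf_div; [exact: sf_FF | exact: sf_mul].
have pf n : prel (rimg_dk i) (ff i n) (cyc_sum q' (D i) (P i) n).
  apply: prel_add; first exact: prel_1.
  by apply: prel_sum => k' _; apply: prel_prod => s' _.
have sf' n : sf (cyc_sum q' (D i) (P i) n) by apply: sf_cyc_sum.
have -> : rimg_dk i (i, k) = y' (Posz k) by rewrite /rimg_dk /= eqxx.
have <- : yy i (Posz k) = rvar A (i, k) by rewrite /yy om_val_id.
rewrite -[X in prel _ _ X](@refl_involutive _ _ _ (dk_P_gt0 i) _ _ (@periodic_yy i) (@periodic_FF i)
   (yy_neq0 i) (FF_neq0 i) (ff_neq0 i) (cyc_prod_qq_neq1 i)) /=.
exact: prel_mul (prel_mul (pf _) (prel_inv (sf_neq0 (sf' _)) (pf _)))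
                (prel_mul (pF _) (prel_inv (sf_neq0 (sy' _)) (py _))).
Qed.

Lemma rimg_dk_indep i : alg_indep (rimg_dk i).
Proof. exact: alg_indep_inverse (rimg_dk_inverse i). Qed.

Definition refl i : K -> K := rsubst (rimg_dk i).

HB.instance Definition _ i := GRing.isZmodMorphism.Build K K (refl i)
  (rsubst_is_zmod_morphism (@rimg_dk_indep i)).
HB.instance Definition _ i := GRing.isMonoidMorphism.Build K K (refl i)
  (rsubst_is_monoid_morphism (@rimg_dk_indep i)).

Lemma refl_cst i (c : rf_C A) : refl i (rcst c) = rcst c.
Proof. exact: rsubst_cst (@rimg_dk_indep i) c. Qed.

Lemma refl_var i v : refl i (rvar A v) = rimg_dk i v.
Proof. exact: rsubst_var (@rimg_dk_indep i) v. Qed.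

Lemma refl_yy i n : refl i (yy i n) = refl_y (D i) (P i) (yy i) (FF i) n.
Proof. by rewrite refl_var rimg_dkE eqxx. Qed.

Lemma refl_yy_ne i j n : j != i -> refl i (yy j n) = yy j n.
Proof. by move=> ji; rewrite refl_var rimg_dkE (negPf ji). Qed.

Lemma refl_FF i n : refl i (FF i n) = FF i n.
Proof.
rewrite rmorph_prod; apply: eq_bigr => j ij; rewrite rmorph_prod; apply: eq_bigr => k _.
by rewrite /= refl_yy_ne //; apply: contraTneq ij => ->; rewrite dk_irr.
Qed.

Lemma reflK i : involutive (refl i).
Proof.
move=> z; have E := @ratfun_morph_ext _ A (refl i \o refl i) idfun.
apply: E => [c|v] /=; first by rewrite !refl_cst.
by rewrite refl_var; apply: prel_rsubstE (@rimg_dk_indep i) _ _ (rimg_dk_inverse i v).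
Qed.

Lemma riccati i n :
  refl i (yy i n) + FF i n / refl i (yy i (n + (D i)%:Z)) =
  yy i n + FF i n / yy i (n + (D i)%:Z).
Proof.
rewrite !refl_yy; apply: refl_riccati => //.
- exact: dk_P_gt0. - exact: periodic_yy. - exact: periodic_FF.
- exact: yy_neq0. - exact: FF_neq0. - exact: ff_neq0.
Qed.

Lemma refl_yy_mul i n : refl i (yy i n) =
  yy i n * (qq i (n - (D i)%:Z) * ff i (n - (D i)%:Z - (D i)%:Z) / ff i (n - (D i)%:Z)).
Proof.
by rewrite refl_yy; apply: refl_yE; first [exact: dk_P_gt0 | exact: periodic_yy | exact: periodic_FF | exact: yy_neq0
  | exact: FF_neq0 | exact: ff_neq0].
Qed.

Lemma refl_qq i n : refl i (qq i n) =
  ff i n / (ff i (n - (D i)%:Z - (D i)%:Z) * qq i (n - (D i)%:Z)).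
Proof.
rewrite fmorph_div rmorphM /= !refl_yy refl_FF.
by apply: refl_q; first [exact: dk_P_gt0 | exact: periodic_yy | exact: periodic_FF | exact: yy_neq0
  | exact: FF_neq0 | exact: ff_neq0].
Qed.

(* Only the k-th shifts of y_i occur, so the factors of the quotient telescope. *)
Lemma refl_qq_ne i j n : j != i -> refl i (qq j n) = qq j n *
  (if adj j i then \prod_(k < g j i)
     (qq i (n + s j i + (k * D i)%:Z) * ff i (n + s j i + (k * D i)%:Z - (D i)%:Z) /
      ff i (n + s j i + (k * D i)%:Z)) else 1).
Proof.
move=> ji; rewrite /qq fmorph_div rmorphM /= !(refl_yy_ne _ ji) [RHS]mulrAC; congr (_ / _).
have Fne (k : 'I_l) m : k != i -> refl i (yy k m) = yy k m by apply: refl_yy_ne.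
case: ifP => aji; last first.
  rewrite mulr1 rmorph_prod; apply: eq_bigr => k jk; rewrite rmorph_prod; apply: eq_bigr => m _.
  by rewrite /= Fne //; apply: contraTneq jk => ->; rewrite aji.
rewrite /FF (bigD1 i) //= rmorphM [RHS]mulrAC -big_split /=; congr (_ * _); last first.
  rewrite rmorph_prod; apply: eq_bigr => k /andP[jk ki]; rewrite rmorph_prod.
  by apply: eq_bigr => m _; rewrite /= Fne.
rewrite rmorph_prod; apply: eq_bigr => k _; rewrite /= refl_yy_mul.
by have -> : n + s j i + (k.+1 * D i)%:Z - (D i)%:Z = n + s j i + (k * D i)%:Z by lia.
Qed.

(** Since q has degree v - 2u < 0, f has degree 0 and only F / y contributes. Degrees are required
    only at times congruent to n0 modulo D_i, because f stays on one cycle. *)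
Lemma deg_refl (w : V l N -> nat) (phi : {rmorphism K -> K}) i n0 (u v : int) :
  (forall k : int, deg_is w (phi (yy i (n0 + k * (D i)%:Z))) u) ->
  (forall k : int, deg_is w (phi (FF i (n0 + k * (D i)%:Z))) v) ->
  0 < 2 * u - v ->
  forall k : int, deg_is w (phi (refl i (yy i (n0 + k * (D i)%:Z)))) (v - u).
Proof.
move=> dy dF uv k.
have dq (m : int) : deg_is w (phi (qq i (n0 + m * (D i)%:Z))) (v - (u + u)).
  rewrite /qq fmorph_div rmorphM /=; apply: deg_isM => //; apply: deg_isV.
  by apply: deg_isM => //; have := dy (m + 1); rewrite mulrDl mul1r addrA.
have df (m : int) : deg_is w (phi (ff i (n0 + m * (D i)%:Z))) 0.
  rewrite rmorphD rmorph1 /=; apply: (@deg_is_1add _ _ _ _ (-1)) => //.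
  rewrite rmorph_sum; elim/big_ind: _ => [|x y dx dy'|j _]; [exact: dle0 | exact: dleD |].
  rewrite /= rmorph_prod.
  have [_ + _] : deg_is w (\prod_(s0 < j.+1) phi (qq i (n0 + m * (D i)%:Z - (s0 * D i)%:Z)))
     (\sum_(s0 < j.+1) (v - (u + u))).
    apply: deg_is_prod => s0 _; have := dq (m - s0%:Z).
    by congr (deg_is w (phi (qq i _)) _); lia.
  by apply: dleW; rewrite sumr_const card_ord -mulr_natr; nia.
have -> : v - u = 0 - 0 + (v - u) by lia.
rewrite refl_yy !rmorphM !fmorphV /=.
have E1 : n0 + k * (D i)%:Z - 2 * (D i)%:Z = n0 + (k - 2) * (D i)%:Z by lia.
have E2 : n0 + k * (D i)%:Z - (D i)%:Z = n0 + (k - 1) * (D i)%:Z by lia.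
rewrite E1 E2; apply: deg_isM; apply: deg_isM => //; try exact: deg_isV.
- exact: df.
- by apply: deg_isV; apply: df.
Qed.

Lemma alt_rmorphism m (f h : {rmorphism K -> K}) :
  exists r : {rmorphism K -> K}, r =1 alt m f h.
Proof.
elim: m f h => [|m IH] f h; first by exists idfun.
have [r E] := IH h f; exists (f \o r) => x /=; by rewrite E.
Qed.

Lemma alt_fix m (f h : K -> K) z : f z = z -> h z = z -> alt m f h z = z.
Proof. by elim: m f h => //= m IH f h fz hz; rewrite IH. Qed.

Section ShortLong.
Variables i j : 'I_l.
Hypotheses (aij : adj i j) (gij : g i j = 1%N).
Let gg := g j i.
Let ji : j != i. Proof. by apply: contraTneq aij => ->; rewrite dk_irr. Qed.
Let aji : adj j i. Proof. by rewrite dk_sym. Qed.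
Let Dj : D j = (gg * D i)%N. Proof. by rewrite -(dk_gD aij) gij mul1n. Qed.
Let ss : s i j + s j i = - (D j)%:Z. Proof. by rewrite (dk_s_sum aij) gij mul1n. Qed.
Let coef (a b : 'I_l) n : K :=
  \prod_(j' | adj a j' && (j' != b)) \prod_(k < g a j') yy j' (n + s a j' + (k.+1 * D j')%:Z).

Let coef_fix (a b : 'I_l) n (c : 'I_l) : (c == a) || (c == b) -> refl c (coef a b n) = coef a b n.
Proof.
move=> cab; rewrite rmorph_prod; apply: eq_bigr => j' /andP[aj' j'b].
rewrite rmorph_prod; apply: eq_bigr => k _; rewrite /= refl_yy_ne //.
by apply: contraTneq cab => <-; rewrite (negPf j'b) orbF; apply: contraTneq aj' => ->; rewrite dk_irr.
Qed.

Let FFi n : FF i n = coef i j n * yy j (n + s i j + (D j)%:Z).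
Proof. by rewrite /FF (bigD1 j) //= gij big_ord1 mul1n mulrC. Qed.

Let FFj n : FF j n = coef j i n * \prod_(k < gg) yy i (n + s j i + (k.+1 * D i)%:Z).
Proof. by rewrite /FF (bigD1 i) //= mulrC. Qed.

(** All other labels get weight 0, so that the coefficients coming from further neighbours have
    degree 0. *)
Let w (v : V l N) : nat :=
  if v.1 == i then absz (top_degrees gg).1 else if v.1 == j then absz (top_degrees gg).2 else 0%N.

Let top_ge0 : (0 <= (top_degrees gg).1) && (0 <= (top_degrees gg).2).
Proof. by rewrite /top_degrees; case: gg => [|[|[|]]]. Qed.

Let deg_yi n : deg_is w (yy i n) (top_degrees gg).1.
Proof. by have := deg_yy w i n; rewrite /w /= eqxx gez0_abs //; case/andP: top_ge0. Qed.

Let deg_yj n : deg_is w (yy j n) (top_degrees gg).2.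
Proof.
by have := deg_yy w j n; rewrite /w /= (negPf ji) eqxx gez0_abs //; case/andP: top_ge0.
Qed.

Let deg_coef a b n : (a == i) && (b == j) || (a == j) && (b == i) -> deg_is w (coef a b n) 0.
Proof.
move=> ab; rewrite [X in deg_is w _ X](_ : 0 =
    \sum_(j' | adj a j' && (j' != b)) (\sum_(k < g a j') 0%Z)); last first.
  by rewrite big1 // => j' _; rewrite big1.
apply: deg_is_prod => j' /andP[aj' j'b]; apply: deg_is_prod => k _.
have := deg_yy w j' (n + s a j' + (k.+1 * D j')%:Z); rewrite /w /=.
have j'a : j' != a by apply: contraTneq aj' => ->; rewrite dk_irr.
by case/orP: ab => /andP[/eqP Ea /eqP Eb]; rewrite -Ea -Eb (negPf j'b) (negPf j'a).
Qed.

(** Here g_ij = 1 gives D_j = g_ji D_i, so i plays the short root. The long variable of the rank 2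
    system is not y_j but F_i, that is y_j times a product over the other neighbours of i, which
    both reflections fix. *)
Lemma braid_short_long z :
  alt (longest_length gg) (refl i) (refl j) z = alt (longest_length gg) (refl j) (refl i) z.
Proof.
(* The base time n0 selects a residue class modulo D_i, and k counts steps of length D_i; each class
   gives one rank 2 system. *)
pose al n0 (k : int) := yy i (n0 + k * (D i)%:Z).
pose t n0 (k : int) := n0 + k * (D i)%:Z + s i j + (D j)%:Z.
pose p n0 (k : int) := FF i (n0 + k * (D i)%:Z).
pose c n0 (k : int) := coef i j (n0 + k * (D i)%:Z).
(* Forced by rewriting the Riccati identity of y_j, multiplied by c(k), in terms of p = c y_j: the
   denominator y_j contributes the second factor c. *)
pose e n0 (k : int) := c n0 k * c n0 (k + gg%:Z) * coef j i (t n0 k).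
have pE n0 k : p n0 k = c n0 k * yy j (t n0 k) by rewrite /p FFi.
have tg n0 k : t n0 (k + gg%:Z) = t n0 k + (D j)%:Z by rewrite /t Dj; lia.
have FjE n0 k : FF j (t n0 k) = coef j i (t n0 k) * \prod_(m < gg) al n0 (k + m.+1%:Z).
  rewrite FFj; congr (_ * _); apply: eq_bigr => m _; congr (yy i _).
  by rewrite /t; move: ss; nia.
have ri_c n0 k : refl i (c n0 k) = c n0 k by apply: coef_fix; rewrite eqxx.
have rj_c n0 k : refl j (c n0 k) = c n0 k by apply: coef_fix; rewrite eqxx orbT.
have ri_e n0 k : refl i (e n0 k) = e n0 k.
  by rewrite !rmorphM /= !ri_c coef_fix ?eqxx ?orbT.
have rj_e n0 k : refl j (e n0 k) = e n0 k by rewrite !rmorphM /= !rj_c coef_fix ?eqxx.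
have dc n0 k : deg_is w (c n0 k) 0 by apply: deg_coef; rewrite !eqxx.
have de n0 k : deg_is w (e n0 k) 0.
  have dc2 : deg_is w (coef j i (t n0 k)) 0 by apply: deg_coef; rewrite !eqxx orbT.
  by have := deg_isM (deg_isM (dc n0 k) (dc n0 (k + gg%:Z))) dc2; rewrite !addr0.
have c0 n0 k : c n0 k != 0 by case: (dc n0 k).
have main n0 := @rank2_braid _ A w (refl i) (refl j) (al n0) (p n0) (e n0) gg.
have {}main n0 n :
  alt (longest_length gg) (refl i) (refl j) (al n0 n) =
    alt (longest_length gg) (refl j) (refl i) (al n0 n) /\
  alt (longest_length gg) (refl i) (refl j) (p n0 n) =
    alt (longest_length gg) (refl j) (refl i) (p n0 n).
  apply: main.
  - exact: dk_g_range.
  - move=> g3 k; have nb := dk_g3 aji g3.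
    have cE a b m : (a == i) && (b == j) || (a == j) && (b == i) -> coef a b m = 1.
      move=> ab; rewrite /coef big1 // => j' /andP[aj'].
      case/orP: ab => /andP[/eqP Ea /eqP Eb]; rewrite Ea Eb in aj' *.
        by rewrite (proj2 (nb j') aj') eqxx.
      by rewrite (proj1 (nb j') aj') eqxx.
    by rewrite /e /c !cE ?eqxx ?orbT // !mulr1.
  - by move=> k; apply: refl_FF.
  - by move=> k; apply: refl_yy_ne; rewrite eq_sym.
  - by move=> k; apply: ri_e.
  - by move=> k; apply: rj_e.
  - move=> k; have := riccati i (n0 + k * (D i)%:Z).
    by rewrite /al /p mulrDl mul1r addrA.
  - move=> k; rewrite !pE !rmorphM /= !rj_c tg.
    have := riccati j (t n0 k); rewrite FjE => R.
    have y1 := yy_neq0 j (t n0 k + (D j)%:Z); have y2 : refl j (yy j (t n0 k + (D j)%:Z)) != 0.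
      by rewrite fmorph_eq0.
    have E y : y != 0 -> e n0 k * \prod_(m < gg) al n0 (k + m.+1%:Z) / (c n0 (k + gg%:Z) * y) =
        c n0 k * (coef j i (t n0 k) * \prod_(m < gg) al n0 (k + m.+1%:Z) / y).
      by move=> yn0; rewrite /e; field; rewrite yn0 c0.
    by rewrite !E // -!mulrDr R.
  - move=> phi u v fix_phi da dp uv k; apply: deg_refl => // m; exact: dp.
  - move=> phi u v fix_phi da dp uv k.
    have phi_c m : phi (c n0 m) = c n0 m by apply: fix_phi; [apply: ri_c | apply: rj_c].
    have phi_c2 m : phi (coef j i m) = coef j i m.
      by apply: fix_phi; apply: coef_fix; rewrite eqxx ?orbT.
    rewrite pE rmorphM /= rj_c rmorphM /= phi_c -[_ - v]add0r; apply: deg_isM => //.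
    have tm m : t n0 k + m * (D j)%:Z = t n0 (k + m * gg%:Z) by rewrite /t Dj; lia.
    have -> : t n0 k = t n0 k + 0 * (D j)%:Z by rewrite mul0r addr0.
    apply: (deg_refl (u := v)) => // m; rewrite tm.
      have := deg_isM (dp (k + m * gg%:Z)) (deg_isV (dc n0 (k + m * gg%:Z))).
      by rewrite pE rmorphM /= phi_c mulrAC divff // mul1r oppr0 addr0.
    rewrite FjE rmorphM /= phi_c2 -[_ * u]add0r.
    apply: deg_isM; first by apply: deg_coef; rewrite !eqxx orbT.
    rewrite rmorph_prod [X in deg_is w _ X](_ : _ = \sum_(s0 < gg) u); last first.
      by rewrite sumr_const card_ord -mulr_natl natz.
    by apply: deg_is_prod => s0 _; apply: da.
  - by move=> k; apply: deg_yi.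
  - by move=> k; rewrite pE -[(top_degrees gg).2]add0r; apply: deg_isM.
  - exact: de.
have [r1 E1] := alt_rmorphism (longest_length gg) (refl i) (refl j).
have [r2 E2] := alt_rmorphism (longest_length gg) (refl j) (refl i).
rewrite -E1 -E2; apply: ratfun_morph_ext => [a|[k n]].
  by rewrite E1 E2 !alt_fix //=; apply: refl_cst.
have <- : yy k (Posz n) = rvar A (k, n) by rewrite /yy om_val_id.
have [->|ki] := eqVneq k i.
  by rewrite E1 E2; have [+ _] := main (Posz n) 0; rewrite /al mul0r addr0.
have [->|kj] := eqVneq k j; last by rewrite E1 E2 !alt_fix //=; apply: refl_yy_ne.
(* The base time is such that the long variable at k = 0 contains y_j at time n; its coefficient is
   fixed by both words and cancels. *)
have [_] := main (Posz n - s i j - (D j)%:Z) 0; rewrite pE /t.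
have -> : Posz n - s i j - (D j)%:Z + 0 * (D i)%:Z + s i j + (D j)%:Z = Posz n by lia.
rewrite -E1 -E2 !rmorphM !E1 !E2 /=.
rewrite [alt _ _ _ (c _ _)]alt_fix // [alt _ _ _ (c _ _)]alt_fix //.
exact: mulfI.
Qed.

End ShortLong.

Definition cox i j : nat :=
  if i == j then 1%N else if adj i j then longest_length (g i j * g j i) else 2%N.

Lemma cox_relation i j z : iter (cox i j) (refl i \o refl j) z = z.
Proof.
rewrite /cox; have [->|ij] := eqVneq i j; first by rewrite /= reflK.
case: ifP => aij; last first.
  have aji : adj j i = false by rewrite dk_sym.
  have rr z' : refl i (refl j z') = refl j (refl i z').
    have E := @ratfun_morph_ext _ A (refl i \o refl j) (refl j \o refl i).
    apply: E => [c|[k n]] /=; first by rewrite !refl_cst.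
    have <- : yy k (Posz n) = rvar A (k, n) by rewrite /yy om_val_id.
    have fixF a b m : adj a b = false -> refl b (FF a m) = FF a m.
      move=> ab; rewrite rmorph_prod; apply: eq_bigr => k' ak; rewrite rmorph_prod.
      by apply: eq_bigr => m' _; rewrite /= refl_yy_ne //; apply: contraTneq ak => ->; rewrite ab.
    have comm a b m : adj a b = false -> b != a -> refl b (refl a (yy a m)) = refl a (yy a m).
      move=> ab ba; have fixq k' : refl b (qq a k') = qq a k'.
        by rewrite /qq fmorph_div rmorphM /= fixF // !refl_yy_ne // eq_sym.
      have fixf k' : refl b (ff a k') = ff a k'.
        rewrite rmorphD rmorph1 rmorph_sum; congr (1 + _); apply: eq_bigr => x _.
        by rewrite rmorph_prod; apply: eq_bigr => x' _; apply: fixq.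
      by rewrite refl_yy_mul rmorphM fmorph_div rmorphM /= !fixf fixq refl_yy_ne // eq_sym.
    have [->|ki] := eqVneq k i.
      by rewrite (refl_yy_ne _ ij) comm // eq_sym.
    have [->|kj] := eqVneq k j; last by rewrite !refl_yy_ne.
    by rewrite comm // (refl_yy_ne (i := i)) // eq_sym.
  by rewrite /= rr !reflK.
(* At least one of g_ij and g_ji is 1. Proving both products for that orientation covers either
   order of i and j. *)
suff H a b : adj a b -> g a b = 1%N -> forall z,
    iter (longest_length (g b a)) (refl a \o refl b) z = z /\
    iter (longest_length (g b a)) (refl b \o refl a) z = z.
  case/orP: (dk_g1 aij) => /eqP E; first by rewrite E mul1n; case: (H _ _ aij E z).
  by rewrite E muln1; have aji := aij; rewrite dk_sym in aji; case: (H _ _ aji E z).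
move=> ab gab {}z; have B := braid_short_long ab gab.
have /andP[] := @dk_g_range _ _ X b a (etrans (dk_sym X b a) ab).
move: B; case: (g b a) => [|[|[|[|k]]]] //= B _ _.
- split.
  + by rewrite (B (refl b (refl a (refl b z)))) !reflK.
  + by rewrite -(B (refl a (refl b (refl a z)))) !reflK.
- split.
  + by rewrite (B (refl a (refl b (refl a (refl b z))))) !reflK.
  + by rewrite -(B (refl b (refl a (refl b (refl a z))))) !reflK.
- split.
  + by rewrite (B (refl a (refl b (refl a (refl b (refl a (refl b z))))))) !reflK.
  + by rewrite -(B (refl b (refl a (refl b (refl a (refl b (refl a z))))))) !reflK.
Qed.

End Reflections.

(** * Seed mutations and the exchange at two vertices *)

Definition mut_incr (a b : int) : int := ((`|a| * b + a * `|b|) %/ 2)%Z.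

Lemma mut_incr1 a : mut_incr a 1 = Num.max a 0.
Proof. by rewrite /mut_incr; case: (lerP 0 a) => ha; lia. Qed.

Lemma mut_incrN1 a : mut_incr a (-1) = Num.min a 0.
Proof. by rewrite /mut_incr; case: (lerP 0 a) => ha; lia. Qed.

Lemma mut_incr0 a : mut_incr a 0 = 0.
Proof. by rewrite /mut_incr normr0 !mulr0. Qed.

Lemma mut_incr0l a : mut_incr 0 a = 0.
Proof. by rewrite /mut_incr normr0 !mul0r. Qed.

Lemma mut_incrC a b : mut_incr a b = mut_incr b a.
Proof. by rewrite /mut_incr addrC mulrC [X in _ + X]mulrC. Qed.

Lemma mut_incrNN a b : mut_incr (- a) (- b) = - mut_incr a b.
Proof.
rewrite /mut_incr !normrN.
have ev c : ((c * 2) %/ 2)%Z = c by apply: mulzK.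
case: (ger0P a) => ha; case: (ger0P b) => hb.
- have -> : a * - b + - a * b = (- (a * b)) * 2 by ring.
  have -> : a * b + a * b = (a * b) * 2 by ring.
  by rewrite !ev.
- have -> : a * - b + - a * - b = 0 by ring.
  by have -> : a * b + a * - b = 0 by ring.
- have -> : - a * - b + - a * b = 0 by ring.
  by have -> : - a * b + a * b = 0 by ring.
- have -> : - a * - b + - a * - b = (a * b) * 2 by ring.
  have -> : - a * b + a * - b = - (a * b) * 2 by ring.
  by rewrite !ev opprK.
Qed.

Section Mutations.
(** [pos] stands for the subtraction-free elements: closed under everything a mutation does to
    X-variables and never zero, so every cancellation is legitimate. *)
Variables (W : finType) (K : fieldType) (pos : K -> Prop).
Hypothesis pos1 : pos 1.
Hypothesis posD : forall x y, pos x -> pos y -> pos (x + y).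
Hypothesis posM : forall x y, pos x -> pos y -> pos (x * y).
Hypothesis posV : forall x, pos x -> pos x^-1.
Hypothesis pos_neq0 : forall x, pos x -> x != 0.
Implicit Types (s : seed W K) (k x y : W) (c : int) (u : K).

Definition mfac c u : K := (1 + u ^ (- sgz c)) ^ (- c).

Lemma posX u c : pos u -> pos (u ^ c).
Proof.
move=> pu; have H n : pos (u ^+ n) by elim: n => // n IH; rewrite exprS; apply: posM.
by case: c => n; [exact: H | apply: posV; exact: H].
Qed.

Lemma pos_mfac c u : pos u -> pos (mfac c u).
Proof. by move=> pu; apply/posX/posD => //; apply: posX. Qed.

Lemma mfac0 u : mfac 0 u = 1. Proof. by rewrite /mfac oppr0 expr0z. Qed.
Lemma mfac1 u : pos u -> mfac 1 u = u / (1 + u).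
Proof.
move=> pu; rewrite /mfac sgz1 !exprN1; have u0 := pos_neq0 pu.
have u1 : 1 + u != 0 by apply/pos_neq0/posD.
by have -> : 1 + u^-1 = (1 + u) / u; [field | rewrite invf_div].
Qed.
Lemma mfacN1 u : mfac (-1) u = 1 + u.
Proof. by rewrite /mfac sgzN sgz1 opprK !expr1z. Qed.

Lemma mfacNV c u : pos u -> mfac (- c) u^-1 = (mfac c u)^-1.
Proof. by move=> pu; rewrite /mfac sgzN !opprK exprz_inv invr_expz opprK. Qed.

Definition seed_eq s s' := s.1 =2 s'.1 /\ s.2 =1 s'.2.
Definition seed_pos s := forall x, pos (s.2 x).

Lemma seed_eq_trans s s' s'' : seed_eq s s' -> seed_eq s' s'' -> seed_eq s s''.
Proof. by move=> [E1 E2] [E3 E4]; split=> [x y|x]; rewrite ?E1 ?E2 ?E3 ?E4. Qed.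

Lemma mutate_e k s x y : (mutate k s).1 x y =
  if (x == k) || (y == k) then - s.1 x y else s.1 x y + mut_incr (s.1 x k) (s.1 k y).
Proof. by []. Qed.

Lemma mutate_x k s x : (mutate k s).2 x =
  if x == k then (s.2 k)^-1 else s.2 x * mfac (s.1 x k) (s.2 k).
Proof. by []. Qed.

Lemma mutate_eq k s s' : seed_eq s s' -> seed_eq (mutate k s) (mutate k s').
Proof. by case=> E1 E2; split=> [x y|x]; rewrite ?mutate_e ?mutate_x ?E1 ?E2. Qed.

Lemma mutate_pos k s : seed_pos s -> seed_pos (mutate k s).
Proof.
move=> ps x; rewrite mutate_x; case: ifP => _; first exact: posV.
by apply: posM => //; apply: pos_mfac.
Qed.

(** The second mutation sees the opposite entry and the inverse variable, so its factor is the
    inverse of the first one. *)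
Lemma mutateK k s : seed_pos s -> seed_eq (mutate k (mutate k s)) s.
Proof.
move=> ps; split=> [x y|x].
  case xk: (x == k); case yk: (y == k); rewrite !mutate_e ?xk ?yk ?eqxx ?orbT /= ?opprK //.
  by rewrite mut_incrNN addrK.
case xk: (x == k); rewrite !mutate_x ?mutate_e xk ?eqxx ?orbT /= ?invrK ?(eqP xk) //.
rewrite mfacNV // mulfK //.
exact/pos_neq0/pos_mfac.
Qed.

Definition runM (ks : seq W) s := foldl (fun s k => mutate k s) s ks.

Lemma run_Mu ks s : run [seq Mu k | k <- ks] s = runM ks s.
Proof. by elim: ks s => //= k ks IH s; rewrite -IH. Qed.

Lemma runM_eq ks s s' : seed_eq s s' -> seed_eq (runM ks s) (runM ks s').
Proof. by elim: ks s s' => //= k ks IH s s' E; apply/IH/mutate_eq. Qed.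

Lemma runM_rcons ks k s : runM (rcons ks k) s = mutate k (runM ks s).
Proof. by rewrite /runM foldl_rcons. Qed.

Lemma runM_rev ks s : seed_pos s -> seed_eq (runM (rev ks) (runM ks s)) s.
Proof.
elim: ks s => //= k ks IH s ps; rewrite rev_cons runM_rcons.
apply: seed_eq_trans (mutateK k ps); apply: mutate_eq.
exact/IH/mutate_pos.
Qed.

Definition xchg (a b u : W) := if u == a then b else if u == b then a else u.

Lemma swap_e a b s x y : (swap_seed a b s).1 x y = s.1 (xchg a b x) (xchg a b y).
Proof. by []. Qed.

Lemma swap_x a b s x : (swap_seed a b s).2 x = s.2 (xchg a b x).
Proof. by []. Qed.

(* Mutating at two non-adjacent vertices a, b and exchanging them preserves the
   exchange matrix as soon as every other vertex sees a and b with opposite signs. *)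
Section Exchange.
Variables (a b : W) (s : seed W K).
Hypothesis ab : a != b.
Hypotheses (eaa : s.1 a a = 0) (ebb : s.1 b b = 0) (eab : s.1 a b = 0) (eba : s.1 b a = 0).
Hypothesis row : forall x, x != a -> x != b -> s.1 x b = - s.1 x a.
Hypothesis col : forall x, x != a -> x != b -> s.1 b x = - s.1 a x.
Let s' := swap_seed a b (mutate b (mutate a s)).

Lemma exchange_e : s'.1 =2 s.1.
Proof.
move=> x y; rewrite /s' swap_e /xchg; have ba : b != a by rewrite eq_sym.
have cl := (eqxx, orbT, negPf ba, negPf ab, eaa, ebb, eab, eba, oppr0, mut_incr0, mut_incr0l, addr0).
have [->|xa] := eqVneq x a; [|have [->|xb] := eqVneq x b];
  (have [->|ya] := eqVneq y a; [|have [->|yb] := eqVneq y b]);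
  rewrite ?cl !mutate_e ?cl.
- by [].
- by [].
- by rewrite (negPf ya) (negPf yb) /= ?cl col ?opprK.
- by [].
- by [].
- by rewrite (negPf ya) (negPf yb) /= ?cl -col.
- by rewrite (negPf xa) /= row ?opprK.
- by rewrite (negPf xb) /= row.
- by rewrite (negPf xa) ?(negPf xb) (negPf ya) ?(negPf yb) /= ?cl row // col // mut_incrNN addrK.
Qed.

Lemma exchange_x x : s'.2 x =
  if x == a then (s.2 b)^-1 else if x == b then (s.2 a)^-1
  else s.2 x * mfac (s.1 x a) (s.2 a) * mfac (- s.1 x a) (s.2 b).
Proof.
have ba : b != a by rewrite eq_sym.
rewrite /s' swap_x /xchg.
have Xb : (mutate a s).2 b = s.2 b by rewrite mutate_x (negPf ba) eba mfac0 mulr1.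
case: (eqVneq x a) => [_|xa]; first by rewrite mutate_x eqxx Xb.
case: (eqVneq x b) => [_|xb].
  by rewrite mutate_x (negPf ab) Xb mutate_e eqxx eab oppr0 mfac0 mulr1 mutate_x eqxx.
rewrite mutate_x (negPf xb) mutate_x (negPf xa) Xb mutate_e (negPf xa) (negPf ba) eab.
by rewrite mut_incr0 addr0 row.
Qed.

End Exchange.
End Mutations.

(** * Rational identities along one cycle *)

Section CycleAlgebra.
Variable K : fieldType.

(** 1 + X_(k-1) + X_(k-1) X_(k-2) + ... + X_(k-1) ... X_0, the truncation of f that does not wrap
    around the cycle. *)
Fixpoint csum (X : int -> K) (k : nat) : K :=
  if k is k'.+1 then 1 + X k'%:Z * csum X k' else 1.

Definition cpi (X : int -> K) (k : nat) : K := \prod_(i < k) X i%:Z.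

Lemma cpiS X k : cpi X k.+1 = cpi X k * X k%:Z.
Proof. by rewrite /cpi big_ord_recr. Qed.

Lemma csum_cyc X k : csum X k = cyc_sum X 1 k.+1 (k%:Z - 1).
Proof.
elim: k => [|k IH]; first by rewrite /cyc_sum /= big_ord0 addr0.
have E : k.+1%:Z - 1 = k%:Z by lia.
rewrite /= IH /cyc_sum /= E; congr (1 + _).
rewrite big_ord_recl big_ord1 mul0n subr0 mulrDr mulr1; congr (_ + _).
rewrite mulr_sumr; apply: eq_bigr => i _.
rewrite lift0 [RHS]big_ord_recl mul0n subr0; congr (_ * _).
by apply: eq_bigr => j _; congr X; rewrite lift0; lia.
Qed.

Variables (X : int -> K) (P : nat).
Let p := P.+2.
Hypothesis perX : forall n, X (n + p%:Z) = X n.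
Let f := cyc_sum X 1 p.
Hypotheses (X0 : forall n, X n != 0) (f0 : forall n, f n != 0).
Hypothesis S0 : forall k, csum X k != 0.
Let A := cyc_prod X 1 p 0.

Let pX : periodic 1 p X. Proof. by move=> n; rewrite muln1. Qed.

Lemma cpi_neq0 k : cpi X k != 0.
Proof. by apply/prodf_neq0 => i _. Qed.

Let perf n : f (n + p%:Z) = f n.
Proof. by have := cyc_sum_periodic pX n; rewrite muln1. Qed.

Let AE (k : nat) : cyc_prod X 1 p k%:Z = A.
Proof.
elim: k => // k <-; rewrite -[LHS](cyc_prod_shift (P := p)) //; congr (cyc_prod X 1 p _); lia.
Qed.

Let frec (k : nat) : f k%:Z = 1 - A + X k%:Z * f (k%:Z - 1).
Proof. by rewrite /f cyc_sum_rec // AE. Qed.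

Let AN1 : cyc_prod X 1 p (-1) = A.
Proof. by rewrite -[RHS](cyc_prod_shift (P := p)). Qed.

Let kap := X (-1) * f (-1 - 1).

Let kapE : kap = f (-1) - (1 - A).
Proof. by rewrite /f (@cyc_sum_rec _ _ _ _ (-1)) // AN1 /kap /f; ring. Qed.

Let kap0 : kap != 0. Proof. exact: mulf_neq0. Qed.

(** Both sides satisfy the same affine recursion in k, and [kap] is fixed by k = 0. This links f to
    sums that do not wrap; the closed forms after it reduce the later identities to field
    arithmetic. *)
Let L1 (k : nat) : f (k%:Z - 1) = (1 - A) * csum X k + cpi X k * kap.
Proof.
elim: k => [|k IH]; first by rewrite sub0r /cpi big_ord0 kapE /=; ring.
have -> : k.+1%:Z - 1 = k%:Z by lia.
by rewrite frec IH cpiS /=; ring.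
Qed.

Definition cyc_refl (n : int) : K := f n / (f (n - 1 - 1) * X (n - 1)).
Let X' := cyc_refl.

Let L2 (k : nat) : csum X' k = f (k%:Z - 1 - 1) * csum X k * X (k%:Z - 1) / (cpi X k * kap).
Proof.
elim: k => [|k IH].
  rewrite /= /cpi big_ord0 sub0r /kap; field.
  by rewrite X0 f0.
rewrite [csum X' k.+1]/= IH /X' /cyc_refl.
have -> : k.+1%:Z - 1 = k%:Z by lia.
have E := L1 k; rewrite [csum X k.+1]/= cpiS.
have -> : f k%:Z = 1 - A + X k%:Z * f (k%:Z - 1) by apply: frec.
have c0 := cpi_neq0 k.
apply: (mulIf (x := cpi X k * kap)); first by rewrite mulf_neq0.
have -> : (1 + (1 - A + X k * f (k%:Z - 1)) / (f (k%:Z - 1 - 1) * X (k%:Z - 1)) *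
    (f (k%:Z - 1 - 1) * csum X k * X (k%:Z - 1) / (cpi X k * kap))) * (cpi X k * kap) =
    cpi X k * kap + (1 - A + X k * f (k%:Z - 1)) * csum X k.
  by field; rewrite !X0 !f0 c0 kap0.
have -> : f (k%:Z - 1) * (1 + X k * csum X k) * X k / (cpi X k * X k * kap) * (cpi X k * kap) =
    f (k%:Z - 1) * (1 + X k * csum X k) by field; rewrite !X0 c0 kap0.
by rewrite E; ring.
Qed.

Let L3 (k : nat) : X' k%:Z * csum X' k = f k%:Z * csum X k / (cpi X k * kap).
Proof.
have c0 := cpi_neq0 k; rewrite L2 /X' /cyc_refl.
by field; rewrite !X0 !f0 c0 kap0.
Qed.

Let L4 (k : nat) : cpi X' k =
  f (k%:Z - 1) * f (k%:Z - 1 - 1) * X (k%:Z - 1) / (f (-1) * kap * cpi X k).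
Proof.
elim: k => [|k IH].
  by rewrite /cpi !big_ord0 sub0r /kap; field; rewrite X0 !f0.
rewrite !cpiS IH /X' /cyc_refl.
have -> : k.+1%:Z - 1 = k%:Z by lia.
by field; rewrite !X0 !f0 cpi_neq0 kap0.
Qed.

Let E1 : csum X P.+1 = f P%:Z.
Proof. by rewrite csum_cyc /f; congr (cyc_sum X 1 p _); lia. Qed.

Let E3 : kap = X P.+1%:Z * f P%:Z.
Proof. by rewrite /kap -(perX (-1)) -(perf (-1 - 1)); congr (X _ * f _); lia. Qed.

Let AP : A = cpi X P * X P%:Z * X P.+1%:Z.
Proof.
rewrite -!cpiS -(AE P.+1) /cyc_prod /cpi (reindex_inj rev_ord_inj) /=.
apply: eq_bigr => i _; congr X; have := ltn_ord i; rewrite /p; lia.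
Qed.

Let E2 : f (P%:Z - 1) = csum X P + cpi X P * X P.+1%:Z.
Proof.
apply: (mulfI (X0 P%:Z)); have := frec P; rewrite -E1 /= => E.
have -> : X P * f (P%:Z - 1) = 1 + X P * csum X P - (1 - A) by rewrite E; ring.
by rewrite AP; ring.
Qed.

Lemma cyc_refl_mid j : csum X' j.+2 / (X' j%:Z * csum X' j) = csum X j.+2 / (X j%:Z * csum X j).
Proof.
rewrite L3 L2 !cpiS; have -> : j.+2%:Z - 1 - 1 = j%:Z by lia.
have -> : j.+2%:Z - 1 = j.+1%:Z by lia.
have c0 := cpi_neq0 j; have := S0 j.+2; have := S0 j; move: (csum X j.+2) (csum X j) => a b a0 b0.
by field; rewrite !X0 !f0 c0 kap0 a0.
Qed.

Let Uc := X P%:Z * csum X P.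
Let Vc := X P.+1%:Z * cpi X P / csum X P.

(** [Uc] and [Vc] are the X-variables at the last two vertices once the first P have been mutated.
    Starting from X' they become the inverses of [Vc] and [Uc], which is the effect of mutating at
    both and transposing. *)
Lemma cyc_refl_U : X' P%:Z * csum X' P = Vc^-1.
Proof.
by rewrite L3 /Vc E3; field; rewrite S0 !X0 !f0 cpi_neq0.
Qed.

Lemma cyc_refl_V : X' P.+1%:Z * cpi X' P / csum X' P = Uc^-1.
Proof.
rewrite L4 L2 /Uc /X' /cyc_refl.
have -> : P.+1%:Z - 1 = P%:Z by lia.
have -> : f P.+1%:Z = f (-1) by rewrite -(perf (-1)); congr f; lia.
by field; rewrite S0 !X0 !f0 cpi_neq0 kap0.
Qed.

Lemma one_Uc : 1 + Uc = csum X P.+1. Proof. by []. Qed.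

Lemma one_Vc : 1 + Vc = f (P%:Z - 1) / csum X P.
Proof. by rewrite /Vc E2; field; rewrite S0. Qed.

(** Among the mutated vertices only v_(P-1) is still linked to the exchanged pair, so its variable
    picks up the two exchange factors. *)
Lemma cyc_refl_last j : P = j.+1 ->
  (X' j%:Z * csum X' j)^-1 = (X j%:Z * csum X j)^-1 * (1 + Uc) * (Vc / (1 + Vc)).
Proof.
move=> Pj; rewrite one_Vc one_Uc E1 L3 E3 /Vc.
have -> : cpi X P = cpi X j * X j%:Z by rewrite Pj cpiS.
have -> : P%:Z - 1 = j%:Z by lia.
by field; rewrite !S0 !X0 !f0 cpi_neq0.
Qed.

Definition cyc_q (n : int) : K := X n * f (n - 1) / f n.

Let u j := X j%:Z * csum X j.
Let u' j := X' j%:Z * csum X' j.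

(** For a vertex off the cycle that meets the j-th mutation with entry 1: the factor gained on the
    way out, divided by the one lost on the way back, is a single factor X f(n - 1) / f(n) of the
    reflection. *)
Lemma ratio_plus (j : nat) : (u j / (1 + u j)) / (u' j / (1 + u' j)) = cyc_q j%:Z.
Proof.
have -> : 1 + u j = csum X j.+1 by [].
have -> : 1 + u' j = csum X' j.+1 by [].
rewrite /u' L3 L2 /cyc_q /u cpiS; have -> : j.+1%:Z - 1 = j%:Z by lia.
have c0 := cpi_neq0 j; have := S0 j.+1; have := S0 j; move: (csum X j.+1) (csum X j) => a b a0 b0.
by field; rewrite !X0 !f0 c0 kap0 a0 b0.
Qed.

Let cyc_q_last : cyc_q P.+1%:Z = kap / f (-1).
Proof.
rewrite E3 /cyc_q; have -> : P.+1%:Z - 1 = P%:Z by lia.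
by congr (_ / _); rewrite -(perf (-1)); congr f; lia.
Qed.

Let cyc_q_prod k : \prod_(i < k) cyc_q i%:Z = cpi X k * f (-1) / f (k%:Z - 1).
Proof.
elim: k => [|k IH]; first by rewrite /cpi !big_ord0 sub0r mul1r divff.
rewrite big_ord_recr /= IH cpiS /cyc_q; have -> : k.+1%:Z - 1 = k%:Z by lia.
by field; rewrite !f0.
Qed.

(** An entry -1 accounts for a whole stretch of the cycle, v_(P+1) followed by v_0, ..., v_(j-1).
    This is the piece needed for windows that wrap around. *)
Lemma ratio_minus (j : nat) : (1 + u j) / (1 + u' j) = cyc_q P.+1%:Z * \prod_(i < j) cyc_q i%:Z.
Proof.
have -> : 1 + u j = csum X j.+1 by [].
have -> : 1 + u' j = csum X' j.+1 by [].
rewrite cyc_q_last cyc_q_prod L2 cpiS; have -> : j.+1%:Z - 1 = j%:Z by lia.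
have c0 := cpi_neq0 j; have := S0 j.+1; move: (csum X j.+1) => a a0.
by field; rewrite !X0 !f0 c0 kap0 a0.
Qed.

Lemma exchange_plus : Uc / (1 + Uc) * (1 + Vc) = cyc_q P%:Z.
Proof.
rewrite one_Vc one_Uc E1 /Uc /cyc_q.
by field; rewrite !f0 S0.
Qed.

Lemma exchange_minus : (1 + Uc) * (Vc / (1 + Vc)) = cyc_q P.+1%:Z * \prod_(i < P) cyc_q i%:Z.
Proof.
rewrite one_Vc one_Uc E1 /Vc cyc_q_last cyc_q_prod E3.
by field; rewrite !f0 S0.
Qed.

End CycleAlgebra.

(** * Exchange matrix entries during the mutations along a cycle *)

Ltac decide_nat := repeat match goal with
  | |- context [@eq_op _ ?a ?b] => first
      [ have -> : (a == b) = true by lia | have -> : (a == b) = false by lia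
      | let H := fresh in case H : (a == b) ]
  | |- context [leq ?a ?b] => first
      [ have -> : (a <= b)%N = true by lia | have -> : (a <= b)%N = false by lia
      | let H := fresh in case H : (a <= b)%N ]
  end.

(* The arrows of the cycle v_0 -> ... -> v_(P+1) -> v_0 after mutating at
   v_0, ..., v_(k-1). *)
Definition cyc_arrows (P k i j : nat) : nat :=
  (((i.+1 < k) && (j == i.+1)) + ((0 < k) && (i == k) && (j == k.-1)) +
  ((0 < k) && (i == k.-1) && (j == P.+1)) +
  ((k <= i) && (i < P.+1) && (j == i.+1)) + ((i == P.+1) && (j == k)))%N.

Definition cyc_eps (P k i j : nat) : int :=
  (cyc_arrows P k i j)%:Z - (cyc_arrows P k j i)%:Z.

Lemma cyc_eps_anti P k i j : cyc_eps P k i j = - cyc_eps P k j i.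
Proof. by rewrite /cyc_eps opprB. Qed.

(** The vertices not yet mutated form a shorter cycle. A triangle attaches v_(k-1) to its closing
    edge from v_(P+1) to v_k, and the older vertices trail behind v_(k-1), so v_k has at most three
    neighbours in the cycle. *)
Lemma cyc_eps_col P k i : (k < P)%N -> (i < P.+2)%N ->
  cyc_eps P k i k = if i == P.+1 then 1 else if i == k.+1 then -1
                    else if (0 < k)%N && (i == k.-1) then -1 else 0.
Proof.
move=> kP iP; rewrite /cyc_eps.
case: (eqVneq i P.+1) => [->|h1]; first by rewrite /cyc_arrows; decide_nat.
case: (eqVneq i k.+1) => [->|h2]; first by rewrite /cyc_arrows; decide_nat.
by case: andP => [[h3 /eqP ->]|h3]; rewrite /cyc_arrows; decide_nat.
Qed.

Lemma cyc_eps_step P k i j : (k < P)%N -> (i < P.+2)%N -> (j < P.+2)%N ->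
  cyc_eps P k.+1 i j = if (i == k) || (j == k) then - cyc_eps P k i j
    else cyc_eps P k i j + mut_incr (cyc_eps P k i k) (cyc_eps P k k j).
Proof.
move=> kP iP jP.
rewrite [cyc_eps P k k j]cyc_eps_anti !cyc_eps_col //.
case: ifP => [/orP[]/eqP->|/norP[ik jk]].
- rewrite [in RHS]cyc_eps_anti cyc_eps_col // opprK.
  case: (eqVneq j P.+1) => [->|h1]; first by rewrite /cyc_eps /cyc_arrows; decide_nat.
  case: (eqVneq j k.+1) => [->|h2]; first by rewrite /cyc_eps /cyc_arrows; decide_nat.
  by case: andP => [[h3 /eqP ->]|h3]; rewrite /cyc_eps /cyc_arrows; decide_nat.
- rewrite cyc_eps_col //.
  case: (eqVneq i P.+1) => [->|h1]; first by rewrite /cyc_eps /cyc_arrows; decide_nat.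
  case: (eqVneq i k.+1) => [->|h2]; first by rewrite /cyc_eps /cyc_arrows; decide_nat.
  by case: andP => [[h3 /eqP ->]|h3]; rewrite /cyc_eps /cyc_arrows; decide_nat.
have T1 : mut_incr 1 1 = 1 by []. have T2 : mut_incr 1 (-1) = 0 by [].
have T3 : mut_incr (-1) (-1) = -1 by []. have T4 : mut_incr (-1) 1 = 0 by [].
have tbl := (@opprK int, @oppr0 int, T1, T2, T3, T4, mut_incr0, mut_incr0l).
case: (eqVneq i P.+1) => [->|i1].
  case: (eqVneq j P.+1) => [->|j1].
    by rewrite ?tbl /cyc_eps /cyc_arrows; decide_nat.
  case: (eqVneq j k.+1) => [->|j2].
    by rewrite ?tbl /cyc_eps /cyc_arrows; decide_nat.
  case: andP => [[h3 /eqP ->]|h3].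
    by rewrite ?tbl /cyc_eps /cyc_arrows; decide_nat.
  by rewrite ?tbl /cyc_eps /cyc_arrows; decide_nat.
case: (eqVneq i k.+1) => [->|i2].
  case: (eqVneq j P.+1) => [->|j1].
    by rewrite ?tbl /cyc_eps /cyc_arrows; decide_nat.
  case: (eqVneq j k.+1) => [->|j2].
    by rewrite ?tbl /cyc_eps /cyc_arrows; decide_nat.
  case: andP => [[h3 /eqP ->]|h3].
    by rewrite ?tbl /cyc_eps /cyc_arrows; decide_nat.
  by rewrite ?tbl /cyc_eps /cyc_arrows; decide_nat.
case: andP => [[h4 /eqP ->]|h4].
  case: (eqVneq j P.+1) => [->|j1].
    by rewrite ?tbl /cyc_eps /cyc_arrows; decide_nat.
  case: (eqVneq j k.+1) => [->|j2].
    by rewrite ?tbl /cyc_eps /cyc_arrows; decide_nat.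
  case: andP => [[h3 /eqP ->]|h3].
    by rewrite ?tbl /cyc_eps /cyc_arrows; decide_nat.
  by rewrite ?tbl /cyc_eps /cyc_arrows; decide_nat.
by rewrite ?tbl /cyc_eps /cyc_arrows; decide_nat.
Qed.

(* The entries e(x, v_j) for a vertex x off the cycle, after k mutations. *)
Fixpoint row_after (P : nat) (r : nat -> int) (k : nat) : nat -> int :=
  if k is k'.+1 then
    let q := row_after P r k' in
    fun j => if j == k' then - q k' else
      q j + (if (j == k'.+1) || (0 < k')%N && (j == k'.-1) then Num.max (q k') 0
             else if j == P.+1 then Num.min (q k') 0 else 0)
  else r.

(** The entry at v_k is passed on to v_(k+1) if positive and to v_(P+1) if negative, so the total
    over unmutated vertices is conserved. When it is zero, the last two entries are opposite, as the
    exchange requires. *)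
Lemma row_after_sum P r k : (k <= P)%N ->
  \sum_(k <= j < P.+2) row_after P r k j = \sum_(0 <= j < P.+2) r j.
Proof.
elim: k => [//|k IH] kP; rewrite -(IH (ltnW kP)).
have sp (F : nat -> int) : \sum_(k.+1 <= j < P.+2) F j =
    F k.+1 + (\sum_(k.+2 <= j < P.+1) F j + F P.+1).
  rewrite big_nat_recr /=; last lia.
  rewrite big_ltn; last lia.
  by rewrite addrA.
rewrite [RHS]big_ltn; last lia.
rewrite !sp /= !eqxx /=.
have -> : (k.+1 == k) = false by lia.
have -> : (P.+1 == k) = false by lia.
have -> : (P.+1 == k.+1) = false by lia.
have -> : (0 < k)%N && (P.+1 == k.-1) = false by lia.
set S1 := \sum_(_ <= _ < _) _; set S2 := \sum_(_ <= _ < _) _.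
have -> : S1 = S2.
  apply: eq_big_nat => j /andP[j1 j2].
  have -> : (j == k) = false by lia.
  have -> : (j == k.+1) = false by lia.
  have -> : (0 < k)%N && (j == k.-1) = false by lia.
  have -> : (j == P.+1) = false by lia.
  by rewrite addr0.
by rewrite /=; move: (row_after P r k k) (row_after P r k k.+1) (row_after P r k P.+1) S2 => a b c d; lia.
Qed.

Lemma row_afterS P r k j : (k < j)%N ->
  row_after P r k.+1 j = row_after P r k j +
    (if j == k.+1 then Num.max (row_after P r k k) 0
     else if j == P.+1 then Num.min (row_after P r k k) 0 else 0).
Proof.
move=> kj /=; have -> : (j == k) = false by lia.
have -> : (0 < k)%N && (j == k.-1) = false by lia.
by rewrite orbF.
Qed.

(** The entry 1 travels with the vertex about to be mutated, from a on, until it cancels the -1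
    waiting at b. *)
Lemma row_after_nowrap P r a b k j : (a < b < P.+2)%N ->
  (forall j, (j < P.+2)%N -> r j = (j == a)%:Z - (j == b)%:Z) ->
  (k <= P)%N -> (k <= j < P.+2)%N ->
  row_after P r k j = if (k <= b)%N then (j == maxn k a)%:Z - (j == b)%:Z else 0.
Proof.
move=> ab rE; elim: k j => [|k IH] j kP /andP[kj jP].
  by rewrite /= rE // max0n.
rewrite row_afterS // !IH; try lia.
have mm := (@maxxx _ int, @minxx _ int, erefl : Num.max 1 0 = 1 :> int,
  erefl : Num.min 1 0 = 0 :> int, erefl : Num.max (-1) 0 = 0 :> int,
  erefl : Num.min (-1) 0 = -1 :> int).
have [ka|ka] : (k < a)%N \/ (a <= k)%N by lia.
  have -> : maxn k a = a by lia. have -> : maxn k.+1 a = a by lia.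
  have -> : (k <= b)%N by lia. have -> : (k < b)%N by lia.
  have -> : (k == a) = false by lia. have -> : (k == b) = false by lia.
  by rewrite subrr; case: ifP => _; [|case: ifP => _]; rewrite ?mm ?addr0.
have -> : maxn k a = k by lia. have -> : maxn k.+1 a = k.+1 by lia.
have -> : (j == k) = false by lia.
rewrite eqxx; have [kb|[kb|kb]] : (k < b)%N \/ (b < k)%N \/ k = b by lia.
- have -> : (k <= b)%N by lia. have -> : (k < b)%N by lia. have -> : (k == b) = false by lia.
  by case: ifP => _; [|case: ifP => _]; rewrite ?subr0 ?mm ?addr0 ?sub0r ?[- _ + _]addrC.
- have -> : (k <= b)%N = false by lia. have -> : (k < b)%N = false by lia.
  by case: ifP => _; [|case: ifP => _]; rewrite ?mm ?subrr ?mm ?addr0.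
- have -> : (k <= b)%N by lia. have -> : (k < b)%N = false by lia. have -> : (k == b) by lia.
  have -> : (j == b) = false by lia.
  by case: ifP => _; [|case: ifP => _]; rewrite ?mm ?subrr ?mm ?addr0.
Qed.

(** The entry -1 at b is reached before the entry 1 at a, and is thrown to v_(P+1) at once; the 1
    travels from a on. *)
Lemma row_after_wrap P r a b k j : (b < a < P.+2)%N ->
  (forall j, (j < P.+2)%N -> r j = (j == a)%:Z - (j == b)%:Z) ->
  (k <= P)%N -> (k <= j < P.+2)%N ->
  row_after P r k j =
    (j == maxn k a)%:Z - (j == (if (k <= b)%N then b else P.+1))%:Z.
Proof.
move=> ab rE; elim: k j => [|k IH] j kP /andP[kj jP].
  by rewrite /= rE // max0n.
rewrite row_afterS // !IH; try lia.
have mm := (@maxxx _ int, @minxx _ int, erefl : Num.max 1 0 = 1 :> int,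
  erefl : Num.min 1 0 = 0 :> int, erefl : Num.max (-1) 0 = 0 :> int,
  erefl : Num.min (-1) 0 = -1 :> int).
have PN : (k.+1 == P.+1) = false by lia.
have [kb|[kb|kb]] : (k < b)%N \/ (b < k)%N \/ k = b by lia.
- have -> : (k <= b)%N by lia. have -> : (k < b)%N by lia.
  have -> : maxn k a = a by lia. have -> : maxn k.+1 a = a by lia.
  have -> : (k == a) = false by lia. have -> : (k == b) = false by lia.
  by rewrite subrr; case: ifP => _; [|case: ifP => _]; rewrite ?mm ?addr0.
- have -> : (k <= b)%N = false by lia. have -> : (k < b)%N = false by lia.
  have -> : (k == (if false then b else P.+1)) = false by lia.
  have [ka|ka] : (k < a)%N \/ (a <= k)%N by lia.
    have -> : maxn k a = a by lia. have -> : maxn k.+1 a = a by lia.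
    have -> : (k == a) = false by lia.
    by rewrite subrr; case: ifP => _; [|case: ifP => _]; rewrite ?mm ?addr0.
  have -> : maxn k a = k by lia. have -> : maxn k.+1 a = k.+1 by lia.
  have -> : (j == k) = false by lia.
  by rewrite eqxx; case: ifP => _; [|case: ifP => _]; rewrite ?subr0 ?mm ?addr0 ?sub0r ?[- _ + _]addrC.
- have -> : (k <= b)%N by lia. have -> : (k < b)%N = false by lia.
  have -> : maxn k a = a by lia. have -> : maxn k.+1 a = a by lia.
  have -> : (k == a) = false by lia.
  have -> : (k == b) by lia.
  have -> : (j == b) = false by lia.
  case: (eqVneq j k.+1) => [->|jk].
    by rewrite PN; exact: addr0.
  by case: (j == P.+1); [rewrite [X in X + _]subr0 | exact: addr0].
Qed.

Lemma prod_window (K : comRingType) (F : nat -> K) a b n : (a <= b <= n)%N ->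
  \prod_(j < n) (if (a <= j < b)%N then F j else 1) = \prod_(k < b - a) F (a + k)%N.
Proof.
case/andP=> ab bn.
have -> : \prod_(k < b - a) F (a + k)%N = \prod_(a <= j < b) F j.
  rewrite -[X in _ = \prod_(X <= _ < _) _]add0n big_addn big_mkord.
  by apply: eq_bigr => k _; rewrite addnC.
rewrite (big_nat_widenl a 0) // (big_nat_widen 0 b n) // big_mkcond big_mkord.
by apply: eq_bigr => j _.
Qed.

(** * The seed produced by R(P) *)

Section CycleRun.
Variables (W : finType) (K : fieldType) (pos : K -> Prop).
Hypothesis pos1 : pos 1.
Hypothesis posD : forall x y, pos x -> pos y -> pos (x + y).
Hypothesis posM : forall x y, pos x -> pos y -> pos (x * y).
Hypothesis posV : forall x, pos x -> pos x^-1.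
Hypothesis pos_neq0 : forall x, pos x -> x != 0.
Variables (P : nat) (v : nat -> W) (e : W -> W -> int).
Hypothesis vinj : forall i j, (i < P.+2)%N -> (j < P.+2)%N -> v i = v j -> i = j.
Hypothesis anti : forall j x, (j < P.+2)%N -> e (v j) x = - e x (v j).
Hypothesis ecyc : forall i j, (i < P.+2)%N -> (j < P.+2)%N -> e (v i) (v j) = cyc_eps P 0 i j.

Definition cverts : seq W := [seq v i | i <- iota 0 P.+2].

Lemma cvertsP x : reflect (exists2 j, (j < P.+2)%N & x = v j) (x \in cverts).
Proof.
apply: (iffP mapP) => [[j]|[j jP ->]]; last by exists j; rewrite // mem_iota.
by rewrite mem_iota => jP ->; exists j.
Qed.

Let veq i j : (i < P.+2)%N -> (j < P.+2)%N -> (v i == v j) = (i == j).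
Proof. by move=> iP jP; apply/eqP/eqP => [/(vinj iP jP)|->]. Qed.

Let voff x j : x \notin cverts -> (j < P.+2)%N -> (x == v j) = false.
Proof. by move=> xv jP; apply: contraNF xv => /eqP ->; apply/cvertsP; exists j. Qed.

Section Forward.
Variables (X : W -> K) (Xc : int -> K).
Hypothesis XcE : forall j, (j < P.+2)%N -> X (v j) = Xc j%:Z.
Hypothesis posXc : forall n, pos (Xc n).
Let s k := runM [seq v i | i <- iota 0 k] (e, X).
Let u j := Xc j%:Z * csum Xc j.

Let sS k : s k.+1 = mutate (v k) (s k).
Proof. by rewrite /s -addn1 iotaD map_cat cats1 runM_rcons. Qed.

Lemma pos_csum k : pos (csum Xc k).
Proof. by elim: k => //= k IH; apply: posD => //; apply: posM. Qed.

Lemma pos_cpi k : pos (cpi Xc k).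
Proof. by apply: (big_ind pos) => // i _. Qed.

Let posu j : pos (u j). Proof. by apply: posM => //; apply: pos_csum. Qed.
Let u0 j : u j != 0. Proof. exact: pos_neq0. Qed.
Let S0 j : csum Xc j != 0. Proof. exact/pos_neq0/pos_csum. Qed.

Lemma fwd_anti k j x : (k <= P)%N -> (j < P.+2)%N -> (s k).1 (v j) x = - (s k).1 x (v j).
Proof.
elim: k j x => [|k IH] j x kP jP; first exact: anti.
have kP' : (k <= P)%N by lia. have kP2 : (k < P.+2)%N by lia.
rewrite sS !mutate_e orbC IH //; case: ifP => // _.
by rewrite opprD [(s k).1 (v j) (v k)]IH // [(s k).1 (v k) x]IH // mut_incrNN mut_incrC
  ![(s k).1 (v k) (v j)]IH // ![(s k).1 (v k) (v j)]IH.
Qed.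

Lemma fwd_cyc k i j : (k <= P)%N -> (i < P.+2)%N -> (j < P.+2)%N ->
  (s k).1 (v i) (v j) = cyc_eps P k i j.
Proof.
elim: k i j => [|k IH] i j kP iP jP; first exact: ecyc.
have kP' : (k <= P)%N by lia. have kP2 : (k < P.+2)%N by lia.
by rewrite sS mutate_e cyc_eps_step // !veq // !IH.
Qed.

Lemma fwd_row k j x : (k <= P)%N -> (j < P.+2)%N -> x \notin cverts ->
  (s k).1 x (v j) = row_after P (fun j => e x (v j)) k j.
Proof.
elim: k j => [//|k IH] j kP jP xv.
have kP' : (k <= P)%N by lia. have kP2 : (k < P.+2)%N by lia.
rewrite sS mutate_e voff // veq // !IH // fwd_cyc // cyc_eps_anti cyc_eps_col //.
have [->|jk] := eqVneq j k; first by rewrite /= eqxx.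
rewrite /= (negPf jk); congr (_ + _).
have [->|jP1] := eqVneq j P.+1.
  have -> : (P.+1 == k.+1) = false by lia.
  have -> : (0 < k)%N && (P.+1 == k.-1) = false by lia.
  by rewrite mut_incrN1.
by case: (j == k.+1); case: (_ && _); rewrite /= ?mut_incr1 ?oppr0 ?mut_incr0.
Qed.

(** A vertex is inverted when mutated and receives one more factor at the next step, as v_(k-1). The
    last vertex changes at every step, since it stays adjacent to the vertex being mutated. *)
Definition cyc_x_after k j : K :=
  if (j.+1 < k)%N then csum Xc j.+2 / u j else if j.+1 == k then (u j)^-1
  else if j == k then u j else if j == P.+1 then Xc P.+1%:Z * cpi Xc k / csum Xc k
  else Xc j%:Z.

Lemma fwd_cyc_x k j : (k <= P)%N -> (j < P.+2)%N -> (s k).2 (v j) = cyc_x_after k j.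
Proof.
elim: k j => [|k IH] j kP jP.
  rewrite /cyc_x_after /=; case: eqP => [->|_]; first by rewrite /u mulr1 XcE.
  by case: eqP => [->|_]; rewrite XcE // /cpi big_ord0 mulr1 divr1.
have kP' : (k <= P)%N by lia. have kP2 : (k < P.+2)%N by lia.
have Xk : (s k).2 (v k) = u k.
  rewrite IH // /cyc_x_after eqxx; have -> : (k.+1 < k)%N = false by lia.
  by have -> : (k.+1 == k) = false by lia.
rewrite sS mutate_x veq // Xk IH // fwd_cyc // cyc_eps_col //.
have Su : 1 + u k = csum Xc k.+1 by [].
have [->|jk] := eqVneq j k.
  by rewrite /cyc_x_after ltnn eqxx.
have [->|jP1] := eqVneq j P.+1.
  rewrite /cyc_x_after; have -> : (P.+2 < k)%N = false by lia.
  have -> : (P.+2 == k) = false by lia. have -> : (P.+2 < k.+1)%N = false by lia.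
  have -> : (P.+2 == k.+1) = false by lia. have -> : (P.+1 == k) = false by lia.
  have -> : (P.+1 == k.+1) = false by lia.
  rewrite eqxx (mfac1 pos1 posD pos_neq0) // Su cpiS /u; field.
  by rewrite S0 -/(csum Xc k.+1) S0.
have [->|jk1] := eqVneq j k.+1.
  rewrite mfacN1 Su /cyc_x_after; have -> : (k.+2 < k)%N = false by lia.
  have -> : (k.+2 == k) = false by lia. have -> : (k.+2 < k.+1)%N = false by lia.
  have -> : (k.+2 == k.+1) = false by lia. have -> : (k.+1 == k) = false by lia.
  have -> : (k.+1 == P.+1) = false by lia.
  by rewrite eqxx.
case: andP => [[k0 /eqP jE]|h].
  rewrite mfacN1 Su /cyc_x_after; have -> : (j.+1 < k)%N = false by lia.
  have -> : j.+1 == k by lia. have -> : (j.+1 < k.+1)%N by lia.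
  have -> : j.+2 = k.+1 by lia.
  by rewrite mulrC.
rewrite mfac0 mulr1 /cyc_x_after; have -> : (j == k) = false by lia.
have -> : (j == k.+1) = false by lia.
have jk' : j.+1 != k by apply/eqP => E; apply: h; split; [lia | apply/eqP; lia].
rewrite (negPf jk') (negPf jP1); have -> : (j.+1 == k.+1) = false by lia.
by have -> : (j.+1 < k.+1)%N = (j.+1 < k)%N by lia.
Qed.

Lemma fwd_off_x k x : (k <= P)%N -> x \notin cverts ->
  (s k).2 x = X x * \prod_(j < k) mfac (row_after P (fun j => e x (v j)) j j) (u j).
Proof.
elim: k => [|k IH] kP xv; first by rewrite big_ord0 mulr1.
have kP' : (k <= P)%N by lia. have kP2 : (k < P.+2)%N by lia.
rewrite sS mutate_x voff // IH // fwd_row // fwd_cyc_x // big_ord_recr /= mulrA.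
rewrite /cyc_x_after eqxx; have -> : (k.+1 < k)%N = false by lia.
by have -> : (k.+1 == k) = false by lia.
Qed.

End Forward.

Lemma runM_matrix ks (X X' : W -> K) : (runM ks (e, X)).1 =2 (runM ks (e, X')).1.
Proof.
have : (e, X).1 =2 (e, X').1 by [].
elim: ks (e, X) (e, X') => //= k ks IH s s' E; apply: IH => x y.
by rewrite !mutate_e !E.
Qed.

Section Main.
Variables (X : W -> K) (Xc : int -> K).
Hypothesis posX : forall x, pos (X x).
Hypothesis XcE : forall j, (j < P.+2)%N -> X (v j) = Xc j%:Z.
Hypothesis posXc : forall n, pos (Xc n).
Hypothesis perXc : forall n, Xc (n + P.+2%:Z) = Xc n.
Hypothesis row0 : forall x, x \notin cverts -> \sum_(0 <= j < P.+2) e x (v j) = 0.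

Let X'c := cyc_refl Xc P.
Let u j := Xc j%:Z * csum Xc j.
Let u' j := X'c j%:Z * csum X'c j.
Let Vc := Xc P.+1%:Z * cpi Xc P / csum Xc P.
Let c x j := row_after P (fun j => e x (v j)) j j.

(** Forward factors, exchange factors, and the inverse of the forward factors for X': the way back
    is the forward run from the answer, reversed. The entries [c x j] are the same in both runs
    because matrix mutation ignores the variables. *)
Definition off_factor x : K :=
  (\prod_(j < P) mfac (c x j) (u j)) * (mfac (c x P) (u P) * mfac (- c x P) Vc) /
  \prod_(j < P) mfac (c x j) (u' j).

Variable X' : W -> K.
Hypothesis X'cyc : forall j, (j < P.+2)%N -> X' (v j) = X'c j%:Z.
Hypothesis X'off : forall x, x \notin cverts -> X' x = X x * off_factor x.

Lemma pos_cyc_sum (q : int -> K) D' P' n : (forall n, pos (q n)) -> pos (cyc_sum q D' P' n).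
Proof.
move=> pq; apply: (big_rec (fun z => pos (1 + z))) => [|i z _ pz]; first by rewrite addr0.
by rewrite addrCA; apply: posD => //; apply: (big_ind pos).
Qed.

Let posX'c n : pos (X'c n).
Proof. by apply: posM; [|apply/posV/posM => //]; apply: pos_cyc_sum. Qed.

Let pos_u j : pos (u j). Proof. by apply: posM => //; apply: pos_csum. Qed.
Let pos_u' j : pos (u' j). Proof. by apply: posM => //; apply: pos_csum. Qed.
Let pos_Vc : pos Vc.
Proof. by apply: posM; [apply: posM => //; apply: pos_cpi | apply: posV; apply: pos_csum]. Qed.
Let pos_prod x (q : nat -> K) : (forall j, pos (q j)) -> pos (\prod_(j < P) mfac (c x j) (q j)).
Proof. by move=> pq; apply: (big_ind pos) => // j _; apply: (pos_mfac pos1 posD posM posV). Qed.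

Lemma pos_off_factor x : pos (off_factor x).
Proof.
apply: posM; last by apply/posV/pos_prod.
by apply: posM; [exact: pos_prod | apply: posM; apply: (pos_mfac pos1 posD posM posV)].
Qed.

Let posX' x : pos (X' x).
Proof.
case: (boolP (x \in cverts)) => [/cvertsP [j jP ->]|xv]; first by rewrite X'cyc.
by rewrite X'off //; apply: posM => //; apply: pos_off_factor.
Qed.

Let X0 n : Xc n != 0. Proof. exact: pos_neq0. Qed.
Let f0 n : cyc_sum Xc 1 P.+2 n != 0. Proof. exact/pos_neq0/pos_cyc_sum. Qed.
Let S0 k : csum Xc k != 0. Proof. by apply/pos_neq0/pos_csum. Qed.

Let M := [seq v i | i <- iota 0 P].
Let s1 := runM M (e, X).
Let a := v P.
Let b := v P.+1.

Let eqvv i j : (i < P.+2)%N -> (j < P.+2)%N -> (v i == v j) = (i == j).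
Proof. by move=> iP jP; apply/eqP/eqP => [/(vinj iP jP)|->]. Qed.

Let s1_cyc i j : (i < P.+2)%N -> (j < P.+2)%N -> s1.1 (v i) (v j) = cyc_eps P P i j.
Proof. exact: fwd_cyc. Qed.

Let s1_a j : (j < P)%N -> s1.1 (v j) a = if j.+1 == P then -1 else 0.
Proof.
move=> jP; rewrite /a s1_cyc //; last lia.
by case: (eqVneq j.+1 P) => E; rewrite /cyc_eps /cyc_arrows; decide_nat.
Qed.

Let s1_b j : (j < P)%N -> s1.1 (v j) b = - s1.1 (v j) a.
Proof.
move=> jP; rewrite s1_a // /b s1_cyc //; last lia.
by case: (eqVneq j.+1 P) => E; rewrite /cyc_eps /cyc_arrows; decide_nat.
Qed.

Let xa_x b' x : x \in cverts -> x != a -> x != b -> (b' = true) ->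
  exists2 j, (j < P)%N & x = v j.
Proof.
move=> /cvertsP[j jP ->]; rewrite /a /b !eqvv // => ja jb _; exists j => //; lia.
Qed.

Let s1_row x : x != a -> x != b -> s1.1 x b = - s1.1 x a.
Proof.
move=> xa xb; case: (boolP (x \in cverts)) => xv.
  by have [j jP ->] := xa_x xv xa xb erefl; apply: s1_b.
rewrite /s1 /a /b !fwd_row // 1?ltnW //.
have := row_after_sum (fun j => e x (v j)) (leqnn P); rewrite row0 //.
rewrite big_nat_recr ?big_nat1 //= => /eqP; rewrite addrC addr_eq0 => /eqP; exact.
Qed.

Let s1_anti j x : (j < P.+2)%N -> s1.1 (v j) x = - s1.1 x (v j).
Proof. by move=> jP; apply: fwd_anti. Qed.

Let s1_col x : x != a -> x != b -> s1.1 b x = - s1.1 a x.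
Proof. by move=> xa xb; rewrite /a /b !s1_anti // -/a -/b s1_row. Qed.

Let ab : a != b.
Proof. by rewrite /a /b eqvv //; lia. Qed.

Let e0 i j : (P <= i < P.+2)%N -> (P <= j < P.+2)%N -> s1.1 (v i) (v j) = 0.
Proof.
move=> iP jP; rewrite s1_cyc; try lia.
rewrite /cyc_eps /cyc_arrows; decide_nat => //.
Qed.

Let s1_xa : s1.2 a = u P.
Proof.
rewrite /s1 /a (fwd_cyc_x XcE) // /cyc_x_after eqxx.
have -> : (P.+1 < P)%N = false by lia.
by have -> : (P.+1 == P) = false by lia.
Qed.

Let s1_xb : s1.2 b = Vc.
Proof.
rewrite /s1 /b (fwd_cyc_x XcE) // /cyc_x_after eqxx.
have -> : (P.+2 < P)%N = false by lia. have -> : (P.+2 == P) = false by lia.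
by have -> : (P.+1 == P) = false by lia.
Qed.

(** Mutations are involutions, so it suffices that M applied to the claimed seed (e, X') equals the
    seed reached after the exchange; the forward formulas describe both sides. *)
Theorem cycle_run : seed_eq (run (Rops cverts) (e, X)) (e, X').
Proof.
have -> : Rops cverts = [seq Mu k | k <- M] ++ [:: Mu a; Mu b; Sw a b] ++ [seq Mu k | k <- rev M].
  have E : cverts = v 0%N :: [seq v i | i <- iota 1 P.+1] by [].
  rewrite {1}E /Rops -E; have -> : size cverts = P.+2 by rewrite size_map size_iota.
  have -> : (P.+2 - 2 = P)%N by lia. have -> : P.+2.-1 = P.+1 by [].
  have -> : take P cverts = M by rewrite /cverts /M -map_take take_iota; congr (map v (iota 0 _)); lia.
  by rewrite /cverts !(nth_map 0%N) ?size_iota // !nth_iota.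
pose s2 := swap_seed a b (mutate b (mutate a s1)).
have -> : run ([seq Mu k | k <- M] ++ [:: Mu a; Mu b; Sw a b] ++ [seq Mu k | k <- rev M]) (e, X) =
    runM (rev M) s2.
  by rewrite /run !foldl_cat -!/(run _ _) !run_Mu.
have eaa : s1.1 a a = 0 by apply: e0; lia.
have ebb : s1.1 b b = 0 by apply: e0; lia.
have eab : s1.1 a b = 0 by apply: e0; lia.
have eba : s1.1 b a = 0 by apply: e0; lia.
have ps' : seed_pos pos (e, X') by [].
apply: seed_eq_trans (runM_rev pos1 posD posM posV pos_neq0 M ps'); apply: runM_eq.
split=> [x y|x].
  rewrite /s2 (exchange_e ab eaa ebb eab eba s1_row s1_col).
  exact: runM_matrix.
rewrite /s2 (exchange_x ab eab eba s1_row) s1_xa s1_xb.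
case: (boolP (x \in cverts)) => xv; last first.
  have xa : (x == a) = false by apply: contraNF xv => /eqP ->; apply/cvertsP; exists P.
  have xb : (x == b) = false by apply: contraNF xv => /eqP ->; apply/cvertsP; exists P.+1.
  rewrite xa xb /s1 (fwd_off_x XcE) // (fwd_off_x X'cyc) // X'off //.
  rewrite /off_factor {1 2}/a !fwd_row //.
  have d0 : \prod_(j < P) mfac (c x j) (u' j) != 0 by apply/pos_neq0/pos_prod.
  by rewrite -[RHS]mulrA divfK // !mulrA.
case: (eqVneq x a) => [->|xa].
  rewrite /a (fwd_cyc_x X'cyc) // /cyc_x_after eqxx.
  have -> : (P.+1 < P)%N = false by lia. have -> : (P.+1 == P) = false by lia.
  by apply/esym; apply: cyc_refl_U.
case: (eqVneq x b) => [->|xb].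
  rewrite /b (fwd_cyc_x X'cyc) // /cyc_x_after eqxx.
  have -> : (P.+2 < P)%N = false by lia. have -> : (P.+2 == P) = false by lia.
  have -> : (P.+1 == P) = false by lia.
  by apply/esym; apply: cyc_refl_V.
have [j jP ->] := xa_x xv xa xb erefl.
have jP2 : (j < P.+2)%N by lia.
rewrite /s1 (fwd_cyc_x XcE) // (fwd_cyc_x X'cyc) // /cyc_x_after -/s1 s1_a //.
have jlt : (j.+1 < P)%N = (j.+1 != P) by lia.
rewrite jlt; case: (eqVneq j.+1 P) => E /=; last first.
  by rewrite oppr0 !mfac0 !mulr1 /X'c cyc_refl_mid.
rewrite mfacN1 opprK (mfac1 pos1 posD pos_neq0) // /X'c (@cyc_refl_last _ Xc P _ _ _ _ j) //.
Qed.

Let q n := cyc_q Xc P n.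
Let contr j (z : int) : K :=
  if z == 1 then q j%:Z else if z == -1 then q P.+1%:Z * \prod_(i < j) q i%:Z else 1.

Let off_factorE x : (forall j, (j <= P)%N -> c x j \in [:: 0; 1; -1]) ->
  off_factor x = \prod_(j < P.+1) contr j (c x j).
Proof.
move=> cx; rewrite big_ord_recr /= /off_factor mulrAC -prodf_div; congr (_ * _).
  apply: eq_bigr => j _; have /cx : (j <= P)%N by rewrite ltnW.
  rewrite /contr !inE => /or3P[] /eqP ->.
  - by rewrite !mfac0 divr1.
  - by rewrite !(mfac1 pos1 posD pos_neq0) //; apply: ratio_plus.
  - by rewrite !mfacN1; apply: ratio_minus.
have := cx P (leqnn P); rewrite /contr !inE => /or3P[] /eqP ->.
- by rewrite oppr0 !mfac0 mulr1.
- by rewrite mfacN1 (mfac1 pos1 posD pos_neq0) //; apply: exchange_plus.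
- by rewrite opprK mfacN1 (mfac1 pos1 posD pos_neq0) //; apply: exchange_minus.
Qed.

Let per_q n : q (n + P.+2%:Z) = q n.
Proof.
have perf m : cyc_sum Xc 1 P.+2 (m + P.+2%:Z) = cyc_sum Xc 1 P.+2 m.
  have pX : periodic 1 P.+2 Xc by move=> k; rewrite muln1.
  by have := cyc_sum_periodic pX m; rewrite muln1.
by rewrite /q /cyc_q addrAC !perf perXc.
Qed.

Lemma off_factor0 x : (forall j, (j < P.+2)%N -> e x (v j) = 0) -> off_factor x = 1.
Proof.
move=> e0x; have c0 k j : (k <= P)%N -> (k <= j < P.+2)%N ->
    row_after P (fun j => e x (v j)) k j = 0.
  elim: k j => [|k IH] j kP /andP[kj jP]; first exact: e0x.
  rewrite row_afterS // !IH; try lia.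
  by rewrite maxxx minxx; case: ifP => _; [|case: ifP => _]; rewrite addr0.
rewrite off_factorE; last by move=> j jP; rewrite /c c0 ?inE ?eqxx //; lia.
apply: big1 => j _; rewrite /contr /c c0 //; have := ltn_ord j; lia.
Qed.

(** Without wrapping, the mutations met with entry 1 are exactly the window from a' to b'. With
    wrapping they give its part up to v_P, and the single entry -1 at b' supplies the rest, by
    [ratio_minus] or [exchange_minus]. *)
Lemma off_factor_pair x a' b' g : (a' < P.+2)%N -> (b' < P.+2)%N -> (0 < g < P.+2)%N ->
  (b' = a' + g \/ b' + P.+2 = a' + g)%N ->
  (forall j, (j < P.+2)%N -> e x (v j) = (j == a')%:Z - (j == b')%:Z) ->
  off_factor x = \prod_(k < g) q (a'%:Z + k%:Z).
Proof.
move=> aP bP gP bg rE.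
have shiftq (k : nat) : q (P.+2 + k)%N%:Z = q k%:Z by rewrite -[RHS]per_q; congr q; lia.
case: bg => bE.
  have abP : (a' < b' < P.+2)%N by lia.
  have cE j : (j <= P)%N -> c x j = ((a' <= j) && (j < b'))%N%:Z.
    move=> jP; rewrite /c (row_after_nowrap abP rE) //; last lia.
    have -> : (j == maxn j a') = (a' <= j)%N by lia.
    by case: (leqP a' j) => h1; case: (ltngtP j b') => h2; rewrite ?subr0 //; lia.
  rewrite off_factorE; last by move=> j jP; rewrite cE // !inE; case: (_ && _).
  rewrite (eq_bigr (fun j : 'I_P.+1 => if (a' <= j < b')%N then q j%:Z else 1)); last first.
    by move=> j _; rewrite cE; [case: (_ && _) | have := ltn_ord j; lia].
  rewrite (prod_window (fun j => q j%:Z)); last lia.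
  by rewrite bE addKn.
have abP : (b' < a' < P.+2)%N by lia.
have cE j : (j <= P)%N -> c x j = (a' <= j)%N%:Z - (j == b')%:Z.
  move=> jP; rewrite /c (row_after_wrap abP rE) //; last lia.
  have -> : (j == maxn j a') = (a' <= j)%N by lia.
  by congr (_ - _); case: ifP => h; [|have -> : (j == P.+1) = false by lia]; lia.
have cc j : (j <= P)%N -> contr j (c x j) =
   (if (a' <= j)%N then q j%:Z else 1) *
   (if j == b' then q P.+1%:Z * \prod_(i < j) q i%:Z else 1).
  move=> jP; rewrite cE //; case: (eqVneq j b') => [->|jb].
    have -> : (a' <= b')%N = false by lia.
    by rewrite mul1r.
  by case: (leqP a' j) => h; rewrite ?mulr1 ?mul1r.
rewrite off_factorE; last first.
  move=> j jP; rewrite cE // !inE; case: (eqVneq j b') => [->|_]; last by case: (_ <= _)%N.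
  by have -> : (a' <= b')%N = false by lia.
rewrite (eq_bigr (fun j : 'I_P.+1 => (if (a' <= j)%N then q j%:Z else 1) *
   (if j == b' :> nat then q P.+1%:Z * \prod_(i < j) q i%:Z else 1))); last first.
  by move=> j _; rewrite cc //; have := ltn_ord j; lia.
rewrite big_split /=.
have bP1 : (b' < P.+1)%N by lia.
rewrite [X in _ * X](bigD1 (Ordinal bP1)) //= eqxx [X in _ * (_ * X)]big1 ?mulr1; last first.
  by move=> j jb; rewrite ifN //; apply: contra jb => /eqP E; apply/eqP/val_inj.
rewrite mulrA.
have -> : (\prod_(i < P.+1) (if (a' <= i)%N then q i%:Z else 1)) * q P.+1%:Z =
    \prod_(k < P.+2 - a') q (a'%:Z + k%:Z).
  have -> : (P.+2 - a' = (P.+1 - a').+1)%N by lia.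
  rewrite [RHS]big_ord_recr /=; congr (_ * _); last by congr q; lia.
  have aPP : (a' <= P.+1 <= P.+1)%N by lia.
  rewrite -[RHS](prod_window (fun j => q j%:Z) aPP).
  by apply: eq_bigr => i _; have -> : (a' <= i < P.+1)%N = (a' <= i)%N by have := ltn_ord i; lia.
have -> : g = (P.+2 - a' + b')%N by lia.
rewrite big_split_ord /=; congr (_ * _); apply: eq_bigr => k _.
by rewrite -shiftq; congr q; lia.
Qed.

End Main.
End CycleRun.

Lemma cyc_arrows0 P k k' : cyc_arrows P 0 k k' =
  if k == P.+1 then nat_of_bool (k' == 0%N) else nat_of_bool ((k < P.+1)%N && (k' == k.+1)).
Proof.
rewrite /cyc_arrows ltn0 !andFb !add0n leq0n andTb.
by case: (eqVneq k P.+1) => [->|_]; rewrite ?ltnn ?addn0.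
Qed.

(** * Running all cycles of one label *)

Section LabelRun.
Variables (l N : nat) (X : dynkin l N).
Variables (K : fieldType) (pos : K -> Prop).
Hypothesis pos1 : pos 1.
Hypothesis posD : forall x y, pos x -> pos y -> pos (x + y).
Hypothesis posM : forall x y, pos x -> pos y -> pos (x * y).
Hypothesis posV : forall x, pos x -> pos x^-1.
Hypothesis pos_neq0 : forall x, pos x -> x != 0.
Local Notation adj := (dk_adj X).
Local Notation D := (dk_D X).
Local Notation s := (dk_s X).
Local Notation g := (dk_g X).
Local Notation om := (ordmod (dk_n0 X)).
Local Notation vert := (V l N).
Implicit Types (i j : 'I_l) (n m : int).

Variable e : vert -> vert -> int.
Hypothesis e_same : forall i n m,
  e (i, om n) (i, om m) = (om m == om (n + (D i)%:Z))%:Z - (om n == om (m + (D i)%:Z))%:Z.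
Hypothesis e_diff : forall i j n m, j != i -> e (j, om m) (i, om n) =
  if adj j i then (om n == om (m + s j i))%:Z -
                  (om n == om (m + s j i + (g j i * D i)%:Z))%:Z else 0.

Lemma om_eq n m : (om n == om m) = (N%:Z %| n - m)%Z.
Proof.
rewrite -eqz_mod_dvd; apply/eqP/eqP => [E|E]; first by rewrite -!(om_val X) E.
by apply/val_inj/eqP; rewrite -eqz_nat /= !om_val E.
Qed.

Section Label.
Variable i : 'I_l.
Local Notation d := (D i).
Local Notation p := (N %/ D i)%N.
Local Notation P := (p - 2)%N.

Definition xq (Y : vert -> K) n : K := Y (i, om n).
Definition xf (Y : vert -> K) : int -> K := cyc_sum (xq Y) d p.
Definition xsame (Y : vert -> K) n : K :=
  xf Y n / (xf Y (n - d%:Z - d%:Z) * xq Y (n - d%:Z)).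
Definition xoff (Y : vert -> K) j n : K :=
  if adj j i then \prod_(k < g j i)
     (xq Y (n + s j i + (k * d)%:Z) * xf Y (n + s j i + (k * d)%:Z - d%:Z) /
      xf Y (n + s j i + (k * d)%:Z)) else 1.

(* The X-variables after the cycles of label i and residue in rs have been run. *)
Definition mut_part (Y : vert -> K) (rs : seq nat) (v : vert) : K :=
  if v.1 == i then if (v.2 %% d)%N \in rs then xsame Y (Posz v.2) else Y v
  else Y v * (if (om (Posz v.2 + s v.1 i) %% d)%N \in rs then xoff Y v.1 (Posz v.2) else 1).

Let d0 : (0 < d)%N.
Proof. by have := dk_PD X i; have := dk_N_gt0 X; case: (D i) => // [] ; rewrite muln0 => /[swap] <-. Qed.

Let pP : p = P.+2.
Proof. by have := dk_P_gt1 X i; lia. Qed.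

Let Nd : N = (p * d)%N. Proof. by rewrite dk_PD. Qed.
Let NdZ : Posz N = p%:Z * d%:Z. Proof. by rewrite -PoszM dk_PD. Qed.

Lemma residue_om n : (om n %% d)%N%:Z = (n %% d%:Z)%Z.
Proof.
by rewrite -modz_nat om_val {2}(divz_eq n N%:Z) {3}NdZ mulrA modzMDl.
Qed.

Definition cvert (r k : nat) : vert := (i, om (r%:Z + (k * d)%:Z)).

Let om_cycle (r : nat) (z z' : int) :
  (om (r%:Z + z * d%:Z) == om (r%:Z + z' * d%:Z)) = (p%:Z %| z - z')%Z.
Proof.
rewrite om_eq; have -> : r%:Z + z * d%:Z - (r%:Z + z' * d%:Z) = (z - z') * d%:Z by ring.
by rewrite NdZ dvdz_mul2r //; lia.
Qed.

Let nat_cycle (k k' : nat) : (k < p)%N -> (k' < p)%N -> (p%:Z %| k%:Z - k'%:Z)%Z = (k == k').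
Proof.
move=> kp k'p; rewrite -eqz_mod_dvd !modz_nat eqz_nat.
by rewrite !modn_small.
Qed.

Lemma cvert_inj r k k' : (k < P.+2)%N -> (k' < P.+2)%N -> cvert r k = cvert r k' -> k = k'.
Proof.
rewrite -pP => kp k'p [] E; apply/eqP; rewrite -nat_cycle // -(om_cycle r); apply/eqP/val_inj.
by rewrite /= -!PoszM E.
Qed.

Lemma residue_off r n k : (r < d)%N -> (n %% d%:Z)%Z != r%:Z -> (om (r%:Z + (k * d)%:Z) == om n) = false.
Proof.
move=> rd nr; apply: contraNF nr => /eqP E; apply/eqP.
have := residue_om n; rewrite -E residue_om PoszM addrC modzMDl => <-.
by rewrite modz_small //; lia.
Qed.

Lemma residue_on (r : nat) n : (n %% d%:Z)%Z = r%:Z -> exists z, n = r%:Z + z * d%:Z.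
Proof. by move=> E; exists (n %/ d%:Z)%Z; rewrite {1}(divz_eq n d%:Z) E addrC. Qed.

Lemma xf_cycle Y (r : nat) z : xf Y (r%:Z + z * d%:Z) = cyc_sum (fun k => xq Y (r%:Z + k * d%:Z)) 1 p z.
Proof.
congr (1 + _); apply: eq_bigr => k _; apply: eq_bigr => k' _; congr xq.
by rewrite muln1 PoszM; ring.
Qed.

Let per_xq Y n : xq Y (n + N%:Z) = xq Y n. Proof. by rewrite /xq om_period. Qed.

Let per_xf Y n : xf Y (n + N%:Z) = xf Y n.
Proof.
have pq : periodic d p (xq Y) by move=> m; rewrite -Nd per_xq.
by have := cyc_sum_periodic pq n; rewrite -Nd.
Qed.

Lemma xsame_om Y n : xsame Y (Posz (om n)) = xsame Y n.
Proof.
apply: (periodic_om X (u := xsame Y)) => m; rewrite /xsame.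
by rewrite ![m + N%:Z - _]addrAC [m - _ + N%:Z - _]addrAC !per_xf per_xq.
Qed.

Lemma xoff_om Y j n : xoff Y j (Posz (om n)) = xoff Y j n.
Proof.
apply: (periodic_om X (u := xoff Y j)) => m; rewrite /xoff; case: ifP => // _.
apply: eq_bigr => k _.
have -> : m + N%:Z + s j i + (k * d)%:Z = m + s j i + (k * d)%:Z + N%:Z by ring.
by rewrite [_ + N%:Z - _]addrAC !per_xf per_xq.
Qed.

Lemma mut_partE Y rs j n : mut_part Y rs (j, om n) =
  if j == i then if (om n %% d)%N \in rs then xsame Y n else Y (j, om n)
  else Y (j, om n) * (if (om (n + s j i) %% d)%N \in rs then xoff Y j n else 1).
Proof.
rewrite /mut_part /= xsame_om xoff_om; case: ifP => // _.
suff -> : om (Posz (om n) + s j i) = om (n + s j i) by [].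
by apply: (periodic_om X (u := fun m => om (m + s j i))) => m; rewrite addrAC om_period.
Qed.

Lemma om_surj (v : vert) : exists n, v = (v.1, om n).
Proof. by exists (Posz v.2); rewrite om_val_id; case: v. Qed.

(** In the coordinate z of n = r + z d the cycle has step 1. A vertex of an adjacent label meets
    only the cycle of residue n + s_ji, with entries 1 and -1 that are g_ji steps apart, so
    [off_factor_pair] gives [xoff]. *)
Lemma cycle_single Y r : (r < d)%N -> (forall v, pos (Y v)) ->
  seed_eq (run (Rops (cverts P (cvert r))) (e, Y)) (e, mut_part Y [:: r]).
Proof.
move=> rd pY.
pose Xc (k : int) := xq Y (r%:Z + k * d%:Z).
have cvE k : cvert r k = (i, om (r%:Z + k%:Z * d%:Z)) by rewrite /cvert PoszM.
have perXc n : Xc (n + P.+2%:Z) = Xc n.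
  by rewrite /Xc -pP mulrDl -NdZ addrA per_xq.
have rmod z : ((r%:Z + z * d%:Z) %% d%:Z)%Z = r%:Z by rewrite addrC modzMDl modz_small //; lia.
have res_eq n : ((om n %% d)%N \in [:: r]) = ((n %% d%:Z)%Z == r%:Z).
  by rewrite inE -eqz_nat residue_om.
have offrow j n : j != i -> adj j i -> ((n + s j i) %% d%:Z)%Z = r%:Z ->
  exists a b, [/\ (a < P.+2)%N, (b < P.+2)%N, (b = a + g j i \/ b + P.+2 = a + g j i)%N,
    forall k, (k < P.+2)%N -> e (j, om n) (cvert r k) = (k == a)%:Z - (k == b)%:Z
    & forall F : int -> K, (forall m, F (m + N%:Z) = F m) ->
        \prod_(k < g j i) F (n + s j i + (k * d)%:Z) =
        \prod_(k < g j i) F (r%:Z + (a%:Z + k%:Z) * d%:Z)].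
  move=> ji aji /residue_on [z zE].
  have p0 : p%:Z != 0 by have := dk_P_gt1 X i; lia.
  have glt : (g j i < p)%N by rewrite -(ltn_pmul2r d0) dk_PD; apply: dk_gD_lt.
  have ppos : 0 < p%:Z by lia.
  have a_ge := modz_ge0 z p0; have a_lt := ltz_pmod z ppos.
  have [a aE] : exists a : nat, a%:Z = (z %% p%:Z)%Z by exists (absz (z %% p%:Z)%Z); lia.
  have ap : (a < p)%N by lia.
  pose b := if (a + g j i < p)%N then (a + g j i)%N else (a + g j i - p)%N.
  have bp : (b < p)%N by rewrite /b; case: ifP; lia.
  have za : exists c, z = a%:Z + c * p%:Z by exists (z %/ p%:Z)%Z; rewrite aE addrC -divz_eq.
  exists a, b; rewrite -pP; split=> //.
  - by rewrite /b; case: ifP; lia.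
  - move=> k kp; rewrite cvE e_diff // aji zE; case: za => c cE.
    have -> : r%:Z + z * d%:Z + (g j i * d)%:Z = r%:Z + (z + (g j i)%:Z) * d%:Z by rewrite PoszM; ring.
    rewrite !om_cycle; congr ((_ : bool)%:Z - (_ : bool)%:Z).
      rewrite -nat_cycle //; have -> : k%:Z - z = k%:Z - a%:Z + (- c) * p%:Z by rewrite cE; ring.
      by rewrite rpredDr // dvdz_mull.
    rewrite -nat_cycle // /b; case: ifP => h.
      have -> : k%:Z - (z + (g j i)%:Z) = k%:Z - (a + g j i)%N%:Z + (- c) * p%:Z.
        by rewrite cE PoszD; ring.
      by rewrite rpredDr // dvdz_mull.
    have -> : k%:Z - (z + (g j i)%:Z) = k%:Z - (a + g j i - p)%N%:Z + (- c - 1) * p%:Z.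
      have -> : (a + g j i - p)%N%:Z = a%:Z + (g j i)%:Z - p%:Z by lia.
      by rewrite cE; ring.
    by rewrite rpredDr // dvdz_mull.
  move=> F perF; apply: eq_bigr => k _; rewrite zE; case: za => c cE.
  have perFc (t : int) m : F (m + t * N%:Z) = F m.
    have perFn (t' : nat) m' : F (m' + t'%:Z * N%:Z) = F m'.
      elim: t' m' => [|t' IH] m'; first by rewrite mul0r addr0.
      by rewrite intS mulrDl mul1r addrA IH perF.
    case: t => t'; first exact: perFn.
    by rewrite -(perFn t'.+1 (m + Negz t' * N%:Z)) NegzE mulNr subrK.
  rewrite -[RHS](perFc c); congr F; rewrite cE NdZ !PoszM; ring.
have cvert_of n : (n %% d%:Z)%Z = r%:Z -> exists2 k, (k < P.+2)%N & (i, om n) = cvert r k.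
  move=> /residue_on [z zE]; have ppos : 0 < p%:Z by lia.
  have p0 : p%:Z != 0 by lia.
  have a_ge := modz_ge0 z p0; have a_lt := ltz_pmod z ppos.
  exists (absz (z %% p%:Z)%Z); first by lia.
  rewrite cvE; congr (i, _); apply/eqP; rewrite zE om_cycle.
  have -> : z - (absz (z %% p%:Z)%Z)%:Z = (z %/ p%:Z)%Z * p%:Z.
    by rewrite gez0_abs // {1}(divz_eq z p%:Z) addrK.
  exact: dvdz_mull.
have off0 j n : j != i -> adj j i = false \/ ((n + s j i) %% d%:Z)%Z != r%:Z ->
    forall k, (k < P.+2)%N -> e (j, om n) (cvert r k) = 0.
  move=> ji h k kp; rewrite /cvert e_diff //; case: h => [->//|h].
  case: ifP => // aji; rewrite !residue_off //.
  by rewrite PoszM addrC modzMDl.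
have e_anti v w : e v w = - e w v.
  have [n ->] := om_surj v; have [m ->] := om_surj w; case: v w => j k [j' k'] /=.
  have [->|jj] := eqVneq j j'; first by rewrite !e_same opprB.
  have jj' : j' != j by rewrite eq_sym.
  rewrite !e_diff // (dk_sym X j); case: ifP => aj; last by rewrite oppr0.
  have E1 : (om m == om (n + s j j' + (g j j' * D j')%:Z)) = (om n == om (m + s j' j)).
    rewrite eq_sym om_eq [RHS]om_eq; congr (_ %| _)%Z.
    by have := dk_s_sum aj; have := dk_gD aj; lia.
  have E2 : (om m == om (n + s j j')) = (om n == om (m + s j' j + (g j' j * D j)%:Z)).
    rewrite eq_sym om_eq [RHS]om_eq; congr (_ %| _)%Z.
    by have := dk_s_sum aj; have := dk_gD aj; lia.
  by rewrite E1 E2 opprB.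
have same0 n : (n %% d%:Z)%Z != r%:Z -> forall k, (k < P.+2)%N -> e (i, om n) (cvert r k) = 0.
  move=> h k kp; rewrite /cvert e_same residue_off //; last by rewrite modzDr.
  rewrite eq_sym; have -> : r%:Z + (k * d)%:Z + d%:Z = r%:Z + (k.+1 * d)%:Z by rewrite mulSn; lia.
  by rewrite residue_off.
have ecyc a b : (a < P.+2)%N -> (b < P.+2)%N -> e (cvert r a) (cvert r b) = cyc_eps P 0 a b.
  rewrite -pP => ap bp; rewrite !cvE e_same.
  have sh (k : nat) : r%:Z + k%:Z * d%:Z + d%:Z = r%:Z + (k%:Z + 1) * d%:Z by ring.
  rewrite !sh !om_cycle /cyc_eps.
  have H (k k' : nat) : (k < p)%N -> (k' < p)%N ->
      (p%:Z %| k'%:Z - (k%:Z + 1))%Z%:Z = (cyc_arrows P 0 k k')%:Z.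
    move=> kp k'p; have [E|E] := eqVneq k P.+1.
      have -> : k'%:Z - (k%:Z + 1) = k'%:Z - 0%N%:Z + (-1) * p%:Z by have := pP; lia.
      rewrite rpredDr ?dvdz_mull // nat_cycle //; last by lia.
      by rewrite cyc_arrows0 E eqxx.
    have -> : k'%:Z - (k%:Z + 1) = k'%:Z - k.+1%:Z by lia.
    rewrite nat_cycle //; last by lia.
    by rewrite cyc_arrows0 (negPf E); have -> : (k < P.+1)%N by lia.
  by rewrite !H.
have row0 x : x \notin cverts P (cvert r) -> \sum_(0 <= k < P.+2) e x (cvert r k) = 0.
  have [n ->] := om_surj x; case: x => j k0 /= xv.
  have [ji|ji] := eqVneq j i.
    rewrite ji in xv *; rewrite big_nat big1 // => k kp; apply: same0 => //.
    by apply: contra xv => /eqP /cvert_of [k' k'P ->]; apply/cvertsP; exists k'.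
  case: (boolP (adj j i && (((n + s j i) %% d%:Z)%Z == r%:Z))) => [/andP[aji /eqP h]|h].
    have [a [b [ap bp _ E _]]] := offrow _ _ ji aji h.
    rewrite big_nat (eq_bigr (fun k => (k == a)%:Z - (k == b)%:Z)); last by move=> k /E.
    rewrite -big_nat sumrB.
    have one c : (c < P.+2)%N -> \sum_(0 <= k < P.+2) (k == c)%:Z = 1.
      move=> cp; rewrite big_mkord (bigD1 (Ordinal cp)) //= eqxx big1 ?addr0 // => k kc.
      by rewrite (_ : (k == c :> nat) = false) //; apply: contraNF kc => /eqP E'; apply/eqP/val_inj.
    by rewrite !one.
  rewrite big_nat big1 // => k kp; apply: off0 => //.
  by case/nandP: h => [/negPf ->|]; [left | right].
have vinjr := @cvert_inj r.
have pXc n : pos (Xc n) by apply: pY.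
have XcE k : (k < P.+2)%N -> Y (cvert r k) = Xc k%:Z by rewrite cvE.
have OF0 x : (forall k, (k < P.+2)%N -> e x (cvert r k) = 0) -> off_factor P (cvert r) e Xc x = 1.
  by move=> h; apply: (@off_factor0 _ _ pos) => //.
have OFP x a b q : (a < P.+2)%N -> (b < P.+2)%N -> (0 < q < P.+2)%N ->
    (b = a + q \/ b + P.+2 = a + q)%N ->
    (forall k, (k < P.+2)%N -> e x (cvert r k) = (k == a)%:Z - (k == b)%:Z) ->
    off_factor P (cvert r) e Xc x = \prod_(k < q) cyc_q Xc P (a%:Z + k%:Z).
  exact: (off_factor_pair pos1 posD posM posV pos_neq0 vinjr pXc perXc).
apply: (@cycle_run _ _ pos _ _ _ _ _ P (cvert r) e _ _ _ Y Xc) => //.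
- move=> k kp; rewrite cvE mut_partE eqxx res_eq rmod eqxx /cyc_refl /xsame.
  have E1 : r%:Z + k%:Z * d%:Z - d%:Z = r%:Z + (k%:Z - 1) * d%:Z by ring.
  have E2 : r%:Z + (k%:Z - 1) * d%:Z - d%:Z = r%:Z + (k%:Z - 1 - 1) * d%:Z by ring.
  by rewrite E1 E2 !xf_cycle -pP.
move=> x; have [n ->] := om_surj x; case: x => j k0 /= xv.
rewrite mut_partE !res_eq; have [ji|ji] := eqVneq j i.
  rewrite ji in xv *; have nr : (n %% d%:Z)%Z != r%:Z.
    by apply: contra xv => /eqP /cvert_of [k' k'P ->]; apply/cvertsP; exists k'.
  by rewrite (negPf nr) OF0 ?mulr1 //; exact: same0.
congr (_ * _); case: ifP => [/eqP h|/negbT h]; last first.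
  by rewrite OF0 //; apply: off0 => //; right.
case aji: (adj j i); last first.
  by rewrite /xoff aji OF0 //; apply: off0 => //; left.
have [a [b [ap bp bg E EF]]] := offrow _ _ ji aji h.
have gP : (0 < g j i < P.+2)%N.
  have := dk_g_range aji; have glt : (g j i < p)%N by rewrite -(ltn_pmul2r d0) dk_PD; apply: dk_gD_lt.
  by move: glt; rewrite -pP; lia.
rewrite (OFP _ a b (g j i)) // /xoff aji.
pose F m := xq Y m * xf Y (m - d%:Z) / xf Y m.
rewrite [LHS](EF F); last by move=> m; rewrite /F [_ + _ - _]addrAC !per_xf per_xq.
apply: eq_bigr => k _; rewrite /F /cyc_q -pP xf_cycle; congr (_ * _ / _).
by rewrite -xf_cycle; congr xf; ring.
Qed.

Lemma xf_ext Y Y' n : (forall z, xq Y (n + z * d%:Z) = xq Y' (n + z * d%:Z)) -> xf Y n = xf Y' n.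
Proof.
move=> H; congr (1 + _); apply: eq_bigr => k _; apply: eq_bigr => k' _.
by have := H (- (k' : nat)%:Z); rewrite PoszM mulNr.
Qed.

Let shiftd Y Y' n c : (forall z, xq Y (n + z * d%:Z) = xq Y' (n + z * d%:Z)) ->
  forall z, xq Y (n + c * d%:Z + z * d%:Z) = xq Y' (n + c * d%:Z + z * d%:Z).
Proof. by move=> H z; rewrite -addrA -mulrDl. Qed.

Lemma xsame_ext Y Y' n : (forall z, xq Y (n + z * d%:Z) = xq Y' (n + z * d%:Z)) ->
  xsame Y n = xsame Y' n.
Proof.
move=> H; rewrite /xsame (xf_ext H).
have -> : n - d%:Z - d%:Z = n + (-2) * d%:Z by ring.
have -> : n - d%:Z = n + (-1) * d%:Z by ring.
by rewrite (xf_ext (shiftd (-2) H)) H.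
Qed.

Lemma xoff_ext Y Y' j n :
  (forall z, xq Y (n + s j i + z * d%:Z) = xq Y' (n + s j i + z * d%:Z)) ->
  xoff Y j n = xoff Y' j n.
Proof.
move=> H; rewrite /xoff; case: ifP => // _; apply: eq_bigr => k _.
rewrite PoszM; have -> : n + s j i + (k : nat)%:Z * d%:Z - d%:Z = n + s j i + (k%:Z - 1) * d%:Z.
  by ring.
by rewrite H (xf_ext (shiftd (k : nat)%:Z H)) (xf_ext (shiftd (k%:Z - 1) H)).
Qed.

Lemma pos_mut_part Y rs : (forall v, pos (Y v)) -> forall v, pos (mut_part Y rs v).
Proof.
move=> pY v; have pf n : pos (xf Y n) by apply: pos_cyc_sum => // m; apply: pY.
rewrite /mut_part; case: ifP => _; first case: ifP => // _.
  by apply: (posM) => //; apply/posV/posM => //; apply: pY.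
apply: (posM) => //; case: ifP => // _; rewrite /xoff; case: ifP => // _.
by apply: (big_ind pos) => // k _; apply: (posM); [apply: (posM) => //; apply: pY | exact: posV].
Qed.

Lemma run_eq (ops : seq (mop vert)) (s1 s2 : seed vert K) :
  seed_eq s1 s2 -> seed_eq (run ops s1) (run ops s2).
Proof.
elim: ops s1 s2 => //= o ops IH s1 s2 h; apply: IH.
case: o => [k|a b]; first exact: mutate_eq.
by case: h => h1 h2; split=> [x y|x]; rewrite ?swap_e ?swap_x ?h1 ?h2.
Qed.

(** Cycles of one label with different residues are not linked, and each formula reads the variables
    of a single residue, so the runs do not interfere. *)
Lemma cycles_all Y rs : uniq rs -> all (fun r => r < d)%N rs -> (forall v, pos (Y v)) ->
  seed_eq (run (flatten [seq Rops (cverts P (cvert r)) | r <- rs]) (e, Y)) (e, mut_part Y rs).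
Proof.
elim: rs Y => [|r rs IH] Y.
  by move=> _ _ _; split=> // v; rewrite /= /mut_part !in_nil mulr1; case: ifP.
rewrite [uniq _]/= [all _ _]/= => /andP[rrs urs] /andP[rd ard] pY.
rewrite [flatten _]/= /run foldl_cat.
apply: seed_eq_trans (run_eq _ (cycle_single rd pY)) _.
have pY1 := pos_mut_part [:: r] pY; move: (pY1); set Y1 := mut_part Y [:: r] => _.
apply: seed_eq_trans (IH _ urs ard pY1) _; split=> // v /=.
have agree m : (om m %% d)%N \in rs -> forall z, xq Y1 (m + z * d%:Z) = xq Y (m + z * d%:Z).
  move=> mrs z; rewrite /xq /Y1 mut_partE eqxx inE ifF //; apply: contraNF rrs => /eqP <-.
  suff -> : (om (m + z * d%:Z) %% d = om m %% d)%N by [].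
  by apply/eqP; rewrite -eqz_nat !residue_om addrC modzMDl.
have [n ->] := om_surj v; case: v => j k0 /=.
rewrite mut_partE [RHS]mut_partE; have [ji|ji] := eqVneq j i.
  case: (boolP (_ \in rs)) => [h|h].
    by rewrite (xsame_ext (agree _ h)) in_cons h orbT.
  by rewrite /Y1 mut_partE ji eqxx !in_cons (negPf h).
rewrite -/Y1; case: (boolP (_ \in rs)) => [h|h].
  rewrite (xoff_ext (agree _ h)) in_cons h orbT /Y1 mut_partE (negPf ji) ifF ?mulr1 //.
  by rewrite inE; apply: contraNF rrs => /eqP <-.
by rewrite mulr1 /Y1 mut_partE (negPf ji) !in_cons (negPf h).
Qed.

Definition mut_img (Y : vert -> K) (v : vert) : K :=
  if v.1 == i then xsame Y (Posz v.2) else Y v * xoff Y v.1 (Posz v.2).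

Lemma cycles_full Y rs : perm_eq rs (iota 0 d) -> (forall v, pos (Y v)) ->
  seed_eq (run (flatten [seq Rops (cverts P (cvert r)) | r <- rs]) (e, Y)) (e, mut_img Y).
Proof.
move=> prs pY; have mrs r : (r \in rs) = (r < d)%N by rewrite (perm_mem prs) mem_iota add0n.
apply: seed_eq_trans (cycles_all _ _ pY) _.
- by rewrite (perm_uniq prs) iota_uniq.
- by apply/allP => r; rewrite mrs.
by split=> // v; rewrite /= /mut_part /mut_img !mrs !ltn_pmod.
Qed.

End Label.
End LabelRun.

(** * The quivers of the individual types *)

Lemma big_iota1 (R : Type) (idx : R) (op : R -> R -> R) l (Q : pred nat) (F : nat -> R) :
  \big[op/idx]_(i <- iota 1 l | Q i) F i = \big[op/idx]_(i < l | Q i.+1) F i.+1.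
Proof.
by rewrite (iotaDl 1 0 l) big_map -{1}[l]subn0 -/(index_iota 0 l) big_mkord.
Qed.

Lemma chain_adj_sym s i j : chain_adj s i j = chain_adj s j i.
Proof. by apply: eq_has => k; rewrite orbC. Qed.

Lemma chain_adj_irr s i : uniq s -> chain_adj s i i = false.
Proof.
move=> us; apply/negbTE/hasPn => k; rewrite mem_iota add0n leq0n /= orbb => ks.
apply/negP => /andP[/eqP E1 /eqP E2].
have k1 : (k.+1 < size s)%N by rewrite -ltn_predRL.
by have := nth_uniq 0 (ltnW k1) k1 us; rewrite E1 E2 eqxx eqn_leq ltnn andbF.
Qed.

Lemma chain_adj_iota l i j : (0 < i <= l)%N -> (0 < j <= l)%N ->
  chain_adj (iota 1 l) i j = (j.+1 == i) || (j == i.+1).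
Proof.
move=> hi hj; apply/hasP/orP => [[k]|].
  rewrite mem_iota size_iota add0n leq0n /= => kl.
  by rewrite !nth_iota ?add1n; [lia|lia|lia].
case=> /eqP E; [exists j.-1 | exists i.-1]; rewrite ?mem_iota ?size_iota; try lia.
  by rewrite !nth_iota ?add1n; [lia|lia|lia].
by rewrite !nth_iota ?add1n; [lia|lia|lia].
Qed.

Definition is_chain (t : ltype) : bool := match t with TD | TE => false | _ => true end.

Lemma adj_chain t l i j : is_chain t -> (0 < i <= l)%N -> (0 < j <= l)%N ->
  adj t l i j = (j.+1 == i) || (j == i.+1).
Proof. by case: t => // _; apply: chain_adj_iota. Qed.

Lemma adj_sym t l i j : adj t l i j = adj t l j i.
Proof.
case: t => /=; rewrite chain_adj_sym //.
all: by rewrite orbAC.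
Qed.

Lemma adj_irr t l i : valid_type t l -> adj t l i i = false.
Proof.
case: t => /= h; rewrite chain_adj_irr ?iota_uniq //=; try lia.
by case/or3P: h => /eqP ->.
Qed.

(* v^i_n -> v^j_(n + x_i) and v^j_(n + y_i) -> v^i_n for j < i adjacent to i. *)
Definition xlow (t : ltype) (l i : nat) : int :=
  match t with TB => if i == l then -1 else 0 | TF => if i == 3%N then -1 else 0 | _ => 0 end.

Definition yup (t : ltype) (l i : nat) : int :=
  match t with
  | TA | TD | TE => 1
  | TB => if i == l then 1 else 2
  | TC => if i == l then 2 else 1
  | TF => if i == 2%N then 2 else 1
  | TG => 3
  end.

(** One format for all types. In a chain the only adjacent label below i is i - 1, so the list then
    contributes at most one pair of arrows. *)
Definition unif_rules t l i n : seq (rawv * rawv) :=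
  ((i, n), (i, n + (dsc t l i)%:Z)) ::
  flatten [seq [:: ((i, n), (j, n + xlow t l i)); ((j, n + yup t l i), (i, n))]
          | j <- iota 1 l & adj t l i j && (j < i)%N].

Lemma lower_chain t l i : is_chain t -> (0 < i <= l)%N ->
  [seq j <- iota 1 l | adj t l i j && (j < i)%N] = if (1 < i)%N then [:: i.-1] else [::].
Proof.
move=> ct hi.
rewrite (eq_in_filter (a2 := pred1 i.-1)); last first.
  by move=> j; rewrite mem_iota => hj; rewrite adj_chain //=; lia.
case: ifP => h; first by rewrite filter_pred1_uniq ?iota_uniq // mem_iota; lia.
rewrite (eq_in_filter (a2 := pred0)) ?filter_pred0 // => j.
by rewrite mem_iota /=; lia.
Qed.

Lemma rules_unif t l i n : valid_type t l -> (0 < i <= l)%N -> rules t l i n = unif_rules t l i n.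
Proof.
move=> vt hi; rewrite /unif_rules.
have ADE : forall t', xlow t' l i = 0 -> yup t' l i = 1 -> dsc t' l i = 1%N ->
  ((i, n), (i, n + 1)) :: flatten [seq [:: ((i, n), (j, n)); ((j, n + 1), (i, n))]
              | j <- iota 1 l & adj t' l i j && (j < i)%N] = unif_rules t' l i n.
  move=> t' E1 E2 E3; rewrite /unif_rules E1 E2 E3; congr (_ :: flatten _).
  by apply: eq_map => j; rewrite addr0.
case: t vt => vt; try exact: ADE; rewrite lower_chain //=; move: vt => /= vt.
- have [->|il] := eqVneq i l.
    have -> : (l <= l.-1)%N = false by lia.
    have -> : (1 < l)%N by lia.
    by rewrite andbF.
  have -> : (i <= l.-1)%N by lia.
  by rewrite andbT; case: ifP => _; rewrite ?addr0.
- have [->|il] := eqVneq i l.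
    have -> : (l <= l.-1)%N = false by lia.
    have -> : (1 < l)%N by lia.
    by rewrite andbF /= addr0.
  have -> : (i <= l.-1)%N by lia.
  by rewrite andbT; case: ifP => _; rewrite ?addr0.
- move: hi; rewrite (eqP vt); case: i {ADE} => [|[|[|[|[|i]]]]] // _; rewrite ?addr0 //.
- by move: hi; rewrite (eqP vt); case: i {ADE} => [|[|[|i]]] // _; rewrite ?addr0.
Qed.

(** The four kinds of edges: simple, the double bond of B and F4, the double bond of C, the triple
    bond of G2. *)
Lemma edge_types t l i j : valid_type t l -> (0 < j < i)%N -> (i <= l)%N -> adj t l i j ->
  [\/ [/\ xlow t l i = 0, yup t l i = (dsc t l i)%:Z, dsc t l j = dsc t l i & bond t l i j = 1%N],
      [/\ xlow t l i = -1, yup t l i = 1, dsc t l i = 1%N /\ dsc t l j = 2%N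
        & bond t l i j = 2%N /\ dpr t = 2%N],
      [/\ xlow t l i = 0, yup t l i = 2, dsc t l i = 2%N /\ dsc t l j = 1%N
        & bond t l i j = 2%N /\ dpr t = 2%N]
    | [/\ xlow t l i = 0, yup t l i = 3, dsc t l i = 3%N /\ dsc t l j = 1%N
        & bond t l i j = 3%N /\ t = TG] ].
Proof.
move=> vt ji il aij; rewrite /bond aij /=.
have hi : (0 < i <= l)%N by lia. have hj : (0 < j <= l)%N by lia.
have ac : is_chain t -> (j.+1 == i) || (j == i.+1) by move=> ct; rewrite -(adj_chain ct hi hj).
case: t vt aij ac => vt aij ac.
- by constructor 1.
- have ji1 : i = j.+1 by have := ac isT; lia.
  have jl : (j == l) = false by lia.
  have jl1 : (j == l.-1) = (i == l) by lia.
  rewrite /xlow /yup /dsc jl jl1 andbF andbb /=.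
  by have [_|_] := eqVneq i l; [constructor 2 | constructor 1].
- have ji1 : i = j.+1 by have := ac isT; lia.
  have jl : (j == l) = false by lia.
  have jl1 : (j == l.-1) = (i == l) by lia.
  rewrite /xlow /yup /dsc jl jl1 andbF andbb /=.
  by have [_|_] := eqVneq i l; [constructor 3 | constructor 1].
- by constructor 1.
- by constructor 1.
- have ac' := ac isT; move: vt hi hj ac' ji il => /= /eqP -> {aij ac}.
  case: i => [|[|[|[|[|i]]]]] //; case: j => [|[|[|[|[|j]]]]] // _ _ _ _ _; rewrite /=.
  + by constructor 1.
  + by constructor 2.
  + by constructor 1.
- have ac' := ac isT; move: vt hi hj ac' ji il => /= /eqP -> {aij ac}.
  case: i => [|[|[|i]]] //; case: j => [|[|[|j]]] // _ _ _ _ _; rewrite /=.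
  by constructor 4.
Qed.

Lemma dsc_dvd t l i : (dsc t l i %| dpr t)%N.
Proof. by case: t => //=; case: ifP. Qed.

Lemma sum_pick (l N : nat) (u : V l N) (G : 'I_l -> 'I_N -> nat) :
  (\sum_(i < l) \sum_(n < N) ((i, n) == u) * G i n = G u.1 u.2)%N.
Proof.
rewrite pair_big (bigD1 u) //= -surjective_pairing eqxx mul1n big1 ?addn0 // => -[i n] /= h.
by rewrite (negPf h).
Qed.

Lemma sum_pick1 (l N : nat) (u : V l N) (Q : pred 'I_l) (c : 'I_N) :
  (\sum_(j < l | Q j) ((j, c) == u) = Q u.1 && (c == u.2))%N.
Proof.
rewrite big_mkcond (bigD1 u.1) //= big1 ?addn0 => [|j ju].
  by rewrite -pair_eqE /= eqxx; case: (Q u.1).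
by rewrite -pair_eqE /= (negPf ju); case: (Q j).
Qed.

(** [Fy] with the variables and the two membership tests abstracted, so that the comparison type by
    type never unfolds the quiver. *)
Definition Fgen t l (K : fieldType) (Y : nat -> int -> K) (out inn : pred nat) (i : nat) (n : int) : K :=
  let Fd := (\prod_(j <- iota 1 l | out j) Y j (n + (dsc t l j)%:Z)) *
            (\prod_(j <- iota 1 l | inn j) Y j n) in
  match t with
  | TB => if i == l then Y i.-1 (n + 1) * Y i.+1 n
          else if i == l.-1 then Y i.-1 (n + 2) * Y i.+1 n * Y i.+1 (n + 1)
          else Fd
  | TF => if i == 3%N then Y i.-1 (n + 1) * Y i.+1 n
          else if i == 2%N then Y i.-1 (n + 2) * Y i.+1 n * Y i.+1 (n + 1)
          else Fd
  | TC => if i == l then Y l.-1 (n + 1) * Y l.-1 (n + 2) else Fd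
  | TG => if i == 2%N then Y 1 (n + 1) * Y 1 (n + 2) * Y 1 (n + 3)
          else Fd
  | _ => Fd
  end.

Lemma prod_pick l (K : fieldType) (H : nat -> K) c :
  \prod_(j < l | (j : nat) == c) H j = if (c < l)%N then H c else 1.
Proof.
case: ltnP => h; first by rewrite (big_pred1 (Ordinal h)).
by rewrite big_pred0 // => j; have := ltn_ord j; lia.
Qed.

Lemma chain_prod t l (K : fieldType) (H : nat -> K) (i : 'I_l) : is_chain t ->
  \prod_(j < l | adj t l i.+1 j.+1) H j =
  (if (0 < i)%N then H i.-1 else 1) * (if (i.+1 < l)%N then H i.+1 else 1).
Proof.
move=> ct; rewrite -(prod_pick l H i.+1).
have -> : (if (0 < i)%N then H i.-1 else 1) = \prod_(j < l | (j.+1 == i)%N) H j.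
  case: posnP => [i0|i0]; first by rewrite big_pred0 // => j; lia.
  have := prod_pick l H i.-1; rewrite ifT; last by have := ltn_ord i; lia.
  by move=> <-; apply: eq_bigl => j; lia.
rewrite [in LHS]big_mkcond [in RHS]big_mkcond [X in _ * X]big_mkcond -big_split /=.
apply: eq_bigr => j _; rewrite adj_chain //; last 2 first.
- by have := ltn_ord i; lia.
- by have := ltn_ord j; lia.
rewrite eqSS; case: (eqVneq j.+1 (i : nat)) => [E|_] /=; last by rewrite mul1r.
by rewrite ifF ?mulr1 //; lia.
Qed.

Section Instance.
Variables (t : ltype) (l m : nat).
Hypothesis vt : valid_type t l.
Hypothesis m_gt1 : (1 < m)%N.
Local Notation N := (Nsz t m).
Implicit Types (i j : 'I_l) (a b : 'I_N) (n : int).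

Lemma Nsz_gt0 : (0 < N)%N.
Proof. by rewrite /Nsz muln_gt0; case: t => /=; lia. Qed.

Local Notation D i := (dsc t l (i : 'I_l).+1).
Local Notation om := (ordmod (Ordinal Nsz_gt0)).

Lemma ordmodE a n : ordmod a n = om n.
Proof.
apply: val_inj; rewrite /= /ordmod !val_insubd ifT ?[in RHS]ifT //.
all: have N0 := Nsz_gt0; have N0' : (N%:Z != 0) by lia.
all: by have H1 := modz_ge0 n N0'; have H2 := @ltz_mod n N%:Z N0'; lia.
Qed.

Lemma vtxE (v0 : V l N) i n : vtx v0 i.+1 n = (i, om n).
Proof. by rewrite /vtx /= ordmodE valKd. Qed.

Definition shift_dk (i j : nat) : int := if (j < i)%N then xlow t l i.+1 else - yup t l j.+1.

(** The offsets of the two arrows between the labels differ by y - x; this is that distance in steps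
    of D_j, hence the number of y_j in F_i. *)
Definition mult_dk (i j : nat) : nat :=
  (`|yup t l (maxn i j).+1 - xlow t l (maxn i j).+1| %/ dsc t l j.+1)%N.

Lemma dsc_gt0 i : (0 < D i)%N.
Proof. by case: t => //=; case: ifP. Qed.

Lemma edge_dk i j : adj t l i.+1 j.+1 -> (j < i)%N ->
  [\/ [/\ xlow t l i.+1 = 0, yup t l i.+1 = (D i)%:Z, D j = D i
        & [/\ mult_dk i j = 1%N, mult_dk j i = 1%N & bond t l i.+1 j.+1 = 1%N]],
      [/\ xlow t l i.+1 = -1, yup t l i.+1 = 1, D i = 1%N /\ D j = 2%N
        & [/\ mult_dk i j = 1%N, mult_dk j i = 2%N & bond t l i.+1 j.+1 = 2%N /\ dpr t = 2%N]],
      [/\ xlow t l i.+1 = 0, yup t l i.+1 = 2, D i = 2%N /\ D j = 1%N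
        & [/\ mult_dk i j = 2%N, mult_dk j i = 1%N & bond t l i.+1 j.+1 = 2%N /\ dpr t = 2%N]]
    | [/\ xlow t l i.+1 = 0, yup t l i.+1 = 3, D i = 3%N /\ D j = 1%N
        & [/\ mult_dk i j = 3%N, mult_dk j i = 1%N & bond t l i.+1 j.+1 = 3%N /\ t = TG]] ].
Proof.
move=> aij ji; have D0 := dsc_gt0 i.
have mx : maxn i j = i by apply/maxn_idPl; exact: ltnW.
have mx' : maxn j i = i by rewrite maxnC.
have := @edge_types t l i.+1 j.+1 vt _ (ltn_ord i) aij; rewrite /mult_dk mx mx' => /(_ ji).
case=> -[-> -> h1 h2].
- by constructor 1; rewrite h1 h2 subr0 /= divnn D0.
- by constructor 2; case: h1 h2 => -> -> [-> ->].
- by constructor 3; case: h1 h2 => -> -> [-> ->].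
- by constructor 4; case: h1 h2 => -> -> [-> ->].
Qed.

Lemma edge_sym i j (Q : 'I_l -> 'I_l -> Prop) :
  (forall i j, adj t l i.+1 j.+1 -> (j < i)%N -> Q i j /\ Q j i) -> adj t l i.+1 j.+1 -> Q i j.
Proof.
move=> H aij; case: (ltngtP j i) => [ji|ij|E].
- by case: (H _ _ aij ji).
- by rewrite adj_sym in aij; case: (H _ _ aij ij).
- by move: aij; rewrite E adj_irr.
Qed.

Lemma shift_lt i j : (j < i)%N -> shift_dk i j = xlow t l i.+1.
Proof. by rewrite /shift_dk => ->. Qed.

Lemma shift_gt i j : (j < i)%N -> shift_dk j i = - yup t l i.+1.
Proof. by rewrite /shift_dk => ji; rewrite ltnNge (ltnW ji). Qed.

Fact dyn_sym : ssrbool.symmetric (fun i j => adj t l i.+1 j.+1).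
Proof. by move=> i j; rewrite adj_sym. Qed.
Fact dyn_irr i : adj t l i.+1 i.+1 = false.
Proof. exact: adj_irr. Qed.
Fact dyn_dvd i : (D i %| N)%N.
Proof. exact: dvdn_mulr (dsc_dvd _ _ _). Qed.
Fact dyn_P_gt1 i : (1 < N %/ D i)%N.
Proof.
have /dvdnP[k E] := dsc_dvd t l i.+1; rewrite /Nsz E mulnAC mulnK ?dsc_gt0 //.
have k0 : (0 < k)%N by case: k E => //; case: (t).
by case: k k0 {E} => // k _; rewrite mulSn; lia.
Qed.
Fact dyn_s_sum i j : adj t l i.+1 j.+1 -> shift_dk i j + shift_dk j i = - (mult_dk i j * D j)%:Z.
Proof.
apply: (edge_sym (Q := fun i j => shift_dk i j + shift_dk j i = - (mult_dk i j * D j)%:Z)).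
move=> {}i {}j aij ji; rewrite (shift_lt ji) (shift_gt ji).
by case: (edge_dk aij ji) => -[-> -> h [-> -> _]]; rewrite ?h; split => //; lia.
Qed.
Fact dyn_gD i j : adj t l i.+1 j.+1 -> (mult_dk i j * D j = mult_dk j i * D i)%N.
Proof.
apply: (edge_sym (Q := fun i j => mult_dk i j * D j = mult_dk j i * D i)%N).
move=> {}i {}j aij ji.
by case: (edge_dk aij ji) => -[_ _ h [-> -> _]]; rewrite ?h; split => //; lia.
Qed.
Fact dyn_range i j : adj t l i.+1 j.+1 -> (0 < mult_dk i j <= 3)%N.
Proof.
apply: (edge_sym (Q := fun i j => 0 < mult_dk i j <= 3)%N) => {}i {}j aij ji.
by case: (edge_dk aij ji) => -[_ _ _ [-> -> _]].
Qed.
Fact dyn_gD_lt i j : adj t l i.+1 j.+1 -> (mult_dk i j * D j < N)%N.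
Proof.
apply: (edge_sym (Q := fun i j => mult_dk i j * D j < N)%N) => {}i {}j aij ji.
case: (edge_dk aij ji) => -[_ _ h [-> -> h']].
- rewrite h mul1n; have := dyn_P_gt1 i; have := divnK (dyn_dvd i); have := dsc_gt0 i; nia.
- by rewrite /Nsz; case: h h' => -> -> [_ ->]; split; lia.
- by rewrite /Nsz; case: h h' => -> -> [_ ->]; split; lia.
- by rewrite /Nsz; case: h h' => -> -> [_ ->]; split; rewrite /=; lia.
Qed.
Fact dyn_g1 i j : adj t l i.+1 j.+1 -> (mult_dk i j == 1%N) || (mult_dk j i == 1%N).
Proof.
apply: (edge_sym (Q := fun i j => (mult_dk i j == 1%N) || (mult_dk j i == 1%N))) => {}i {}j aij ji.
by case: (edge_dk aij ji) => -[_ _ _ [-> -> _]].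
Qed.
Fact dyn_g3 i j : adj t l i.+1 j.+1 -> mult_dk i j = 3%N ->
  forall k : 'I_l, (adj t l i.+1 k.+1 -> k = j) /\ (adj t l j.+1 k.+1 -> k = i).
Proof.
move=> aij g3 k.
have l2 : l = 2%N.
  move: g3; apply: (edge_sym (Q := fun i j => mult_dk i j = 3%N -> l = 2%N)) aij => {}i {}j aij ji.
  by case: (edge_dk aij ji) => -[_ _ _ [-> -> h]] //; split=> // _; case: h => _ E; move: vt; rewrite E => /eqP.
have two (a b c : 'I_l) : a != b -> a != c -> b = c.
  move=> ab ac; apply/val_inj/eqP => /=; move: ab ac; rewrite -!val_eqE /=.
  by have := ltn_ord a; have := ltn_ord b; have := ltn_ord c; lia.
have ne (a b : 'I_l) : adj t l a.+1 b.+1 -> a != b.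
  by apply: contraTneq => ->; rewrite adj_irr.
split=> h; [apply: (two i); apply: ne | apply: (two j); apply: ne] => //.
by rewrite adj_sym.
Qed.

Definition dyn : dynkin l N := @Dynkin l N (Ordinal Nsz_gt0) (fun i j => adj t l i.+1 j.+1)
  (fun i => D i) (fun i j => shift_dk i j) (fun i j => mult_dk i j)
  dyn_sym dyn_irr dyn_dvd dyn_P_gt1 dyn_s_sum dyn_gD dyn_range dyn_gD_lt dyn_g1 dyn_g3.

Definition narrows (u v : V l N) : nat :=
  (((u.1 == v.1) && (om (Posz u.2 + (D u.1)%:Z) == v.2))
   + (adj t l u.1.+1 v.1.+1 && (v.1 < u.1)%N && (om (Posz u.2 + xlow t l u.1.+1) == v.2))
   + (adj t l v.1.+1 u.1.+1 && (u.1 < v.1)%N && (om (Posz v.2 + yup t l v.1.+1) == u.2)))%N.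

Lemma om_dyn_id a : om (Posz a) = a.
Proof. exact: (om_val_id dyn). Qed.

Lemma count_arrows (v0 u v : V l N) : count (pred1 (u, v)) (arrows t v0) = narrows u v.
Proof.
set f := fun a : rawv * rawv => (vtx v0 a.1.1 a.1.2, vtx v0 a.2.1 a.2.2).
pose S w (i : 'I_l) c : nat := (\sum_(j < l | adj t l i.+1 j.+1 && (j < i)) ((j, c) == w :> V l N))%N.
have E i (n : 'I_N) : count (preim f (pred1 (u, v))) (rules t l i.+1 (Posz n)) =
    (((i, n) == u) * (((i, om (Posz n + (D i)%:Z)) == v) + S v i (om (Posz n + xlow t l i.+1)))
     + ((i, n) == v) * S u i (om (Posz n + yup t l i.+1)))%N.
  rewrite rules_unif ?ltn_ord // /unif_rules /= count_flatten -!map_comp sumnE big_map.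
  rewrite big_filter big_iota1 /f /= !vtxE om_dyn_id xpair_eqE -mulnb mulnDr -!addnA; congr (_ + _)%N.
  rewrite /S !big_distrr /= -big_split /=; apply: eq_bigr => j _.
  by rewrite /= !vtxE !xpair_eqE addn0 -!mulnb; congr (_ + _)%N; rewrite mulnC.
transitivity (\sum_(i < l) \sum_(n < N) (((i, n) == u) *
      (((i, om (Posz n + (D i)%:Z)) == v) + S v i (om (Posz n + xlow t l i.+1))))
    + \sum_(i < l) \sum_(n < N) ((i, n) == v) * S u i (om (Posz n + yup t l i.+1)))%N.
  rewrite /arrows /raw_arrows count_map count_flatten -map_comp sumnE big_map big_iota1.
  rewrite -big_split /=; apply: eq_bigr => i _.
  rewrite /= count_flatten -map_comp sumnE big_map -{1}[N]subn0 -/(index_iota 0 N) big_mkord.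
  by rewrite -big_split /=; apply: eq_bigr => n _; rewrite /= E.
rewrite !sum_pick /S !sum_pick1 /narrows; congr (_ + _ + _)%N.
Qed.

Lemma eps_same i n n' : eps t (i, om n) (i, om n') =
  (om n' == om (n + (D i)%:Z))%:Z - (om n == om (n' + (D i)%:Z))%:Z.
Proof.
rewrite /eps !count_arrows /narrows /= !eqxx ltnn !andbF !addn0 /=.
have omD k c : om (Posz (om k) + c) = om (k + c).
  by apply: (periodic_om dyn (u := fun k => om (k + c))) => k'; rewrite addrAC (om_period dyn).
by rewrite !omD eq_sym [X in _ - (X : bool)%:Z]eq_sym.
Qed.

Lemma om_flip k k' c : (om (k + c) == om k') = (om k == om (k' - c)).
Proof.
have omE (x y : int) : (om x == om y) = (N%:Z %| x - y)%Z := om_eq dyn x y.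
by rewrite !omE opprB addrA addrAC.
Qed.

Lemma eps_diff i j n n' : j != i -> eps t (j, om n') (i, om n) =
  if adj t l j.+1 i.+1 then (om n == om (n' + shift_dk j i))%:Z -
     (om n == om (n' + shift_dk j i + (mult_dk j i * D i)%:Z))%:Z else 0.
Proof.
move=> ji; rewrite /eps !count_arrows /narrows /= (negPf ji) [i == j]eq_sym (negPf ji) /= !add0n.
have omD k c : om (Posz (om k) + c) = om (k + c).
  by apply: (periodic_om dyn (u := fun k => om (k + c))) => k'; rewrite addrAC (om_period dyn).
rewrite !omD (adj_sym t l i.+1); case: ifP => aji //=.
have := dyn_s_sum aji; case: (ltngtP i j) => [ij|ij|E].
- rewrite (shift_lt ij) (shift_gt ij) /= !addn0 add0n => h.
  have -> : n' + xlow t l j.+1 + (mult_dk j i * D i)%:Z = n' + yup t l j.+1 by lia.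
  by rewrite ![om n == _]eq_sym.
- rewrite (shift_lt ij) (shift_gt ij) /= !addn0 add0n !om_flip => h.
  by have -> : n' - yup t l i.+1 + (mult_dk j i * D i)%:Z = n' - xlow t l i.+1 by lia.
- by move: ji; rewrite (val_inj E) eqxx.
Qed.

Lemma om_fix a c : (om (Posz a + c) == a) = (N%:Z %| c)%Z.
Proof.
rewrite -{2}(om_dyn_id a).
by rewrite [LHS](om_eq dyn (Posz a + c) (Posz a)) addrAC subrr add0r.
Qed.

(** All offsets are smaller than N in absolute value, so arrows joining equal times come from
    offsets that are literally 0. This decides the membership tests in [Fdef]. *)
Lemma edge_num i j : adj t l i.+1 j.+1 -> (j < i)%N ->
  (N%:Z %| xlow t l i.+1)%Z = (xlow t l i.+1 == 0) /\ (N%:Z %| yup t l i.+1)%Z = false.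
Proof.
move=> aij ji; have glt := dyn_gD_lt aij.
have small (c : nat) : (0 < c < N)%N -> (N%:Z %| c%:Z)%Z = false.
  by move=> h; rewrite dvdzE /= gtnNdvd //; lia.
have DN : (D i < N)%N.
  by have := dyn_P_gt1 i; have := divnK (dyn_dvd i); have := dsc_gt0 i; nia.
case: (edge_dk aij ji) => -[-> -> h [E _ _]]; rewrite ?dvdz0 ?eqxx.
- by rewrite small // DN andbT dsc_gt0.
- have N2 : (1 < N)%N by move: glt; rewrite E; case: h => _ ->; lia.
  by rewrite (small 1%N) //; have := small 1%N N2; rewrite !dvdzE /= => ->.
- by rewrite (small 2%N) //; case: h => <- _; rewrite dsc_gt0.
- by rewrite (small 3%N) //; case: h => <- _; rewrite dsc_gt0.
Qed.

Lemma narrows_gt0 (v : V l N) j : (0 < narrows v (j, v.2))%N =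
  [&& adj t l v.1.+1 j.+1, (j < v.1)%N & xlow t l v.1.+1 == 0].
Proof.
case: v => i k; rewrite /narrows /= !om_fix.
have DN : (N%:Z %| (D i)%:Z)%Z = false.
  have h : (0 < D i < N)%N.
    by have := dyn_P_gt1 i; have := divnK (dyn_dvd i); have := dsc_gt0 i; nia.
  by rewrite dvdzE /= gtnNdvd //; lia.
rewrite DN andbF add0n (adj_sym t l j.+1); case aij: (adj _ _ _ _) => //=.
case: (ltngtP j i) => [ji|ij|E] //=.
- by have [-> _] := edge_num aij ji; rewrite addn0 lt0b.
- by rewrite adj_sym in aij; have [_ ->] := edge_num aij ij.
Qed.

Lemma narrows_gt0_r (v : V l N) j : (0 < narrows (j, v.2) v)%N =
  [&& adj t l v.1.+1 j.+1, (v.1 < j)%N & xlow t l j.+1 == 0].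
Proof.
by have := narrows_gt0 (j, v.2) v.1; rewrite /= -surjective_pairing (adj_sym t l j.+1).
Qed.

End Instance.

Lemma Fgen_def t l (vt : valid_type t l) (K : fieldType) (Y : nat -> int -> K)
    (out inn : pred nat) (i : 'I_l) (n : int) :
  (forall j : 'I_l, out j.+1 = [&& adj t l i.+1 j.+1, (j < i)%N & xlow t l i.+1 == 0]) ->
  (forall j : 'I_l, inn j.+1 = [&& adj t l i.+1 j.+1, (i < j)%N & xlow t l j.+1 == 0]) ->
  (forall j : 'I_l, adj t l i.+1 j.+1 -> xlow t l (maxn i j).+1 = 0 /\ mult_dk t l i j = 1%N) ->
  (\prod_(j <- iota 1 l | out j) Y j (n + (dsc t l j)%:Z)) * (\prod_(j <- iota 1 l | inn j) Y j n) =
  \prod_(j < l | adj t l i.+1 j.+1)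
     \prod_(k < mult_dk t l i j) Y j.+1 (n + shift_dk t l i j + (k.+1 * dsc t l j.+1)%:Z).
Proof.
move=> outE innE simple; rewrite !big_iota1 [RHS](bigID (fun j : 'I_l => (j < i)%N)) /=; congr (_ * _).
  rewrite (eq_bigl (fun j : 'I_l => adj t l i.+1 j.+1 && (j < i)%N)) => [|j]; last first.
    rewrite outE; case aij: (adj _ _ _ _) => //=; case ji: (j < i)%N => //=.
    by have [] := simple _ aij; rewrite (maxn_idPl (ltnW ji)) => -> _; rewrite eqxx.
  apply: eq_bigr => j /andP[aij ji]; have [] := simple _ aij.
  by rewrite (maxn_idPl (ltnW ji)) (shift_lt _ ji) => -> ->; rewrite big_ord1 addr0 mul1n.
have gt_of (j : 'I_l) : adj t l i.+1 j.+1 -> ~~ (j < i)%N -> (i < j)%N.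
  move=> aij; rewrite -leqNgt leq_eqVlt => /orP[/eqP /val_inj E|//].
  by move: aij; rewrite E adj_irr.
rewrite (eq_bigl (fun j : 'I_l => adj t l i.+1 j.+1 && ~~ (j < i)%N)) => [|j]; last first.
  rewrite innE; case aij: (adj _ _ _ _) => //=; case ji: (j < i)%N => /=.
    by rewrite ltnNge (ltnW ji).
  have ij := gt_of _ aij (negbT ji); rewrite ij /=.
  by have [] := simple _ aij; rewrite (maxn_idPr (ltnW ij)) => -> _; rewrite eqxx.
apply: eq_bigr => j /andP[aij nji]; have ij := gt_of _ aij nji.
have [] := simple _ aij; rewrite (maxn_idPr (ltnW ij)) => x0 g1.
have aji : adj t l j.+1 i.+1 by rewrite adj_sym.
rewrite g1 (shift_gt _ ij) big_ord1 mul1n; congr Y.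
suff -> : yup t l j.+1 = (dsc t l j.+1)%:Z by rewrite subrK.
case: (edge_dk vt aji ij) => -[xE yE h _]; rewrite yE.
- by [].
- by move: xE; rewrite x0.
- by case: h => ->.
- by case: h => ->.
Qed.

(** The exceptional formulas sit exactly at the labels having an edge with shifted arrows or a
    window of several factors; every other label satisfies the condition of [Fgen_def]. *)
Lemma Fgen_eq t l (vt : valid_type t l) (K : fieldType) (Y : nat -> int -> K)
    (out inn : pred nat) (i : 'I_l) (n : int) :
  (forall j c, ~~ (0 < j <= l)%N -> Y j c = 1) ->
  (forall j : 'I_l, out j.+1 = [&& adj t l i.+1 j.+1, (j < i)%N & xlow t l i.+1 == 0]) ->
  (forall j : 'I_l, inn j.+1 = [&& adj t l i.+1 j.+1, (i < j)%N & xlow t l j.+1 == 0]) ->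
  Fgen t l Y out inn i.+1 n = \prod_(j < l | adj t l i.+1 j.+1)
     \prod_(k < mult_dk t l i j) Y j.+1 (n + shift_dk t l i j + (k.+1 * dsc t l j.+1)%:Z).
Proof.
move=> Y1 outE innE; have FD := Fgen_def vt Y n outE innE.
pose G := \prod_(j < l | adj t l i.+1 j.+1)
     \prod_(k < mult_dk t l i j) Y j.+1 (n + shift_dk t l i j + (k.+1 * dsc t l j.+1)%:Z).
pose lo := \prod_(k < `|yup t l i.+1 - xlow t l i.+1| %/ dsc t l i)
     Y i (n + xlow t l i.+1 + (k.+1 * dsc t l i)%:Z).
pose up := \prod_(k < `|yup t l i.+2 - xlow t l i.+2| %/ dsc t l i.+2)
     Y i.+2 (n - yup t l i.+2 + (k.+1 * dsc t l i.+2)%:Z).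
have chainE : is_chain t -> G = (if (0 < i)%N then lo else 1) * (if (i.+1 < l)%N then up else 1).
  move=> ct; rewrite /G (chain_prod (fun j => \prod_(k < mult_dk t l i j)
     Y j.+1 (n + shift_dk t l i j + (k.+1 * dsc t l j.+1)%:Z)) i ct).
  rewrite /mult_dk /shift_dk; congr (_ * _); last first.
    by case: ifP => // _; rewrite (maxn_idPr (leqnSn i)) ifF //; lia.
  by case: posnP => // i0; rewrite (maxn_idPl (leq_pred i)) prednK // leqnn.
rewrite -/G in FD *.
have lti := ltn_ord i.
have ac (j : 'I_l) : is_chain t -> adj t l i.+1 j.+1 -> (j.+1 == i :> nat) || (j == i.+1 :> nat).
  by move=> ct; rewrite (adj_chain ct) ?eqSS //; have := ltn_ord j; lia.
case: t vt @G @lo @up FD chainE ac {outE innE} => vt G lo up FD chainE ac; rewrite /Fgen.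
- by apply: FD => j _.
- have l2 : (2 <= l)%N := vt; have [E|NE] := eqVneq i.+1 l.
    rewrite chainE // E ltnn /up /lo /yup /xlow /dsc E eqxx ifT; last by lia.
    have -> : ((i : nat) == l) = false by lia.
    rewrite big_ord1 mulr1 [Y l.+1 _]Y1 ?mulr1; last by lia.
    have -> : l.-1 = i by lia.
    by congr Y; rewrite /= mul1n -addrA.
  have [E|NE'] := eqVneq i.+1 l.-1; last first.
    apply: FD => j /(ac j isT) h; have lj := ltn_ord j; rewrite /mult_dk /xlow /yup /dsc.
    rewrite ifF; last by lia.
    by rewrite !ifF //; lia.
  have E2 : i.+2 = l by lia.
  rewrite chainE // /up /lo /yup /xlow /dsc (negPf NE) E2 eqxx.
  have -> : ((i : nat) == l) = false by lia.
  rewrite leqnn.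
  rewrite !big_ord_recr !big_ord0 /= !mul1r addr0.
  have -> : n - 1 + 1%N%:Z = n by lia.
  have -> : n - 1 + 2%N%:Z = n + 1 by lia.
  case: posnP => [->|_]; last by rewrite mul1n mulrA.
  by rewrite [Y 0%N _]Y1 // !mul1r.
- have l2 : (2 <= l)%N := vt; have [E|NE] := eqVneq i.+1 l.
    rewrite chainE // E ltnn /lo /yup /xlow /dsc E eqxx ifT; last by lia.
    have -> : ((i : nat) == l) = false by lia.
    have -> : l.-1 = i by lia.
    by rewrite !big_ord_recr !big_ord0 /= !mul1r addr0 mulr1.
  apply: FD => j /(ac j isT) h; have lj := ltn_ord j; rewrite /mult_dk /xlow /yup /dsc.
  split=> //; have [E|NE2] := eqVneq j.+1 l.
    have -> : (maxn i j).+1 = l by lia.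
    by rewrite eqxx.
  have -> : ((maxn i j).+1 == l) = false by lia.
  by [].
- by apply: FD => j _.
- by apply: FD => j _.
- have l4 : l = 4%N := eqP vt.
  have [E|N3] := eqVneq i.+1 3%N.
    have E2 : nat_of_ord i = 2%N by lia.
    have il : (i.+1 < l)%N by lia.
    have i0 : (0 < i)%N by lia.
    rewrite chainE // il i0 /lo /up E2 /= !big_ord1 /=.
    have -> : n - 1 + 2%N%:Z = n + 1 by lia.
    by have -> : n - 1 + 1%N%:Z = n by lia.
  have [E|N2] := eqVneq i.+1 2%N.
    have E2 : nat_of_ord i = 1%N by lia.
    have il : (i.+1 < l)%N by lia.
    have i0 : (0 < i)%N by lia.
    rewrite chainE // il i0 /lo /up E2 /= !big_ord_recr !big_ord0 /= !mul1r addr0.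
    have -> : n - 1 + 2%N%:Z = n + 1 by lia.
    have -> : n - 1 + 1%N%:Z = n by lia.
    by rewrite mulrA.
  apply: FD => j /(ac j isT) h; have lj := ltn_ord j.
  have ij : (nat_of_ord i = 0 /\ nat_of_ord j = 1 \/ nat_of_ord i = 3 /\ nat_of_ord j = 2)%N by lia.
  by rewrite /mult_dk; case: ij => -[-> ->].
- have l2 : l = 2%N := eqP vt.
  have [E|N2] := eqVneq i.+1 2%N.
    have E2 : nat_of_ord i = 1%N by lia.
    have il : (i.+1 < l)%N = false by lia.
    have i0 : (0 < i)%N by lia.
    by rewrite chainE // il i0 /lo E2 /= !big_ord_recr !big_ord0 /= !mul1r addr0 mulr1.
  apply: FD => j /(ac j isT) h; have lj := ltn_ord j.
  have [i0 j1] : (nat_of_ord i = 0 /\ nat_of_ord j = 1)%N by lia.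
  by rewrite /mult_dk i0 j1.
Qed.

(** * Generated subfields and the intertwining relation *)

Section GeneratedSubfield.
Variables (I : Type) (A : ratfun I).
Local Notation K := (rf_K A).
Local Notation ev := (@rf_ev I A).
Implicit Types (h k : I -> K) (x y z : K).

Lemma ev_ext h k p : h =1 k -> ev h p = ev k p.
Proof.
move=> hk; elim/rf_ind: p => [c|v|p q Pp Pq|p q Pp Pq].
- by rewrite !rf_evC.
- by rewrite !rf_evX.
- by rewrite !rmorphD Pp Pq.
- by rewrite !rmorphM Pp Pq.
Qed.

Lemma rmorph_ev (phi : {rmorphism K -> K}) h p : (forall c, phi (rcst c) = rcst c) ->
  phi (ev h p) = ev (phi \o h) p.
Proof.
move=> phic; elim/rf_ind: p => [c|v|p q Pp Pq|p q Pp Pq].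
- by rewrite !rf_evC; apply: phic.
- by rewrite !rf_evX.
- by rewrite !rmorphD Pp Pq.
- by rewrite !rmorphM Pp Pq.
Qed.

Definition gen h z := exists p q, ev h q != 0 /\ z = ev h p / ev h q.

Lemma gen_ev h p : gen h (ev h p).
Proof. by exists p, 1; rewrite rmorph1 oner_neq0 divr1. Qed.

Lemma gen_add h x y : gen h x -> gen h y -> gen h (x + y).
Proof.
move=> [p [q [q0 ->]]] [p' [q' [q0' ->]]]; exists (p * q' + p' * q), (q * q').
by rewrite rmorphD !rmorphM /= mulf_neq0 // addf_div.
Qed.

Lemma gen_mul h x y : gen h x -> gen h y -> gen h (x * y).
Proof.
move=> [p [q [q0 ->]]] [p' [q' [q0' ->]]]; exists (p * p'), (q * q').
by rewrite !rmorphM /= mulf_neq0 // mulf_div.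
Qed.

Lemma gen_inv h x : gen h x -> gen h x^-1.
Proof.
move=> [p [q [q0 ->]]]; have [p0|p0] := eqVneq (ev h p) 0; last first.
  by exists q, p; rewrite p0 invf_div.
by exists p, q; rewrite p0 mul0r invr0.
Qed.

Lemma gen1 h : gen h 1.
Proof. by rewrite -(rmorph1 (ev h)); apply: gen_ev. Qed.

Lemma gen_prod h (J : Type) (r : seq J) (Q : pred J) (F : J -> K) :
  (forall i, Q i -> gen h (F i)) -> gen h (\prod_(i <- r | Q i) F i).
Proof. by move=> H; apply: (big_ind (gen h)) => //; [apply: gen1 | apply: gen_mul]. Qed.

Lemma gen_cyc_sum h (q : int -> K) D P n : (forall m, gen h (q m)) -> gen h (cyc_sum q D P n).
Proof.
move=> gq; apply: gen_add; first exact: gen1.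
apply: (big_ind (gen h)) => [||k _]; last by apply: gen_prod.
- by rewrite -(rmorph0 (ev h)); apply: gen_ev.
- exact: gen_add.
Qed.

Lemma gen_trans h k z : (forall v, gen h (k v)) -> gen k z -> gen h z.
Proof.
move=> hk; have gp p : gen h (ev k p).
  elim/rf_ind: p => [c|v|p q Pp Pq|p q Pp Pq].
  - by rewrite rf_evC -(rf_evC h); apply: gen_ev.
  - by rewrite rf_evX.
  - by rewrite rmorphD; apply: gen_add.
  - by rewrite rmorphM; apply: gen_mul.
by case=> p [q [_ ->]]; apply: gen_mul; last apply: gen_inv.
Qed.

Lemma gen_rmorph (phi : {rmorphism K -> K}) h z : (forall c, phi (rcst c) = rcst c) ->
  gen h z -> gen (phi \o h) (phi z).
Proof.
move=> phic [p [q [q0 ->]]]; exists p, q.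
by rewrite -!(rmorph_ev _ _ phic) fmorph_eq0 q0 fmorph_div.
Qed.

End GeneratedSubfield.

Section Intertwining.
Variables (l N : nat) (X : dynkin l N) (A : ratfun (V l N)).
Local Notation K := (rf_K A).
Local Notation adj := (dk_adj X).
Local Notation D := (dk_D X).
Local Notation s := (dk_s X).
Local Notation g := (dk_g X).
Local Notation om := (ordmod (dk_n0 X)).
Local Notation P i := (N %/ D i)%N.
Implicit Types (i j : 'I_l) (n m : int).

(** beta sends X to 1 / a = q, so it is the partial substitution given by [qv]. *)
Definition qv (v : V l N) : K := qq X A v.1 (Posz v.2).

Lemma qvE i n : qv (i, om n) = qq X A i n.
Proof.
apply: (periodic_om X (u := qq X A i)) => m.
by have := periodic_qq X A i m; rewrite dk_PD.
Qed.

Lemma gen_refl i z : gen (fun v => (qv v)^-1) z -> gen (fun v => (qv v)^-1) (refl X i z).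
Proof.
set h := fun v => (qv v)^-1; move=> gz.
apply: gen_trans (gen_rmorph (phi := refl X (A := A) i) (refl_cst X i) gz) => v.
have gq j n : gen h (qq X A j n).
  by rewrite -qvE -[qv _]invrK -[(qv _)^-1](rf_evX h (j, om n)); apply: gen_inv; apply: gen_ev.
have gf n : gen h (ff X A i n) by apply: gen_cyc_sum => m; apply: gq.
rewrite /= {2}/h fmorphV /=; apply: gen_inv; rewrite /qv; have [->|vi] := eqVneq v.1 i.
  by rewrite refl_qq; apply: gen_mul => //; apply: gen_inv; apply: gen_mul.
rewrite (refl_qq_ne _ _ _ vi); apply: gen_mul => //; case: ifP => _; last exact: gen1.
by apply: gen_prod => k _; apply: gen_mul; [apply: gen_mul | apply: gen_inv].
Qed.

Lemma prel_mut_img i (h Y Z : V l N -> K) : (forall v, prel h (Y v) (Z v)) ->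
  (forall v, sf (Z v)) -> forall v, prel h (mut_img X i Y v) (mut_img X i Z v).
Proof.
move=> YZ sZ v.
have sq n : sf (xq X i Z n) by apply: sZ.
have sfx n : sf (xf X i Z n) by apply: sf_cyc_sum.
have pq n : prel h (xq X i Y n) (xq X i Z n) by apply: YZ.
have pf n : prel h (xf X i Y n) (xf X i Z n).
  apply: prel_add; first exact: prel_1.
  by apply: prel_sum => k _; apply: prel_prod => k' _.
rewrite /mut_img; case: ifP => _.
  apply: prel_mul => //; apply: prel_inv; last exact: prel_mul.
  by apply: mulf_neq0; apply: sf_neq0.
apply: prel_mul => //; rewrite /xoff; case: ifP => _; last exact: prel_1.
apply: prel_prod => k _; apply: prel_mul; first exact: prel_mul.
by apply: prel_inv => //; apply: sf_neq0.
Qed.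

Lemma mut_img_qv i v : mut_img X i qv v = refl X i (qv v).
Proof.
have xqE n : xq X i qv n = qq X A i n by apply: qvE.
have xfE n : xf X i qv n = ff X A i n.
  by congr (1 + _); apply: eq_bigr => k _; apply: eq_bigr => k' _; apply: xqE.
rewrite /mut_img; have [vi|vi] := eqVneq v.1 i.
  by rewrite /xsame !xfE xqE /qv vi refl_qq.
rewrite [in RHS]/qv (refl_qq_ne _ _ _ vi) -/(qv v); congr (_ * _).
by rewrite /xoff; case: ifP => // _; apply: eq_bigr => k _; rewrite !xfE xqE.
Qed.

Lemma sf_mut_img i (Y : V l N -> K) : (forall v, sf (Y v)) -> forall v, sf (mut_img X i Y v).
Proof.
move=> sY v; have sfx n : sf (xf X i Y n) by apply: sf_cyc_sum => m; apply: sY.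
rewrite /mut_img; case: ifP => _; first by apply: sf_div => //; apply: sf_mul => //; apply: sY.
apply: sf_mul => //; rewrite /xoff; case: ifP => _; last exact: sf_1.
by apply: sf_prod => k _; apply: sf_div => //; apply: sf_mul => //; apply: sY.
Qed.

Lemma cyc_prod_var_neq1 i n : cyc_prod (xq X i (rvar A)) (D i) (P i) n != 1.
Proof.
pose w (v : V l N) : nat := 1.
have dA : deg_is w (cyc_prod (xq X i (rvar A)) (D i) (P i) n) (\sum_(k < P i) 1).
  by apply: deg_is_prod => k _; apply: deg_is_var.
apply/eqP => E; move: dA; rewrite E => /(deg_is_fun (deg_is1 A w)).
rewrite sumr_const card_ord; have := dk_P_gt1 X i; lia.
Qed.

(* With y = 1 and F = X on one cycle, the X-variables transform like the quotients
   q = F / (y y+) under the reflection of y, whose involutivity carries over. *)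
Lemma mut_imgK i v : mut_img X i (mut_img X i (rvar A)) v = rvar A v.
Proof.
pose Y := rvar A; pose Y' := mut_img X i Y.
have P0 := dk_P_gt0 X i.
have sY v' : sf (Y v') by apply: sf_var.
have sY' : forall v', sf (Y' v') by apply: sf_mut_img.
pose y (n : int) : K := 1.
pose F := xq X i Y.
pose Q (u : int -> K) n := F n / (u n * u (n + (D i)%:Z)).
pose Fs u := cyc_sum (Q u) (D i) (P i).
have py : periodic (D i) (P i) y by [].
have pF : periodic (D i) (P i) F by move=> n; rewrite dk_PD /F /xq om_period.
have y0 n : y n != 0 by apply: oner_neq0.
have F0 n : F n != 0 by apply: sf_neq0; apply: sY.
have RQ u : periodic (D i) (P i) u -> (forall n, u n != 0) -> (forall n, Fs u n != 0) ->
    forall n, Q (refl_y (D i) (P i) u F) n =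
      Fs u n / (Fs u (n - (D i)%:Z - (D i)%:Z) * Q u (n - (D i)%:Z)).
  by move=> pu u0 fu n; apply: refl_q.
have RY u : (forall n, u n != 0) -> (forall n, Fs u n != 0) ->
    forall n, refl_y (D i) (P i) u F (n + (D i)%:Z) =
      u (n + (D i)%:Z) * (Q u n * Fs u (n - (D i)%:Z) / Fs u n).
  move=> u0 fu n; have H m : refl_y (D i) (P i) u F m =
      u m * (Q u (m - (D i)%:Z) * Fs u (m - (D i)%:Z - (D i)%:Z) / Fs u (m - (D i)%:Z)).
    exact: refl_yE.
  by rewrite H addrK.
have qF n : Q y n = F n by rewrite /Q mulr1 divr1.
have fE n : Fs y n = xf X i Y n.
  by congr (1 + _); apply: eq_bigr => k _; apply: eq_bigr => k' _; rewrite qF.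
have fx0 n : xf X i Y n != 0 by apply: sf_neq0; apply: sf_cyc_sum => m; apply: sY.
have f0 n : Fs y n != 0 by rewrite fE.
have A1 n : cyc_prod (Q y) (D i) (P i) n != 1.
  rewrite (_ : cyc_prod _ _ _ _ = cyc_prod F (D i) (P i) n); first exact: cyc_prod_var_neq1.
  by apply: eq_bigr => k _; rewrite qF.
pose y' := refl_y (D i) (P i) y F.
have y'0 n : y' n != 0 by apply: refl_y_neq0.
have y'E n : y' (n + (D i)%:Z) = xq X i Y n * xf X i Y (n - (D i)%:Z) / xf X i Y n.
  by rewrite /y' RY // mul1r !fE qF.
have q'E n : Q y' n = xsame X i Y n by rewrite /y' RQ // !fE qF.
have xq'E n : xq X i Y' n = xsame X i Y n.
  by rewrite /xq /Y' /mut_img /= eqxx xsame_om.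
have xf'E n : Fs y' n = xf X i Y' n.
  by congr (1 + _); apply: eq_bigr => k _; apply: eq_bigr => k' _; rewrite q'E xq'E.
have fx'0 n : xf X i Y' n != 0 by apply: sf_neq0; apply: sf_cyc_sum => m; apply: sY'.
have f'0 n : Fs y' n != 0 by rewrite xf'E.
have y''E n : refl_y (D i) (P i) y' F n = 1.
  have RI : let f' := Fs y' in f' (n - 2 * (D i)%:Z) / f' (n - (D i)%:Z) *
      (F (n - (D i)%:Z) / y' (n - (D i)%:Z)) = y n by apply: refl_involutive.
  exact: RI.
have y''M n : y' (n + (D i)%:Z) *
    (xq X i Y' n * xf X i Y' (n - (D i)%:Z) / xf X i Y' n) = 1.
  by rewrite -(y''E (n + (D i)%:Z)) RY // !xf'E q'E xq'E.
have py' : periodic (D i) (P i) y'.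
  move=> n; have := y'E (n - (D i)%:Z + (P i * D i)%:Z); rewrite addrAC subrK => ->.
  have := y'E (n - (D i)%:Z); rewrite subrK => ->.
  have pxf m : xf X i Y (m + (P i * D i)%:Z) = xf X i Y m by exact: cyc_sum_periodic.
  by rewrite [_ + (P i * D i)%:Z - _]addrAC !pxf; congr (_ * _ / _); apply: pF.
rewrite -/Y -/Y' /mut_img; have [vi|vi] := eqVneq v.1 i.
  have E := RQ _ py' y'0 f'0 (Posz v.2); rewrite !xf'E q'E -xq'E in E.
  rewrite /xsame -E /Q !y''E mulr1 divr1 /F /xq om_val_id -vi.
  by rewrite -surjective_pairing.
have -> : Y' v = Y v * xoff X i Y v.1 (Posz v.2) by rewrite /Y' /mut_img (negPf vi).
rewrite -mulrA -[RHS]mulr1; congr (_ * _).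
rewrite /xoff; case: ifP => _; last by rewrite mulr1.
rewrite -big_split /= big1 // => k _; rewrite -y'E; exact: y''M.
Qed.

Lemma mut_img_indep i : alg_indep (mut_img X i (rvar A)).
Proof.
apply: (alg_indep_inverse (k := mut_img X i (rvar A))) => v.
rewrite -[X in prel _ _ X](mut_imgK i); apply: prel_mut_img => v'; first exact: prel_var.
by apply: sf_mut_img => v''; apply: sf_var.
Qed.

(** On variables both sides are the same formula [mut_img], evaluated at X and at q. For fractions,
    [mut_img_indep] makes R_i^* multiplicative, and injectivity of [refl] keeps the image of the
    denominator nonzero. *)
Theorem intertwining i x z : prel qv x z ->
  prel qv (rsubst (mut_img X i (rvar A)) x) (refl X i z).
Proof.
move=> [p [q [q0 -> ->]]].
have ind := @mut_img_indep i.
have p1 r : prel qv (rf_ev (mut_img X i (rvar A)) r) (refl X i (rf_ev qv r)).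
  rewrite rmorph_ev; last exact: refl_cst.
  apply: prel_ev => v /=; rewrite -mut_img_qv; apply: prel_mut_img => v'; first exact: prel_var.
  exact: sf_qq.
have -> : rsubst (mut_img X i (rvar A)) (rf_frac A p / rf_frac A q) =
    rf_ev (mut_img X i (rvar A)) p / rf_ev (mut_img X i (rvar A)) q.
  apply: prel_rsubstE => //; apply: prel_mul; first exact: prel_pol.
  apply: prel_inv; last exact: prel_pol.
  by apply: alg_indep_neq0 => //; apply: contraNneq q0 => ->; rewrite rmorph0.
rewrite fmorph_div; apply: prel_mul; first exact: p1.
by apply: prel_inv; [rewrite fmorph_eq0 | exact: p1].
Qed.
End Intertwining.

(** * The concrete field of fractions of complex polynomials *)

Section Concrete.
Variables (l N : nat).

Fact cst_is_zmod_morphism : zmod_morphism (@cst l N).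
Proof. by move=> a b; rewrite /cst mpolyCB tofracB. Qed.
Fact cst_is_monoid_morphism : monoid_morphism (@cst l N).
Proof. by split=> [|a b]; rewrite /cst ?mpolyC1 ?tofrac1 // mpolyCM tofracM. Qed.
HB.instance Definition _ := GRing.isZmodMorphism.Build CC (RF l N) (@cst l N) cst_is_zmod_morphism.
HB.instance Definition _ := GRing.isMonoidMorphism.Build CC (RF l N) (@cst l N) cst_is_monoid_morphism.
HB.instance Definition _ h := GRing.RMorphism.copy (@mev l N h) (mmap (@cst l N) (fun k => h (enum_val k))).

Definition pol_grade (w : V l N -> nat) : Pol l N -> {poly (Pol l N)} :=
  mmap (polyC \o @mpolyC _ CC) (fun k => ('X_k)%:P * 'X^(w (enum_val k))).
HB.instance Definition _ w := GRing.RMorphism.copy (pol_grade w)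
  (mmap (polyC \o @mpolyC _ CC) (fun k => ('X_k)%:P * 'X^(w (enum_val k)))).

Fact pol_ind (Q : Pol l N -> Prop) :
  (forall c, Q c%:MP) -> (forall v : V l N, Q 'X_(enum_rank v)) ->
  (forall p q, Q p -> Q q -> Q (p + q)) ->
  (forall p q, Q p -> Q q -> Q (p * q)) -> forall p, Q p.
Proof.
move=> QC QX QD QM; elim/mpolyind => [|c mo p _ _ Qp]; first by rewrite -mpolyC0.
apply: (QD) => //; rewrite -mul_mpolyC; apply: (QM) => //; rewrite mpolyXE_id.
apply: (big_ind Q) => [|//|k _]; first by rewrite -mpolyC1.
elim: (mo k) => [|e IH]; first by rewrite expr0 -mpolyC1.
by rewrite exprS; apply: (QM) => //; rewrite -(enum_valK k).
Qed.

Fact RF_repr (x : RF l N) : x = (\n_(repr x))%:F / (\d_(repr x))%:F.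
Proof.
have d0 : \d_(repr x) != 0 by exact: denom_ratioP.
apply: (mulIf (x := (\d_(repr x))%:F)); first by rewrite tofrac_eq0.
rewrite mulfVK ?tofrac_eq0 // -{1}[x]reprK.
rewrite !piE /= /FracField.mulf /=; apply/eqP; rewrite FracField.equivf_def.
by rewrite !numden_Ratio ?mulf_neq0 ?oner_neq0 ?mulr1 ?mul1r // 1?mulrC ?oner_neq0.
Qed.

Fact RF_den (x : RF l N) : \d_(repr x) != 0 :> Pol l N.
Proof. exact: denom_ratioP. Qed.

Fact CC_char0 n : n.+1%:R != 0 :> CC.
Proof. by rewrite (@Num.Theory.pnatr_eq0 (complex Rdefinitions.R)). Qed.

Fact mevC h (c : CC) : @mev l N h c%:MP = (c%:MP : Pol l N)%:F.
Proof. exact: mmapC. Qed.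
Fact mevX h v : @mev l N h 'X_(enum_rank v) = h v.
Proof. by rewrite /mev mmapX mmap1U enum_rankK. Qed.
Fact gradeC w (c : CC) : pol_grade w c%:MP = (c%:MP)%:P.
Proof. exact: mmapC. Qed.
Fact gradeX w v : pol_grade w 'X_(enum_rank v) = ('X_(enum_rank v))%:P * 'X^(w v).
Proof. by rewrite /pol_grade mmapX mmap1U enum_rankK. Qed.
Fact at1X (v : V l N) : meval (fun=> 1) ('X_(enum_rank v) : Pol l N) = 1.
Proof. by rewrite mevalXU. Qed.
Fact mpolyCN1 : (-1 : CC)%:MP = -1 :> Pol l N.
Proof. by rewrite mpolyCN mpolyC1. Qed.
Fact frac_eq0 (p : Pol l N) : (p%:F == 0) = (p == 0).
Proof. exact: tofrac_eq0. Qed.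

Definition RF_ratfun : ratfun (V l N) :=
  @RatFun (V l N) CC (Pol l N) (RF l N) (@mpolyC (nv l N) CC) (fun v => 'X_(enum_rank v))
    (@FracField.tofrac (Pol l N)) (fun x => \n_(repr x)) (fun x => \d_(repr x))
    (@mev l N) pol_grade (meval (fun=> 1)) CC_char0 pol_ind (mpolyC0 _ _) mpolyCN1
    frac_eq0 RF_repr RF_den mevC mevX gradeC gradeX at1X.

End Concrete.

Lemma filter_mod_iota p d r : (r < d)%N ->
  [seq n <- iota 0 (p * d) | (n %% d == r)%N] = [seq (r + k * d)%N | k <- iota 0 p].
Proof.
move=> rd; apply: (irr_sorted_eq ltn_trans ltnn).
- exact/(sorted_filter ltn_trans)/iota_ltn_sorted.
- apply: (homo_sorted (e := ltn)) (iota_ltn_sorted 0 p) => a b /= ab.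
  by rewrite ltn_add2l ltn_pmul2r //; lia.
move=> n; rewrite mem_filter mem_iota add0n /=; apply/andP/mapP => [[/eqP E np]|[k]].
  exists (n %/ d)%N; last by rewrite addnC -E -divn_eq.
  by rewrite mem_iota add0n leq0n /= ltn_divLR //; lia.
rewrite mem_iota add0n => /andP[_ kp] ->.
split; first by rewrite addnC modnMDl modn_small.
have : (k.+1 * d <= p * d)%N by rewrite leq_mul2r kp orbT.
by rewrite mulSn; lia.
Qed.

(** * Translation of the given definitions and conclusion *)

Section Main.
Variables (t : ltype) (l m : nat).
Hypothesis vt : valid_type t l.
Hypothesis m_gt1 : (1 < m)%N.
Local Notation N := (Nsz t m).
Local Notation X := (dyn vt m_gt1).
Local Notation A := (RF_ratfun l N).
Implicit Types (i j : 'I_l) (v : V l N).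

Lemma yvE v j (n : int) : yv v j.+1 n = yy X A j n.
Proof. by rewrite /yv ltn_ord (vtxE vt m_gt1). Qed.

Lemma yy_self v : yy X A v.1 (Posz v.2) = var v.
Proof. by rewrite /yy om_val_id -surjective_pairing. Qed.

Lemma Fy_FF v : Fy t v = FF X A v.1 (Posz v.2).
Proof.
have -> : Fy t v = Fgen t l (yv v) (fun j : nat => (v, vtx v j (time v)) \in arrows t v)
  (fun j : nat => (vtx v j (time v), v) \in arrows t v) v.1.+1 (Posz v.2) by [].
have vj j : vtx v j.+1 (time v) = (j, v.2) by rewrite (vtxE vt m_gt1) (om_dyn_id vt).
rewrite (Fgen_eq vt).
- by apply: eq_bigr => j _; apply: eq_bigr => k _; rewrite yvE.
- by move=> j c h; rewrite /yv ifN.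
- by move=> j; rewrite vj -has_pred1 has_count (count_arrows vt m_gt1) (narrows_gt0 vt).
- by move=> j; rewrite vj -has_pred1 has_count (count_arrows vt m_gt1) (narrows_gt0_r vt).
Qed.

Lemma ay_qv v : ay t v = (qv X A v)^-1.
Proof. by rewrite /ay /qv /qq invf_div -Fy_FF yy_self yvE. Qed.

Lemma fy_ff v : fy t v = ff X A v.1 (Posz v.2).
Proof.
congr (1 + _); apply: eq_bigr => k _; rewrite -prodfV; apply: eq_bigr => k' _.
by rewrite ay_qv invrK (vtxE vt m_gt1) (qvE X).
Qed.

Lemma rimgE i v : rimg t i v = rimg_dk X A i v.
Proof.
rewrite /rimg /rimg_dk; case: eqP => // vi.
have fO n : ff X A i (Posz (ordmod (Ordinal (Nsz_gt0 vt m_gt1)) n)) = ff X A i n.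
  by apply: (periodic_om X (u := ff X A i)) => n'; apply: ff_period.
have FO n : FF X A i (Posz (ordmod (Ordinal (Nsz_gt0 vt m_gt1)) n)) = FF X A i n.
  by apply: (periodic_om X (u := FF X A i)) => n'; apply: FF_period.
by rewrite !(vtxE vt m_gt1) !fy_ff Fy_FF !fO FO.
Qed.

Lemma rmapE i z : rmap t i z = refl X (A := A) i z.
Proof. by congr (_ / _); apply: (ev_ext (A := A)) => v; apply: rimgE. Qed.

Lemma inCaE (z : RF l N) : inCa t z <-> gen (A := A) (fun v => (qv X A v)^-1) z.
Proof.
have E p : mev (@ay t l N) p = rf_ev (r := A) (fun v => (qv X A v)^-1) p.
  by apply: (ev_ext (A := A)) => v; apply: ay_qv.
by split=> -[p [q [q0 ->]]]; exists p, q; move: q0; rewrite !E.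
Qed.

Lemma beta_relE (x z : RF l N) : beta_rel t x z <-> prel (A := A) (qv X A) x z.
Proof.
have E p : mev (fun v => (@ay t l N v)^-1) p = rf_ev (r := A) (qv X A) p.
  by apply: (ev_ext (A := A)) => v; rewrite ay_qv invrK.
by split=> -[p [q [q0 -> ->]]]; exists p, q; move: q0; rewrite !E.
Qed.

Lemma bond_sym a b : bond t l a b = bond t l b a.
Proof. by rewrite /bond adj_sym; case: t => //; rewrite orbC. Qed.

Lemma mcoxE i j : mcox t l i.+1 j.+1 = cox X i j.
Proof.
rewrite /mcox /cox eqSS (_ : (i == j :> nat) = (i == j)) //; case: ifP => // _.
case: ifP => /= aij; last by rewrite /bond aij.
apply: (edge_sym vt (Q := fun i j => match bond t l i.+1 j.+1 with
  0 => 2 | 1 => 3 | 2 => 4 | _ => 6 end%N = longest_length (mult_dk t l i j * mult_dk t l j i))) aij.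
move=> {}i {}j aij ji; rewrite (bond_sym j.+1).
by case: (edge_dk vt aij ji) => -[_ _ _ [-> -> h]]; first [rewrite h | rewrite (proj1 h)].
Qed.

(** The index gamma starts at 1 and residues at 0, whence [r.+1]. The offset 2 matches the
    convention that a cycle has P + 2 vertices. *)
Lemma cycE i r : (r < dsc t l i.+1)%N ->
  cyc t N i r.+1 = cverts (N %/ dsc t l i.+1 - 2) (cvert X i r).
Proof.
move=> rd; set d := dsc t l i.+1 in rd *.
have P1 : (1 < N %/ d)%N := dk_P_gt1 X i.
have PD : (N %/ d * d)%N = N := dk_PD X i.
have E : [seq n : 'I_N <- enum 'I_N | (n %% d == r)%N] =
    [seq ordmod (dk_n0 X) (r%:Z + (k * d)%:Z) | k <- iota 0 (N %/ d)].
  apply: (inj_map val_inj); rewrite -map_comp.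
  have -> : [seq val n | n <- [seq n : 'I_N <- enum 'I_N | (n %% d == r)%N]] =
      [seq n <- iota 0 (N %/ d * d) | (n %% d == r)%N] by rewrite PD -val_enum_ord filter_map.
  rewrite filter_mod_iota //.
  apply/eq_in_map => k; rewrite mem_iota add0n => /andP[_ kp].
  have kN : (k.+1 * d <= N %/ d * d)%N by rewrite leq_mul2r kp orbT.
  rewrite PD mulSn in kN; have := om_val X (r%:Z + (k * d)%:Z).
  rewrite modz_small -?PoszD => [[<-]//|]; lia.
have PE : ((N %/ d - 2).+2 = N %/ d)%N by lia.
by rewrite /cverts PE /cyc [r.+1.-1]/= -/d E -map_comp.
Qed.

Lemma run_Riops i v : (run (Riops t N i) (@eps t l N, @var l N)).2 v = mut_img X i (rvar A) v.
Proof.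
have -> : Riops t N i = flatten [seq Rops (cverts (N %/ dk_D X i - 2) (cvert X i r))
    | r <- rev (iota 0 (dk_D X i))].
  rewrite /Riops (iotaDl 1 0) -map_rev -map_comp; congr flatten; apply/eq_in_map => r.
  by rewrite mem_rev mem_iota add0n => /andP[_ rd]; rewrite /= add1n cycE.
(* [Riops] runs the residues in decreasing order; [cycles_full] accepts them in any order. *)
have prs : perm_eq (rev (iota 0 (dk_D X i))) (iota 0 (dk_D X i)) by rewrite perm_rev.
have [_ H] := @cycles_full l N X (RF l N) (@sf _ A) (sf_1 A) (@sf_add _ A) (@sf_mul _ A)
  (@sf_inv _ A) (@sf_neq0 _ A) (@eps t l N) (eps_same vt m_gt1)
  (fun i j n n' => @eps_diff t l m vt m_gt1 i j n n') i (rvar A)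
  (rev (iota 0 (dk_D X i))) prs (@sf_var _ A).
exact: H.
Qed.

Lemma RstarE i x : Rstar t i x = rsubst (A := A) (mut_img X i (rvar A)) x.
Proof. by congr (_ / _); apply: (ev_ext (A := A)) => v; apply: run_Riops. Qed.

End Main.

Theorem theorem4p12 (t : ltype) (l m : nat)
  (Hl : valid_type t l) (Hm1 : (1 < m)%N) (Hm2 : (l.-1 < m)%N) :
  let N := Nsz t m in
  (* each r_i is a field endomorphism of C(y) over C (implicit in the paper) *)
  (forall i : 'I_l,
     [/\ {morph rmap t (N := N) i : x y / x + y},
         {morph rmap t (N := N) i : x y / x * y},
         rmap t (N := N) i 1 = 1
       & forall c : CC, rmap t i (cst l N c) = cst l N c]) /\
  (* r_i(C(a)) is contained in C(a) *)
  (forall (i : 'I_l) (z : RF l N), inCa t z -> inCa t (rmap t i z)) /\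
  (* r_i o beta = beta o R_i^* on C(X) *)
  (forall (i : 'I_l) (x z : RF l N),
     beta_rel t x z -> beta_rel t (Rstar t i x) (rmap t i z)) /\
  (* Coxeter relations (r_i o r_j)^{m_ij} = id *)
  (forall (i j : 'I_l) (z : RF l N),
     iter (mcox t l i.+1 j.+1) (rmap t i \o rmap t j) z = z).
Proof.
move=> N; have rE := @rmapE t l m Hl Hm1.
split=> [i|].
  split=> [x y|x y||c]; rewrite !rE.
  - exact: (rmorphD (refl (dyn Hl Hm1) (A := RF_ratfun l N) i)).
  - exact: (rmorphM (refl (dyn Hl Hm1) (A := RF_ratfun l N) i)).
  - exact: (rmorph1 (refl (dyn Hl Hm1) (A := RF_ratfun l N) i)).
  - exact: (refl_cst (dyn Hl Hm1) (A := RF_ratfun l N) i c).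
split=> [i z|]; first by rewrite rE => /(inCaE Hl Hm1) h; apply/(inCaE Hl Hm1)/gen_refl.
split=> [i x z|i j z].
  rewrite rE (RstarE Hl Hm1) => /(beta_relE Hl Hm1) h.
  by apply/(beta_relE Hl Hm1); apply: (intertwining i h).
rewrite (mcoxE Hl Hm1) -[RHS](cox_relation (dyn Hl Hm1) (A := RF_ratfun l N) i j).
by apply: eq_iter => x /=; rewrite !rE.
Qed.
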